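(* Let $n\ge 1$ and let $H\in\mathbb C[x,y]$ be a polynomial of degree $n+1$ transversal to infinity. Put $\nu=n(2n-1)$ and let $\omega_1,\dots,\omega_\nu$ be monomial polynomial 1-forms of degree $\le 2n$ such that $d\omega_1,\dots,d\omega_\nu$ form a basis of the linear space $\Lambda^2_{\le 2n}$ of polynomial 2-forms of degree $\le 2n$. Then there exist constant matrices $A,B\in\mathrm{Mat}_{\nu\times\nu}(\mathbb C)$ such that for any continuous family $\delta(t)$ of 1-cycles on the level curves $\{H=t\}\subset\mathbb C^2$, $t$ not a critical value of $H$, the column vector $X(t)=(X_1(t),\dots,X_\nu(t))$ of Abelian integrals $X_i(t)=\oint_{\delta(t)}\omega_i$ satisfies the system of linear ordinary differential equations $$(tE-A)\,\dot X=BX,$$ where $E$ is the identity matrix.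
   Context: The degree of a polynomial $k$-form on $\mathbb C^2$ ($k=0,1,2$) is by definition the maximal degree of its coefficients plus $k$; thus $\Lambda^2_{\le 2n}$ is spanned by the forms $x^ry^s\,dx\wedge dy$ with $r+s\le 2n-2$ and has dimension $n(2n-1)$. A polynomial $H$ is transversal to infinity if its principal (highest degree) homogeneous part is a product of pairwise non-proportional linear forms. A continuous family of cycles means a family that is locally constant (horizontal) with respect to the natural flat connexion on the first homology bundle of the level curves $H^{-1}(t)$ over the complement of the critical values of $H$ (in general multivalued in $t$). *)

(* Defs.v *)
From mathcomp Require Import all_boot all_order all_algebra.
From mathcomp Require Import all_classical all_reals all_analysis.
From mathcomp.real_closed Require Export complex.
(* The notations of mpoly clash with those of analysis. *)
From mathcomp.multinomials Require Export -(notations) freeg mpoly.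

Set Implicit Arguments.
Unset Strict Implicit.
Unset Printing Implicit Defensive.

Import Order.TTheory GRing.Theory Num.Theory.
Import numFieldNormedType.Exports.

Local Open Scope classical_set_scope.
Local Open Scope ring_scope.
Local Open Scope complex_scope.

Section PolynomialForms.
Variable R : realType.

Definition poly2 := mpoly 2 R[i].

Definition varx : 'I_2 := ord0.
Definition vary : 'I_2 := ord_max.

Definition linear_form (a b : R[i]) : poly2 :=
  a *: mpolyX _ (mnm1 varx) + b *: mpolyX _ (mnm1 vary).

(* [mmeasure mdeg f] is deg f + 1, and the form degree adds the rank of the
   form to the degree of the coefficients: [(P, Q)] is [P dx + Q dy], of degree
   [(maxn (deg P) (deg Q)).+1], and [f : poly2] also stands for [f dx /\ dy], of
   degree [(deg f).+2]. Zero forms get degree 0. *)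
Definition form1 : Type := poly2 * poly2.

Definition deg1 (w : form1) : nat :=
  maxn (mmeasure mdeg w.1) (mmeasure mdeg w.2).

Definition deg2 (f : poly2) : nat :=
  if f == 0 then 0%N else (mmeasure mdeg f).+1.

Definition d1 (w : form1) : poly2 := mderiv varx w.2 - mderiv vary w.1.

Definition monomial_form (w : form1) : Prop :=
  exists (c : R[i]) (m : multinom 2),
    w = (c *: mpolyX _ m, 0) \/ w = (0, c *: mpolyX _ m).

Definition basis_forms2 (d m : nat) (mu : 'I_m -> poly2) : Prop :=
  [/\ forall i, (deg2 (mu i) <= d)%N,
      forall c : 'I_m -> R[i], \sum_i c i *: mu i = 0 -> forall i, c i = 0 &
      forall f : poly2, (deg2 f <= d)%N ->
        exists c : 'I_m -> R[i], f = \sum_i c i *: mu i].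

Definition transversal_to_infinity (H : poly2) : Prop :=
  let d := (mmeasure mdeg H).-1 in
  exists l : 'I_d -> R[i] * R[i],
    pihomog mdeg d H = \prod_k linear_form (l k).1 (l k).2 /\
    forall j k, j != k -> forall c : R[i], l j <> c *: l k.

End PolynomialForms.

(* Points of C^2 are given by real coordinates ((Re x, Im x), (Re y, Im y)), so
   that smoothness is real smoothness between normed R-modules. *)
Local Notation C2 R := ((R * R) * (R * R))%type.

Section LevelCurves.
Variable R : realType.

Definition cplx (z : R * R) : R[i] := z.1 +i* z.2.

Definition eval2 (f : poly2 R) (p : C2 R) : R[i] :=
  meval (fun i : 'I_2 => if i == varx then cplx p.1 else cplx p.2) f.

Definition level (H : poly2 R) (t : R[i]) : set (C2 R) :=
  [set p | eval2 H p = t].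

Definition critical_value (H : poly2 R) (t : R[i]) : Prop :=
  exists2 p : C2 R, level H t p & forall i, eval2 (mderiv i H) p = 0.

End LevelCurves.

Section Smooth.
Variables (R : realType) (V W : normedModType R).

(* On a finite-dimensional [V] and an open [O] this is the usual class C^k. *)
Fixpoint Ck (k : nat) (O : set V) (f : V -> W) : Prop :=
  if k is k'.+1 then
    forall v : V, (forall x, O x -> derivable f x v) /\ Ck k' O ('D_v f)
  else forall x, O x -> {for x, continuous f}.

(* Smoothness on an arbitrary subset: existence of a smooth extension to an
   open neighbourhood. *)
Definition smooth_on (S : set V) (f : V -> W) : Prop :=
  exists (O : set V) (g : V -> W),
    [/\ open O, S `<=` O, forall k, Ck k O g & forall x, S x -> f x = g x].

End Smooth.

(* Smooth singular homology of the level curves, in degree 1. A simplex is a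
   total function of which only the values on the standard simplex matter. *)
Section Homology.
Variable R : realType.
Variable H : poly2 R.

Definition seg : set R := `[0, 1].
Definition tri : set (R * R) :=
  [set u | [/\ 0 <= u.1, 0 <= u.2 & u.1 + u.2 <= 1]].

Definition chain1 : Type := seq (int * (R -> C2 R)).
Definition chain2 : Type := seq (int * (R * R -> C2 R)).

Definition path_in (t : R[i]) (g : R -> C2 R) : Prop :=
  smooth_on seg g /\ forall s, seg s -> level H t (g s).

Definition triangle_in (t : R[i]) (g : R * R -> C2 R) : Prop :=
  smooth_on tri g /\ forall u, tri u -> level H t (g u).

Definition is_cycle (t : R[i]) (c : chain1) : Prop :=
  (forall e, e \in c -> path_in t e.2) /\
  forall p : C2 R,
    \sum_(e <- c) e.1 * ((e.2 1 == p)%:R - (e.2 0 == p)%:R) = 0 :> int.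

Definition boundary2 (b : chain2) : chain1 :=
  flatten [seq [:: (  e.1, fun s : R => e.2 (1 - s, s));
                   (- e.1, fun s : R => e.2 (0, s));
                   (  e.1, fun s : R => e.2 (s, 0))] | e <- b].

(* Coefficient of the simplex [g] in the formal sum [c]. *)
Definition chain_coef (c : chain1) (g : R -> C2 R) : int :=
  \sum_(e <- c | `[< forall s, seg s -> e.2 s = g s >]) e.1.

Definition homologous (t : R[i]) (c c' : chain1) : Prop :=
  exists2 b : chain2, (forall e, e \in b -> triangle_in t e.2) &
    forall g : R -> C2 R,
      chain_coef c g - chain_coef c' g = chain_coef (boundary2 b) g.

Definition pushforward (f : C2 R -> C2 R) (c : chain1) : chain1 :=
  [seq (e.1, f \o e.2) | e <- c].

(* [(t, q) |-> Psi t q] is a diffeomorphism from V x {H = t0} onto H^-1(V) over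
   [V], with inverse [p |-> (H p, rho p)], and is the identity over [t0]. *)
Definition local_trivialization (V : set (R[i])^o) (t0 : R[i])
    (Psi : R[i] -> C2 R -> C2 R) (rho : C2 R -> C2 R) : Prop :=
  [/\ forall t q, V t -> level H t0 q ->
        level H t (Psi t q) /\ rho (Psi t q) = q,
      forall p, V (eval2 H p) ->
        level H t0 (rho p) /\ Psi (eval2 H p) (rho p) = p,
      smooth_on [set w : (R * R) * C2 R | V (cplx w.1) /\ level H t0 w.2]
        (fun w => Psi (cplx w.1) w.2),
      smooth_on [set p | V (eval2 H p)] rho &
      forall q, level H t0 q -> Psi t0 q = q].

(* A single-valued branch over [U] of a continuous family of cycles: each
   homology class is represented by a cycle, and the classes are constant in
   local trivializations of the fibration. *)
Definition continuous_family (U : set (R[i])^o) (delta : R[i] -> chain1) :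
    Prop :=
  (forall t, U t -> is_cycle t (delta t)) /\
  forall t0, U t0 ->
    exists (V : set (R[i])^o) (Psi : R[i] -> C2 R -> C2 R) (rho : C2 R -> C2 R),
      [/\ open V, V t0, V `<=` U, local_trivialization V t0 Psi rho &
          forall t, V t ->
            homologous t (delta t) (pushforward (Psi t) (delta t0))].

End Homology.

Section Integral.
Variable R : realType.

Definition path_integral (w : form1 R) (g : R -> C2 R) : R[i] :=
  let F (s : R) : R[i] := eval2 w.1 (g s) * cplx (derive1 g s).1
                        + eval2 w.2 (g s) * cplx (derive1 g s).2 in
  (\int[lebesgue_measure]_(s in @seg R) complex.Re (F s))%R
  +i* (\int[lebesgue_measure]_(s in @seg R) complex.Im (F s))%R.

Definition chain_integral (w : form1 R) (c : chain1 R) : R[i] :=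
  \sum_(e <- c) path_integral w e.2 *~ e.1.

End Integral.

(* Main.v *)
Require Import Defs.
From HB Require Import structures.
From mathcomp Require Import all_boot all_order all_algebra.
From mathcomp.field Require Import separable.
From mathcomp Require Import all_classical all_reals all_analysis.
From mathcomp Require Import ring lra zify.

(** For a cycle c on the level curve H = t, the Gelfand-Leray integral of
    f dx /\ dy over c is the integral of any 1-form theta along c such that
    dH /\ theta = f dx /\ dy; on the curve theta is unique.  The system comes
    from four facts.
    - If delta(t) is a continuous family of cycles, the derivative of the
      integral of omega over delta(t) is the Gelfand-Leray integral of d omega
      ([is_derive_chain_integral]).
    - The Gelfand-Leray integral of H f is t times that of f
      ([gl_integralMH]), and that of dH /\ eta is the integral of eta
      ([gl_integral_wedge]).
    - Transversality to infinity makes the two partial derivatives of the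
      principal part of H coprime forms of degree n, which generate every form
      of degree at least 2n - 1.  Division by them gives
      H d omega_i = dH /\ eta_i + sum_j a_ij d omega_j with deg eta_i <= 2n
      ([jacobian_division]), and then d eta_i = sum_j b_ij d omega_j because
      the d omega_j span.
    - A closed polynomial 1-form is exact ([closed_form_exact]), so that the
      integral of eta_i equals sum_j b_ij X_j.
    Together, t X_i' = sum_j b_ij X_j + sum_j a_ij X_j', which is the system
    with A = (a_ij) and B = (b_ij).

    The analytic content is one formula, [variation]: for a map Gamma(r, s),
    the r-derivative of the integral of omega along Gamma(r, .) is the
    increment of omega(Gamma_r) between the end points plus the integral of
    d omega(Gamma_r, Gamma_s) over s.  It is used twice.  For a triangle inside
    a level curve, Gamma_r and Gamma_s lie in the same complex line, so the
    last term vanishes; this is Stokes' formula ([triangle_stokes]), and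
    integrals depend only on the homology class ([homologous_integral]).  For a
    path moved by a local trivialization in the direction h of the t-plane,
    dH(Gamma_r) = h and dH(Gamma_s) = 0, so the last term is h times the
    Gelfand-Leray integral ([line_variation]); the end point terms cancel when
    summed over a cycle ([cycle_boundary_eq0]).  The derivative in each real
    direction h is thus h g(t) with g continuous, and the mean value theorem
    turns this into a complex derivative ([is_derive_of_directional]). *)

Set Implicit Arguments.
Unset Strict Implicit.
Unset Printing Implicit Defensive.

Import Order.TTheory GRing.Theory Num.Theory numFieldNormedType.Exports.
Local Open Scope ring_scope.

(** * Binary forms and division by the partial derivatives of H *)

Section BinaryForms.
Variable K : numFieldType.
Implicit Types (p q u v : {poly K}) (f g h : mpoly 2 K).

Local Notation ix := (ord0 : 'I_2).
Local Notation iy := (ord_max : 'I_2).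

Definition bimon (i j : nat) : mpoly 2 K :=
  mpolyX K (mnm1 ix) ^+ i * mpolyX K (mnm1 iy) ^+ j.

(** A binary form of degree d is y^d p(x/y) for a univariate p of degree at
    most d; coprimality of forms becomes coprimality in {poly K}. *)
Definition homogenize (d : nat) p : mpoly 2 K :=
  \sum_(i < d.+1) p`_i *: bimon i (d - i).

Lemma homogenize_is_linear d : linear (homogenize d).
Proof.
move=> c p q; rewrite /homogenize scaler_sumr -big_split /=.
by apply: eq_bigr => i _; rewrite coefD coefZ scalerDl scalerA.
Qed.

HB.instance Definition _ d :=
  GRing.isLinear.Build K {poly K} (mpoly 2 K) _ (homogenize d) (homogenize_is_linear d).

Lemma homogenizeZ d c p : homogenize d (c *: p) = c *: homogenize d p.
Proof. exact: linearZ. Qed.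

Lemma homogenizeXn d i : (i <= d)%N -> homogenize d 'X^i = bimon i (d - i).
Proof.
move=> le_id; rewrite /homogenize (bigD1 (Ordinal (le_id : (i < d.+1)%N))) //=.
rewrite coefXn eqxx scale1r big1 ?addr0 // => j ne_ji.
rewrite coefXn; case: eqP => [e|]; last by rewrite scale0r.
by case/eqP: ne_ji; apply: val_inj.
Qed.

Lemma bimonM i j k l : bimon i j * bimon k l = bimon (i + k) (j + l).
Proof. by rewrite /bimon mulrACA -!exprD. Qed.

Lemma poly_sumXn p d : (size p <= d.+1)%N -> p = \sum_(i < d.+1) p`_i *: 'X^i.
Proof.
move=> sp; rewrite -poly_def; apply/polyP => i; rewrite coef_poly.
by case: ltnP => // le; rewrite nth_default // (leq_trans sp).
Qed.

Lemma homogenizeM d e p q : (size p <= d.+1)%N -> (size q <= e.+1)%N ->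
  homogenize d p * homogenize e q = homogenize (d + e) (p * q).
Proof.
move=> sp sq; rewrite [in RHS](poly_sumXn sp) [in RHS](poly_sumXn sq).
rewrite [in RHS]mulr_suml linear_sum [X in X * _]/homogenize mulr_suml.
apply: eq_bigr => i _ /=.
rewrite [in RHS]mulr_sumr linear_sum [X in _ * X]/homogenize mulr_sumr.
apply: eq_bigr => j _ /=.
rewrite -!scalerAl -!scalerAr !linearZ /= -exprD.
have li : (i <= d)%N by rewrite -ltnS.
have lj : (j <= e)%N by rewrite -ltnS.
rewrite homogenizeXn ?leq_add // bimonM.
by rewrite scalerA mulrC -scalerA; congr (_ *: (_ *: bimon _ _)); lia.
Qed.

Lemma mderivXn (i j : 'I_2) k : mderiv i (mpolyX K (mnm1 j) ^+ k) =
  (i == j)%:R *: (k%:R *: mpolyX K (mnm1 j) ^+ k.-1).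
Proof.
elim: k => [|k IHk]; first by rewrite expr0 -mpolyC1 mderivC scale0r scaler0.
rewrite exprS mderivM IHk mderivX mnm1E eq_sym.
case: eqP => [->|ne] /=; last by rewrite !scale0r mul0r mulr0 addr0.
have -> : mnm_sub (mnm1 j) (mnm1 j) = mnm0 by apply/mnmP => l; rewrite mnmBE subnn mnm0E.
rewrite mpolyX0 !scale1r mul1r; case: k {IHk} => [|k] /=.
  by rewrite scale0r mulr0 addr0 scale1r.
by rewrite -scalerAr -exprS -[X in X + _]scale1r -scalerDl nat1r.
Qed.

Lemma mderivx_bimon i j : mderiv ix (bimon i j) = i%:R *: bimon i.-1 j.
Proof.
rewrite /bimon mderivM !mderivXn /= scale1r.
by rewrite -scalerAl scale0r mulr0 addr0.
Qed.

Lemma mderivy_bimon i j : mderiv iy (bimon i j) = j%:R *: bimon i j.-1.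
Proof.
rewrite /bimon mderivM !mderivXn /= scale1r.
by rewrite -scalerAr scale0r mul0r add0r.
Qed.

Lemma mderivx_homogenize d p : (size p <= d.+2)%N ->
  mderiv ix (homogenize d.+1 p) = homogenize d p^`().
Proof.
move=> sp; rewrite {2}(poly_sumXn sp) [homogenize d.+1 p]/homogenize !linear_sum /=.
apply: eq_bigr => i _ /=.
rewrite mderivZ mderivx_bimon derivZ derivXn homogenizeZ; congr (_ *: _).
case: (i : nat) (ltn_ord i) => [|k] hk; first by rewrite scale0r mulr0n linear0.
by rewrite -(scaler_nat _ 'X^_) homogenizeZ homogenizeXn.
Qed.

(** By the relation of Euler, y F_y = d F - x F_x for a form F of degree d. *)
Lemma mderivy_homogenize d p : (size p <= d.+2)%N ->
  mderiv iy (homogenize d.+1 p) = homogenize d (d.+1%:R *: p - 'X * p^`()).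
Proof.
move=> sp; have -> : d.+1%:R *: p - 'X * p^`() =
   \sum_(i < d.+2) (p`_i * (d.+1 - i)%:R) *: 'X^i.
  have dp : p^`() = \sum_(i < d.+2) (p`_i *: 'X^i)^`().
    by rewrite {1}(poly_sumXn sp) linear_sum.
  rewrite dp {1}(poly_sumXn sp) scaler_sumr mulr_sumr -sumrB.
  apply: eq_bigr => i _; rewrite derivZ derivXn -scalerAr.
  have -> : 'X * ('X^(i.-1) *+ i) = i%:R *: 'X^i :> {poly K}.
    by rewrite scaler_nat mulrnAr; case: (i : nat) => [|k]; rewrite ?mulr0n // -exprS.
  by rewrite natrB ?(ltnSE (ltn_ord i)) // mulrBr scalerBl !scalerA [_%:R * _]mulrC.
rewrite [homogenize d.+1 p]/homogenize !linear_sum /=.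
apply: eq_bigr => i _; rewrite mderivZ mderivy_bimon homogenizeZ.
have := ltn_ord i; rewrite ltnS leq_eqVlt => /orP[/eqP -> |lt_id].
  by rewrite subnn scale0r mulr0 scale0r scaler0.
rewrite homogenizeXn // scalerA; congr (_ *: bimon _ _).
by rewrite subSn //= .
Qed.

Lemma mpolyX_bimon m : mpolyX K m = bimon (m ix) (m iy).
Proof.
rewrite mpolyXE_id !big_ord_recl big_ord0 mulr1 /bimon.
by have -> : fintype.lift ix ord0 = iy by apply: val_inj.
Qed.

Lemma msize_leP f k :
  reflect (forall m, m \in msupp f -> (mdeg m < k)%N) (mmeasure mdeg f <= k)%N.
Proof.
rewrite mmeasureE; apply: (iffP (bigmax_leqP_seq _ _ _ _)) => le m *; exact: le.
Qed.

Lemma msize_bimon i j : mmeasure mdeg (bimon i j) = (i + j).+1.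
Proof.
rewrite /bimon !mpolyXn -mpolyXD mmeasureX /= mdegD !mdegMn !mdeg1.
by rewrite !mul1n.
Qed.

Lemma msizeD_leq f g k : (mmeasure mdeg f <= k)%N -> (mmeasure mdeg g <= k)%N ->
  (mmeasure mdeg (f + g) <= k)%N.
Proof.
by move=> lf lg; rewrite (leq_trans (mmeasureD_le _ _ _)) // geq_max lf.
Qed.

Lemma msize_sum_leq (I : Type) (r : seq I) (P : pred I) (F : I -> mpoly 2 K) k :
  (forall i, P i -> (mmeasure mdeg (F i) <= k)%N) ->
  (mmeasure mdeg (\sum_(i <- r | P i) F i) <= k)%N.
Proof.
move=> le_F; elim/big_rec: _ => [|i f Pi lf]; first by rewrite mmeasure0.
by apply: msizeD_leq => //; apply: le_F.
Qed.

Lemma msizeZ_leq c f k : (mmeasure mdeg f <= k)%N -> (mmeasure mdeg (c *: f) <= k)%N.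
Proof. exact/leq_trans/mmeasureZ_le. Qed.

Lemma msizeM_leq f g i j : (mmeasure mdeg f <= i)%N -> (mmeasure mdeg g <= j.+1)%N ->
  (mmeasure mdeg (f * g) <= i + j)%N.
Proof.
move=> lf lg; have [->|f0] := eqVneq f 0; first by rewrite mul0r mmeasure0.
have [->|g0] := eqVneq g 0; first by rewrite mulr0 mmeasure0.
by rewrite msizeM // -subn1 leq_subLR add1n -addnS leq_add.
Qed.

Lemma msize_mderiv i f k : (mmeasure mdeg f <= k.+1)%N ->
  (mmeasure mdeg (mderiv i f) <= k)%N.
Proof.
move=> /msize_leP lf; apply/msize_leP => m; rewrite mcoeff_msupp mcoeff_deriv => nz.
have: (mnm_add m (mnm1 i)) \in msupp f.
  by rewrite mcoeff_msupp; apply: contraNneq nz => ->; rewrite mul0rn.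
by move=> /lf; rewrite mdegD mdeg1 addn1.
Qed.

Lemma msize_homogenize d p : (mmeasure mdeg (homogenize d p) <= d.+1)%N.
Proof.
apply: msize_sum_leq => i _; apply: msizeZ_leq; rewrite msize_bimon.
by rewrite subnKC // -ltnS.
Qed.

Section LinearFactors.
Variables (d : nat) (a b : 'I_d -> K).
Hypothesis indep : forall j k, j != k -> a j * b k - a k * b j != 0.

Let L k : {poly K} := a k *: 'X + (b k)%:P.
Let P : {poly K} := \prod_k L k.

Lemma homogenize_linear k :
  homogenize 1 (L k) = a k *: mpolyX K (mnm1 ix) + b k *: mpolyX K (mnm1 iy).
Proof.
rewrite /homogenize !big_ord_recl big_ord0 addr0 /L !coefE /= /bimon !mulr1 mulr0.
by rewrite add0r addr0 expr0 !expr1 mul1r addrC.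
Qed.

Lemma size_linear_le k : (size (L k) <= 2)%N.
Proof.
rewrite (leq_trans (size_polyD _ _)) // geq_max (leq_trans (size_scale_leq _ _)) ?size_polyX //.
by rewrite (leq_trans (size_polyC_leq1 _)).
Qed.

Lemma homogenize_prod :
  homogenize d P = \prod_k (a k *: mpolyX K (mnm1 ix) + b k *: mpolyX K (mnm1 iy)).
Proof.
suff H (s : seq 'I_d) : homogenize (size s) (\prod_(k <- s) L k) =
     \prod_(k <- s) (a k *: mpolyX K (mnm1 ix) + b k *: mpolyX K (mnm1 iy))
     /\ (size (\prod_(k <- s) L k)%R <= (size s).+1)%N.
  have [+ _] := H (index_enum 'I_d).
  by rewrite [in size _]/index_enum -enumT size_enum_ord.
elim: s => [|k s [IH les]].
  rewrite !big_nil /homogenize big_ord1 /= coef1 scale1r subnn size_poly1.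
  by rewrite /bimon !expr0 mulr1.
rewrite !big_cons -IH -homogenize_linear homogenizeM ?size_linear_le //; split=> //=.
rewrite (leq_trans (size_polyMleq _ _)) //.
by rewrite -subn1 leq_subLR (leq_trans (leq_add (size_linear_le k) les)).
Qed.

Hypothesis d_gt1 : (1 < d)%N.

Lemma linear_neq0 k : L k != 0.
Proof.
have [j ne_jk] : exists j, j != k.
  have [e|e] := eqVneq k (Ordinal (ltnW d_gt1)); last by exists (Ordinal (ltnW d_gt1)); rewrite eq_sym.
  by exists (Ordinal d_gt1); rewrite e.
apply: contraNneq (indep ne_jk) => L0.
have -> : b k = 0 by have := congr1 (fun p : {poly K} => p`_0) L0; rewrite /L !coefE mulr0 add0r.
have -> : a k = 0 by have := congr1 (fun p : {poly K} => p`_1) L0; rewrite /L !coefE mulr1 addr0.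
by rewrite mulr0 mul0r subr0.
Qed.

Lemma separable_linear k : separable_poly (L k).
Proof.
rewrite unlock /L derivD derivZ derivX derivC addr0.
have [a0|a0] := eqVneq (a k) 0; last first.
  by rewrite coprimepZr ?coprimep1.
have := linear_neq0 k; rewrite /L a0 !scale0r add0r polyC_eq0 => b0.
by rewrite coprimep0 -size_poly_eq1 size_polyC b0.
Qed.

Lemma coprimep_linear j k : j != k -> coprimep (L j) (L k).
Proof.
move=> /indep D0; apply/Bezout_eq1_coprimepP.
set D := a j * b k - a k * b j in D0.
exists ((- (a k / D))%:P, (a j / D)%:P); rewrite /= /L -!mul_polyC.
have -> : (- (a k / D))%:P * ((a j)%:P * 'X + (b j)%:P) +
  (a j / D)%:P * ((a k)%:P * 'X + (b k)%:P) =
  ((a j * b k - a k * b j) / D)%:P :> {poly K}.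
  by rewrite !(polyCD, polyCN, polyCM); ring.
by rewrite divff.
Qed.

(** Distinct lines through the origin give distinct roots, apart from the line
    y = 0, which gives a nonzero constant. *)
Lemma separable_prod_linear : separable_poly P.
Proof.
rewrite /P; have := index_enum_uniq 'I_d.
elim: (index_enum _) => [|k s IH]; first by rewrite big_nil unlock coprime1p.
rewrite /= big_cons => /andP[ks /IH sep_s].
rewrite separable_mul separable_linear sep_s /=.
elim: s ks {IH sep_s} => [|j s IH]; first by rewrite big_nil coprimep1.
rewrite inE negb_or big_cons coprimepMr => /andP[kj ks].
by rewrite coprimep_linear //= IH.
Qed.

(** A common root of the two polynomials would be a root of P and of its
    derivative, that is, a double root of P. *)
Lemma coprimep_partials : coprimep P^`() (d%:R *: P - 'X * P^`()).
Proof.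
have d0 : d%:R != 0 :> K by rewrite pnatr_eq0; case: d d_gt1.
rewrite addrC -mulNr coprimep_addl_mul coprimepZr // coprimep_sym.
by have := separable_prod_linear; rewrite unlock.
Qed.

(** A factor proportional to y becomes constant after setting y = 1, and two
    such factors would be proportional: the degree drops by at most one. *)
Lemma size_prod_linear : (size P == d.+1) || (size P == d).
Proof.
rewrite /P size_prod; last by move=> k _; apply: linear_neq0.
rewrite card_ord.
have size2 k : a k != 0 -> size (L k) = 2.
  move=> ak; rewrite /L size_polyDl size_scale ?size_polyX //.
  by rewrite (leq_ltn_trans (size_polyC_leq1 _)).
case: (pickP (fun k => a k == 0)) => [k ak0|all_ne].
  rewrite (bigD1 k) //=.
  have -> : (\sum_(i < d | i != k) size (L i) = \sum_(i < d | i != k) 2)%N.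
    apply: eq_bigr => i ik; apply: size2; apply: contraNneq (indep ik) => ai0.
    by rewrite ai0 (eqP ak0) !mul0r subr0.
  rewrite sum_nat_const cardC1 card_ord.
  have -> : size (L k) = 1.
    have := linear_neq0 k; rewrite /L (eqP ak0) !scale0r add0r polyC_eq0 => b0.
    by rewrite size_polyC b0.
  by apply/orP; right; apply/eqP; case: d d_gt1 => [|d'] //= _; lia.
have -> : (\sum_(i < d) size (L i) = \sum_(i < d) 2)%N.
  by apply: eq_bigr => i _; apply: size2; rewrite all_ne.
by rewrite sum_nat_const card_ord; apply/orP; left; apply/eqP; lia.
Qed.

End LinearFactors.

(** Start from any Bezout relation for f; reducing v modulo p bounds its degree,
    and the equation then bounds the degree of u. *)
Lemma Bezout_size N p q (f : {poly K}) : coprimep p q -> size p = N.+1 -> (size q <= N.+1)%N ->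
  (size f <= N + N)%N ->
  exists u v, [/\ f = u * p + v * q, (size u <= N)%N & (size v <= N)%N].
Proof.
move=> /Bezout_eq1_coprimepP[[u0 v0] /= uv] sp sq sf.
have p0 : p != 0 by rewrite -size_poly_gt0 sp.
pose v := (f * v0) %% p; pose u := f * u0 + ((f * v0) %/ p) * q.
have fE : f = u * p + v * q.
  rewrite /u /v; have := divp_eq (f * v0) p; set c := (f * v0) %/ p; set r := _ %% p.
  move=> e; have -> : r = f * v0 - c * p by rewrite e addrAC subrr add0r.
  have -> : (f * u0 + c * q) * p + (f * v0 - c * p) * q = f * (u0 * p + v0 * q) by ring.
  by rewrite uv mulr1.
have sv : (size v <= N)%N by rewrite -ltnS -sp ltn_modp.
exists u, v; split=> //.
have [->|u0'] := eqVneq u 0; first by rewrite size_poly0.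
have : (size (u * p)%R <= N + N)%N.
  have -> : u * p = f - v * q by rewrite fE addrK.
  rewrite (leq_trans (size_polyD _ _)) // geq_max sf size_polyN.
  rewrite (leq_trans (size_polyMleq _ _)) // -subn1 leq_subLR add1n -addnS.
  exact: leq_add.
rewrite size_mul // sp addnS /= => le.
by rewrite -(leq_add2r N).
Qed.

Section TransversalForm.
Variables (n : nat) (a b : 'I_n.+1 -> K).
Hypothesis n_gt0 : (0 < n)%N.
Hypothesis indep : forall j k, j != k -> a j * b k - a k * b j != 0.

Let h := \prod_k (a k *: mpolyX K (mnm1 ix) + b k *: mpolyX K (mnm1 iy)).

(** After setting y = 1 the partial derivatives are coprime of degree at most n,
    and one of them has degree exactly n, so that [Bezout_size] applies with
    cofactors of degree n - 1; these homogenize back in degree n - 1. *)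
Lemma bimon_top_ideal i j : (i + j = 2 * n - 1)%N ->
  exists A B, [/\ bimon i j = A * mderiv ix h + B * mderiv iy h,
     (mmeasure mdeg A <= n)%N & (mmeasure mdeg B <= n)%N].
Proof.
move=> ij; rewrite /h -homogenize_prod.
set P := \prod_k _; have d_gt1 : (1 < n.+1)%N by [].
have sP : (size P <= n.+2)%N.
  by case/orP: (size_prod_linear indep d_gt1) => /eqP ->.
rewrite mderivx_homogenize // mderivy_homogenize //.
set Px := P^`(); set Py := _ - _.
have cop : coprimep Px Py := coprimep_partials indep d_gt1.
have sPx : (size Px <= n.+1)%N.
  by apply/leq_sizeP => k lk; rewrite coef_deriv (leq_sizeP _ _ sP) // mul0rn.
have cPy k : Py`_k = P`_k *+ n.+1 - P`_k *+ k.
  rewrite /Py coefB coefZ coefXM coef_deriv mulr_natl.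
  by case: k => [|k] /=; rewrite ?mulr0n.
have sPy : (size Py <= n.+1)%N.
  apply/leq_sizeP => k; rewrite leq_eqVlt => /orP[/eqP <-|lk].
    by rewrite cPy subrr.
  by rewrite cPy (leq_sizeP _ _ sP) // !mul0rn subrr.
have sX : (size ('X^i : {poly K}) <= n + n)%N by rewrite size_polyXn; lia.
have {cop} [u [v [XE su sv]]] :
  exists u v, [/\ 'X^i = u * Px + v * Py, (size u <= n)%N & (size v <= n)%N].
  case/orP: (size_prod_linear indep d_gt1) => /eqP sizeP.
    apply: (Bezout_size cop _ sPy sX); apply/eqP; rewrite eqn_leq sPx /=.
    rewrite ltnNge; apply/negP => /leq_sizeP/(_ n (leqnn n)).
    rewrite coef_deriv => /eqP; rewrite mulrn_eq0 /=.
    by have := lead_coef_eq0 P; rewrite lead_coefE sizeP /= => ->; rewrite -size_poly_eq0 sizeP.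
  rewrite coprimep_sym in cop.
  have [|v [u [XE sv su]]] := Bezout_size cop _ sPx sX; last first.
    by exists u, v; split=> //; rewrite addrC.
  apply/eqP; rewrite eqn_leq sPy /=.
  rewrite ltnNge; apply/negP => /leq_sizeP/(_ n (leqnn n)).
  rewrite cPy mulrSr addrAC subrr add0r => /eqP.
  by have := lead_coef_eq0 P; rewrite lead_coefE sizeP /= => ->; rewrite -size_poly_eq0 sizeP.
have nE : n = n.-1.+1 by rewrite prednK.
exists (homogenize n.-1 u), (homogenize n.-1 v); split.
- rewrite !homogenizeM -?nE //; transitivity (homogenize (n.-1 + n) ('X^i : {poly K})).
    by rewrite homogenizeXn; [congr (bimon _ _)|]; lia.
  by rewrite XE linearD.
- by rewrite [X in (_ <= X)%N]nE msize_homogenize.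
- by rewrite [X in (_ <= X)%N]nE msize_homogenize.
Qed.

(** Such a monomial is a multiple of one of degree exactly 2n - 1. *)
Lemma bimon_ideal i j : (2 * n - 1 <= i + j)%N ->
  exists A B, [/\ bimon i j = A * mderiv ix h + B * mderiv iy h,
     (mmeasure mdeg A <= (i + j).+1 - n)%N & (mmeasure mdeg B <= (i + j).+1 - n)%N].
Proof.
move=> le_ij; pose i0 := minn i (2 * n - 1); pose j0 := (2 * n - 1 - i0)%N.
have [|A [B [E sA sB]]] := @bimon_top_ideal i0 j0; first by rewrite /j0 /i0; lia.
pose m := bimon (i - i0) (j - j0).
have sm : mmeasure mdeg m = (i + j - (2 * n - 1)).+1.
  by rewrite msize_bimon /j0 /i0; congr S; lia.
exists (A * m), (B * m); split.
- rewrite ![_ * m * _]mulrAC -mulrDl -E bimonM; congr (bimon _ _); rewrite /j0 /i0; lia.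
- have -> : ((i + j).+1 - n = n + (i + j - (2 * n - 1)))%N by lia.
  by apply: msizeM_leq; rewrite ?sm.
- have -> : ((i + j).+1 - n = n + (i + j - (2 * n - 1)))%N by lia.
  by apply: msizeM_leq; rewrite ?sm.
Qed.

Variable H : mpoly 2 K.
Hypothesis sizeH : mmeasure mdeg H = n.+2.
Hypothesis topH : pihomog mdeg n.+1 H = h.

Lemma msize_lower_part : (mmeasure mdeg (H - h) <= n.+1)%N.
Proof.
rewrite -topH pihomogE {1}(mpolyE H) (bigID (fun m => mdeg m == n.+1)) /=.
rewrite addrAC subrr add0r big_seq_cond; apply: msize_sum_leq => m /andP[mH ne].
apply: msizeZ_leq; rewrite mmeasureX /=.
have := msize_mdeg_lt mH; rewrite sizeH /= ltnS leq_eqVlt.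
by rewrite (negPf ne).
Qed.

(** Top-degree monomials are divided by the partial derivatives of the principal
    part h; replacing h by H in the result only creates terms of lower degree,
    to which the induction applies.  As [mmeasure mdeg] is the degree plus one,
    the remainder has degree at most 2n - 2. *)
Lemma jacobian_division k f : (mmeasure mdeg f <= k)%N ->
  exists A B r, [/\ f = A * mderiv ix H + B * mderiv iy H + r,
    (mmeasure mdeg A <= k - n)%N, (mmeasure mdeg B <= k - n)%N &
    (mmeasure mdeg r <= 2 * n - 1)%N].
Proof.
elim: k f => [|k IH] f sf.
  exists 0, 0, f; rewrite !mul0r !add0r mmeasure0; split=> //.
  exact: leq_trans sf _.
have [le_k|lt_k] := leqP k.+1 (2 * n - 1).
  exists 0, 0, f; rewrite !mul0r !add0r mmeasure0; split=> //.
  exact: leq_trans sf _.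
rewrite (mpolyE f) big_seq.
elim/big_rec: _ => [|m g mf [A [B [r [-> sA sB sr]]]]].
  by exists 0, 0, 0; rewrite !mul0r !add0r !mmeasure0.
have : (mdeg m <= k)%N by have := msize_mdeg_lt mf => /leq_trans/(_ sf).
rewrite leq_eqVlt => /orP[/eqP mk|mk]; last first.
  have [|A' [B' [r' [-> sA' sB' sr']]]] := IH (mpolyX K m); first by rewrite mmeasureX.
  have le : (k - n <= k.+1 - n)%N by lia.
  exists (mcoeff m f *: A' + A), (mcoeff m f *: B' + B), (mcoeff m f *: r' + r); split.
  - by rewrite !scalerDr !scalerAl; ring.
  - exact: msizeD_leq (msizeZ_leq _ (leq_trans sA' le)) sA.
  - exact: msizeD_leq (msizeZ_leq _ (leq_trans sB' le)) sB.
  - exact: msizeD_leq (msizeZ_leq _ sr') sr.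
have mE : (m ix + m iy)%N = k.
  by rewrite -mk mdegE !big_ord_recl big_ord0 addn0; congr (_ + m _)%N; apply: val_inj.
have [|A' [B' [XE sA' sB']]] := @bimon_ideal (m ix) (m iy); first by rewrite mE; lia.
rewrite mE in sA' sB'.
pose e := A' * mderiv ix (h - H) + B' * mderiv iy (h - H).
have sl : (mmeasure mdeg (h - H) <= n.+1)%N by rewrite -opprB mmeasureN msize_lower_part.
have se : (mmeasure mdeg e <= k)%N.
  have -> : k = (k.+1 - n + n.-1)%N by lia.
  by apply: msizeD_leq; apply: msizeM_leq => //; rewrite prednK //; apply: msize_mderiv.
have [A2 [B2 [r2 [eE sA2 sB2 sr2]]]] := IH _ se.
have le : (k - n <= k.+1 - n)%N by lia.
exists (mcoeff m f *: (A' + A2) + A), (mcoeff m f *: (B' + B2) + B), (mcoeff m f *: r2 + r); split.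
- rewrite mpolyX_bimon XE.
  have -> : A' * mderiv ix h + B' * mderiv iy h =
     A' * mderiv ix H + B' * mderiv iy H + e.
    by rewrite /e !linearB /=; ring.
  rewrite eE -!mul_mpolyC; ring.
- exact: msizeD_leq (msizeZ_leq _ (msizeD_leq sA' (leq_trans sA2 le))) sA.
- exact: msizeD_leq (msizeZ_leq _ (msizeD_leq sB' (leq_trans sB2 le))) sB.
- exact: msizeD_leq (msizeZ_leq _ sr2) sr.
Qed.

End TransversalForm.

Definition antideriv (i : 'I_2) f : mpoly 2 K :=
  \sum_(m <- msupp f) (mcoeff m f / (m i).+1%:R) *: mpolyX K (mnm_add m (mnm1 i)).

Lemma antiderivK i f : mderiv i (antideriv i f) = f.
Proof.
rewrite [RHS]mpolyE /antideriv linear_sum; apply: eq_bigr => m _ /=.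
rewrite mderivZ mderivX mnmDE mnm1E eqxx addn1 scalerA divfK ?pnatr_eq0 //.
congr (_ *: mpolyX K _); apply/mnmP => j.
by rewrite mnmBE mnmDE addnK.
Qed.

Lemma antideriv_const i j f : i != j -> mderiv j f = 0 -> mderiv j (antideriv i f) = 0.
Proof.
move=> ne_ij f_j; rewrite /antideriv linear_sum big_seq big1 // => m mf /=.
rewrite mderivZ mderivX mnmDE mnm1E (negPf ne_ij) addn0.
suff -> : m j = 0%N by rewrite scale0r scaler0.
apply/eqP; rewrite eqn0Ngt; apply/negP => m_gt0.
have mE : mnm_add (mnm_sub m (mnm1 j)) (mnm1 j) = m.
  apply/mnmP => k; rewrite mnmDE mnmBE mnm1E subnK //.
  by case: eqP => // <-.
have /eqP := congr1 (mcoeff (mnm_sub m (mnm1 j))) f_j.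
rewrite mcoeff_deriv mE mcoeff0 mulrn_eq0 /= mcoeff_eq0.
by rewrite mf.
Qed.

(** Integrate f in x; the part of g that this does not account for is free of x
    and is integrated in y. *)
Lemma closed_form_exact f g : mderiv ix g = mderiv iy f ->
  exists F, mderiv ix F = f /\ mderiv iy F = g.
Proof.
move=> closed; pose F1 := antideriv ix f; pose r := g - mderiv iy F1.
have rx : mderiv ix r = 0.
  by rewrite /r linearB /= mderiv_comm antiderivK closed subrr.
exists (F1 + antideriv iy r); rewrite !mderivD !antiderivK antideriv_const // addr0.
by rewrite /r addrC subrK.
Qed.

End BinaryForms.


Local Open Scope classical_set_scope.
Local Open Scope ring_scope.
Local Open Scope complex_scope.


(** * Chain rule, Schwarz theorem and tubes for real functions *)

Section RealCalculus.
Variable R : realType.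

Lemma continuous_at_leP (V : normedModType R) (f : V -> R) (x : V) :
  {for x, continuous f} <->
  forall e, 0 < e -> exists2 d, 0 < d & forall y, `|y - x| < d -> `|f y - f x| <= e.
Proof.
split=> [cf e e0|H].
  move/cvgrPdist_le : (cf) => /(_ e e0) /nbhs_normP[d /= d0 H].
  by exists d => // y yx; rewrite distrC; apply: H; rewrite /= distrC.
apply/cvgrPdist_le => e /H[d d0 {}H]; apply/nbhs_normP; exists d => //= y /= yx.
by rewrite distrC; apply: H; rewrite distrC.
Qed.

(** The increment form of differentiability, in which the estimates are made. *)
Lemma is_derive1P (f : R -> R) (s l : R) :
  is_derive s 1 f l <->
  forall e, 0 < e -> exists2 d, 0 < d &
    forall h, `|h| < d -> `|f (s + h) - f s - h * l| <= e * `|h|.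
Proof.
have E (h : R) : h != 0 -> h^-1 *: (f (h *: 1 + s) - f s) = (f (s + h) - f s) / h.
  by move=> h0; rewrite /GRing.scale /= mulr1 mulrC [h + s]addrC.
split=> [[df dl] e e0|H].
  have : (fun h => h^-1 *: (f (h *: 1 + s) - f s)) @ 0^' --> l by rewrite -dl.
  move/cvgrPdist_le => /(_ e e0) /nbhs_normP[d /= d0 H].
  exists d => // h hd; have [->|h0] := eqVneq h 0.
    by rewrite addr0 subrr mul0r subr0 normr0 mulr0.
  have /H/(_ h0) : ball_ Num.norm 0 d h by rewrite /= sub0r normrN.
  rewrite E // distrC => le.
  have -> : f (s + h) - f s - h * l = ((f (s + h) - f s) / h - l) * h.
    by rewrite mulrBl divfK // [l * h]mulrC.
  by rewrite normrM ler_wpM2r.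
have : (fun h => h^-1 *: (f (h *: 1 + s) - f s)) @ 0^' --> l.
  apply/cvgrPdist_le => e /H[d d0 {}H]; apply/nbhs_normP; exists d => //= h /= hd h0.
  rewrite E // distrC.
  have -> : (f (s + h) - f s) / h - l = (f (s + h) - f s - h * l) / h.
    by field.
  rewrite normrM normfV ler_pdivrMr ?normr_gt0 //.
  by apply: H; rewrite -normrN -sub0r.
by move=> cf; split; [apply/cvg_ex; exists l | apply/cvg_lim].
Qed.

Lemma is_derive1_continuous (f : R -> R) (s l : R) :
  is_derive s 1 f l -> {for s, continuous f}.
Proof.
by move=> [df _]; apply: differentiable_continuous; apply/derivable1_diffP.
Qed.

Lemma MVT_sym (f df : R -> R) (x h : R) :
  (forall y, `|y - x| <= `|h| -> is_derive y 1 f (df y)) ->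
  exists2 k, `|k| <= `|h| & f (x + h) - f x = h * df (x + k).
Proof.
move=> D; have [->|h0] := eqVneq h 0.
  by exists 0; rewrite ?addr0 ?subrr ?mul0r.
have C a b : (forall y, y \in `[a, b] -> `|y - x| <= `|h|) -> {within `[a, b], continuous f}.
  move=> ab; apply: derivable_within_continuous => y /ab yx.
  by have [] := D _ yx.
have [h_gt0|h_le0] := ltP 0 h.
  have ab y : y \in `[x, x + h] -> `|y - x| <= `|h|.
    by rewrite in_itv /= => /andP[a1 a2]; rewrite (ger0_norm (ltW h_gt0)) ger0_norm ?subr_ge0 // lerBlDl.
  have [||c cI ->] := @MVT R f df x (x + h) _ _ (C _ _ ab); first by rewrite ltrDl.
    by move=> y yI; apply: D; apply: ab; exact: subset_itv_oo_cc yI.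
  exists (c - x); first by apply: ab; exact: subset_itv_oo_cc cI.
  by rewrite [x + (c - x)]addrC subrK addrAC subrr add0r mulrC.
have {h_le0}h_lt0 : h < 0 by rewrite lt_neqAle h0.
have ab y : y \in `[x + h, x] -> `|y - x| <= `|h|.
  rewrite in_itv /= => /andP[a1 a2]; rewrite distrC ger0_norm ?subr_ge0 // ltr0_norm //; lra.
have [||c cI e] := @MVT R f df (x + h) x _ _ (C _ _ ab); first by rewrite gtrDl.
  by move=> y yI; apply: D; apply: ab; exact: subset_itv_oo_cc yI.
exists (c - x); first by apply: ab; exact: subset_itv_oo_cc cI.
by rewrite -opprB e [x + (c - x)]addrC subrK; ring.
Qed.

Lemma is_derive_line (V : normedModType R) (u : V -> R) (y e : V) (w d : R) :
  is_derive (y + w *: e) e u d -> is_derive w 1 (fun t => u (y + t *: e)) d.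
Proof.
move=> [du <-].
have E : (fun h : R => h^-1 *: (u (y + (h *: 1 + w) *: e) - u (y + w *: e))) =
         (fun h : R => h^-1 *: (u (h *: e + (y + w *: e)) - u (y + w *: e))).
  by apply/funext => h; rewrite [h%:A]mulr1 scalerDl addrCA.
by split; rewrite /derivable /derive /= E.
Qed.

(** The mean value theorem along the line of direction e writes
    u (c t + b t *: e) - u (c t) as b t times a value of D close to c s.  Only
    partial derivatives are involved, so the chain rule follows without a
    detour through total differentiability. *)
Lemma chain_step (V : normedModType R) (O : set V) (u D : V -> R) (e : V)
    (c : R -> V) (b : R -> R) (s b' l : R) :
  open O -> (forall x, O x -> is_derive x e u (D x)) ->
  O (c s) -> {for c s, continuous D} ->
  {for s, continuous c} -> b s = 0 -> is_derive s 1 b b' ->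
  is_derive s 1 (u \o c) l ->
  is_derive s 1 (fun t => u (c t + b t *: e)) (l + b' * D (c s)).
Proof.
move=> oO dO Ocs cD cc b0 db dl.
have dline y w : O (y + w *: e) -> is_derive w 1 (fun t => u (y + t *: e)) (D (y + w *: e)).
  by move=> /dO; exact: is_derive_line.
pose q t := u (c t + b t *: e) - u (c t).
suff dq : is_derive s 1 q (b' * D (c s)).
  have -> : (fun t => u (c t + b t *: e)) = (u \o c) + q.
    by apply/funext => t; rewrite /q fctE /= addrC subrK.
  exact: is_deriveD.
apply/is_derive1P => eps eps0.
pose M := `|D (c s)| + 1; have M0 : 0 < M by rewrite ltr_wpDl.
pose e1 := eps / (2 * (M + `|b'|)); have Mb0 : 0 < M + `|b'| by rewrite ltr_pwDl.
have e1_gt0 : 0 < e1 by rewrite divr_gt0 // mulr_gt0.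
have e2_gt0 : 0 < Num.min 1 e1 by rewrite lt_min ltr01.
have [d1 d1_gt0 D1] := (continuous_at_leP D (c s)).1 cD _ e2_gt0.
have /nbhs_normP[d2 /= d2_gt0 D2] : nbhs (c s) O by exact: open_nbhs_nbhs.
pose d3 := Num.min d1 d2; have d3_gt0 : 0 < d3 by rewrite lt_min d1_gt0.
have near_c : \forall t \near s, `|c t - c s| < d3 / 2.
  have := cc; move/cvgrPdist_lt => /(_ (d3 / 2)) H.
  by near do rewrite distrC; apply: H; rewrite divr_gt0.
have cb : {for s, continuous b} := is_derive1_continuous db.
have near_b : \forall t \near s, `|b t| * `|e| < d3 / 2.
  have : (fun t => `|b t| * `|e|) @ s --> `|b s| * `|e|.
    by apply: cvgM; [apply: cvg_norm|apply: cvg_cst].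
  rewrite b0 normr0 mul0r => /cvgrPdist_lt/(_ (d3 / 2)) H.
  near=> t; have : `|0 - `|b t| * `|e| | < d3 / 2 by near: t; apply: H; rewrite divr_gt0.
  by rewrite sub0r normrN ger0_norm // mulr_ge0.
have /nbhs_normP[d4 /= d4_gt0 N4] : \forall t \near s, `|c t - c s| < d3 / 2 /\ `|b t| * `|e| < d3 / 2.
  by apply: filterS2 near_c near_b => t.
have [d5 d5_gt0 D5] := (is_derive1P b s b').1 db _ e1_gt0.
exists (Num.min d4 d5); first by rewrite lt_min d4_gt0.
move=> h; rewrite lt_min => /andP[h4 h5].
have [|hc hb] := N4 (s + h); first by rewrite /= opprD addrA subrr sub0r normrN.
have close k : `|k| <= `|b (s + h)| -> `|c (s + h) + k *: e - c s| < d3.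
  move=> kb; rewrite addrAC (le_lt_trans (ler_normD _ _)) // (splitr d3) ltrD //.
  by rewrite normrZ (le_lt_trans _ hb) // ler_wpM2r.
have [|k kb qE] := @MVT_sym (fun t => u (c (s + h) + t *: e))
    (fun t => D (c (s + h) + t *: e)) 0 (b (s + h)).
  move=> y; rewrite subr0 => /close yc; apply: dline; apply: D2.
  by rewrite /= distrC (lt_le_trans yc) // ge_min lexx orbT.
rewrite !add0r scale0r addr0 in qE.
rewrite /q b0 scale0r addr0 subrr subr0 qE.
set Dk := D _; have Dk1 : `|Dk - D (c s)| <= Num.min 1 e1.
  by apply: D1; rewrite (lt_le_trans (close _ kb)) // ge_min lexx.
have /andP[Dk2 Dk3] : (`|Dk - D (c s)| <= 1) && (`|Dk - D (c s)| <= e1).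
  by rewrite -le_min.
have DkM : `|Dk| <= M.
  by rewrite -(subrK (D (c s)) Dk) addrC (le_trans (ler_normD _ _)) // lerD2l.
have bh := D5 _ h5; rewrite b0 subr0 in bh.
have -> : b (s + h) * Dk - h * (b' * D (c s)) =
  (b (s + h) - h * b') * Dk + h * b' * (Dk - D (c s)) by ring.
rewrite (le_trans (ler_normD _ _)) // !normrM.
apply: (@le_trans _ _ (e1 * `|h| * M + `|h| * `|b'| * e1)).
  apply: lerD; first exact: ler_pM.
  by rewrite ler_wpM2l // mulr_ge0.
have -> : e1 * `|h| * M + `|h| * `|b'| * e1 = e1 * (M + `|b'|) * `|h| by ring.
rewrite ler_wpM2r // /e1 mulrAC ler_pdivrMr ?mulr_gt0 //.
by rewrite ler_pM2l // ler_pMl // ler1n.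
Unshelve. all: by end_near. Qed.

Lemma continuous_at_sum (T : topologicalType) (V : normedModType R) (I : Type)
    (r : seq I) (P : pred I) (F : I -> T -> V) (x : T) :
  (forall i, P i -> {for x, continuous (F i)}) ->
  {for x, continuous (fun t => \sum_(i <- r | P i) F i t)}.
Proof.
move=> cF; elim: r => [|i r IH].
  have -> : (fun t => \sum_(i <- [::] | P i) F i t) = cst 0.
    by apply/funext => t; rewrite big_nil.
  exact: cvg_cst.
have [Pi|nPi] := boolP (P i).
  have -> : (fun t => \sum_(j <- i :: r | P j) F j t) =
            F i + (fun t => \sum_(j <- r | P j) F j t).
    by apply/funext => t; rewrite big_cons Pi.
  by apply: continuousD => //; apply: cF.
have -> // : (fun t => \sum_(j <- i :: r | P j) F j t) =
             (fun t => \sum_(j <- r | P j) F j t).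
by apply/funext => t; rewrite big_cons (negPf nPi).
Qed.

(** The coordinates of the curve are released one after the other by
    [chain_step]. *)
Lemma curve_chain (V : normedModType R) (O : set V) (u : V -> R) (N : nat)
    (e : 'I_N -> V) (D : 'I_N -> V -> R) (c : 'I_N -> R -> R) (c' : 'I_N -> R) (s : R) :
  open O -> (forall i x, O x -> is_derive x (e i) u (D i x)) ->
  (forall i x, O x -> {for x, continuous (D i)}) ->
  (forall i, is_derive s 1 (c i) (c' i)) ->
  O (\sum_i c i s *: e i) ->
  is_derive s 1 (fun t => u (\sum_i c i t *: e i))
    (\sum_i c' i * D i (\sum_i c i s *: e i)).
Proof.
move=> oO dO cD dc; set p := \sum_i _ => Op.
pose path (k : nat) t := p + \sum_(i < N | (i < k)%N) (c i t - c i s) *: e i.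
have path_s k : path k s = p.
  by rewrite /path big1 ?addr0 // => i _; rewrite subrr scale0r.
have dcB i : is_derive s 1 (fun t => c i t - c i s) (c' i).
  rewrite -[c' i]subr0; have -> : (fun t => c i t - c i s) = c i - cst (c i s).
    by apply/funext.
  exact: is_deriveB.
have cpath k : {for s, continuous (path k)}.
  apply: (@continuousD _ _ _ (cst p)); first exact: cvg_cst.
  apply: continuous_at_sum => i _.
  apply: cvgZl; exact: is_derive1_continuous (dcB i).
suff H (k : nat) : (k <= N)%N ->
    is_derive s 1 (u \o path k) (\sum_(i < N | (i < k)%N) c' i * D i p).
  have all_lt (W : nmodType) (F : 'I_N -> W) :
      \sum_(i < N | (i < N)%N) F i = \sum_(i < N) F i.
    by apply: eq_bigl => i; rewrite ltn_ord.
  have := H N (leqnn N); rewrite all_lt.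
  congr (is_derive s 1 _ _); apply/funext => t /=; congr u.
  rewrite /path all_lt.
  rewrite /p -big_split; apply: eq_bigr => i _ /=.
  by rewrite -scalerDl addrC subrK.
elim: k => [|k IH] kN.
  rewrite big1 //; have -> : u \o path 0%N = cst (u p).
    by apply/funext => t /=; rewrite /path big1 ?addr0.
  exact: is_derive_cst.
pose i0 := Ordinal kN.
have split_sum (W : nmodType) (F : 'I_N -> W) :
    \sum_(i < N | (i < k.+1)%N) F i = \sum_(i < N | (i < k)%N) F i + F i0.
  rewrite (bigD1 i0) //= addrC; congr (_ + _); apply: eq_bigl => i.
  by rewrite ltnS ltn_neqAle andbC.
rewrite split_sum.
have -> : u \o path k.+1 = (fun t => u (path k t + (c i0 t - c i0 s) *: e i0)).
  by apply/funext => t /=; rewrite /path split_sum addrA.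
rewrite -[in X in _ + _ * X](path_s k).
apply: (chain_step oO (dO i0)); rewrite ?path_s //; [exact: cD|exact: subrr|].
exact/IH/ltnW.
Qed.

(** The second difference of a over a square of side h at p is h ^ 2 times a
    value of either mixed derivative near p. *)
Lemma schwarz (U : set (R * R)) (a ar as_ ars asr : R * R -> R) (p : R * R) :
  open U -> U p ->
  (forall q, U q -> is_derive q.1 1 (fun r => a (r, q.2)) (ar q)) ->
  (forall q, U q -> is_derive q.2 1 (fun s => a (q.1, s)) (as_ q)) ->
  (forall q, U q -> is_derive q.2 1 (fun s => ar (q.1, s)) (ars q)) ->
  (forall q, U q -> is_derive q.1 1 (fun r => as_ (r, q.2)) (asr q)) ->
  {for p, continuous ars} -> {for p, continuous asr} ->
  ars p = asr p.
Proof.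
move=> oU Up dr ds drs dsr crs csr; apply/eqP/negPn/negP => ne.
(* the common value found below is within e of both mixed derivatives at p,
   which are 4 e apart *)
pose e := `|ars p - asr p| / 4.
have e0 : 0 < e by rewrite divr_gt0 // normr_gt0 subr_eq0.
have [d1 d1_gt0 D1] := (continuous_at_leP ars p).1 crs _ e0.
have [d2 d2_gt0 D2] := (continuous_at_leP asr p).1 csr _ e0.
have /nbhs_normP[d3 /= d3_gt0 D3] : nbhs p U by exact: open_nbhs_nbhs.
(* the square of side h lies in U and in both neighbourhoods *)
pose h := Num.min d1 (Num.min d2 d3) / 2.
have h0 : 0 < h by rewrite divr_gt0 // !lt_min d1_gt0 d2_gt0.
have hd : [/\ h < d1, h < d2 & h < d3].
  have : h < Num.min d1 (Num.min d2 d3) by rewrite /h ltr_pdivrMr // ltr_pMr ?ltr1n // !lt_min d1_gt0 d2_gt0.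
  by rewrite !lt_min => /and3P[].
case: hd => hd1 hd2 hd3.
have hn : `|h| = h by rewrite gtr0_norm.
have near d k l : h < d -> `|k| <= h -> `|l| <= h -> `|(p.1 + k, p.2 + l) - p| < d.
  move=> hd kh lh; rewrite (le_lt_trans _ hd) //.
  rewrite prod_normE /= ge_max /= [_ + k - _]addrAC subrr add0r kh.
  by rewrite [_ + l - _]addrAC subrr add0r lh.
have inU k l : `|k| <= h -> `|l| <= h -> U (p.1 + k, p.2 + l).
  by move=> kh lh; apply: D3; rewrite /= distrC; apply: near.
pose Dl := a (p.1 + h, p.2 + h) - a (p.1 + h, p.2) - (a (p.1, p.2 + h) - a (p.1, p.2)).
have shift (x y : R) : y = x + (y - x) by rewrite addrC subrK.
have [k [l [kh lh E1]]] : exists k l, [/\ `|k| <= h, `|l| <= h &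
    Dl = h * (h * ars (p.1 + k, p.2 + l))].
  have [|k kh E] := @MVT_sym (fun r => a (r, p.2 + h) - a (r, p.2))
    (fun r => ar (r, p.2 + h) - ar (r, p.2)) p.1 h.
    move=> y; rewrite hn (shift p.1 y) addrAC subrr add0r => yh.
    apply: is_deriveB.
      by apply: (dr (_, _)); apply: inU; rewrite ?hn.
    by apply: (dr (_, _)); rewrite -[p.2]addr0; apply: inU; rewrite ?normr0 // ltW.
  have [|l lh E'] := @MVT_sym (fun s => ar (p.1 + k, s)) (fun s => ars (p.1 + k, s)) p.2 h.
    move=> y; rewrite hn (shift p.2 y) addrAC subrr add0r => yh.
    by rewrite hn in kh; apply: (drs (_, _)); apply: inU.
  exists k, l; rewrite -hn; split=> //.
  by rewrite /Dl E E' hn.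
have [k' [l' [kh' lh' E2]]] : exists k l, [/\ `|k| <= h, `|l| <= h &
    Dl = h * (h * asr (p.1 + k, p.2 + l))].
  have [|l' lh' E] := @MVT_sym (fun s => a (p.1 + h, s) - a (p.1, s))
    (fun s => as_ (p.1 + h, s) - as_ (p.1, s)) p.2 h.
    move=> y; rewrite hn (shift p.2 y) addrAC subrr add0r => yh.
    apply: is_deriveB.
      by apply: (ds (_, _)); apply: inU; rewrite ?hn.
    by apply: (ds (_, _)); rewrite -[p.1]addr0; apply: inU; rewrite ?normr0 // ltW.
  have [|k' kh' E'] := @MVT_sym (fun r => as_ (r, p.2 + l')) (fun r => asr (r, p.2 + l')) p.1 h.
    move=> y; rewrite hn (shift p.1 y) addrAC subrr add0r => yh.
    by rewrite hn in lh'; apply: (dsr (_, _)); apply: inU.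
  exists k', l'; rewrite -hn; split=> //.
  rewrite hn -E' -E /Dl; ring.
have same : ars (p.1 + k, p.2 + l) = asr (p.1 + k', p.2 + l').
  by apply: (mulfI (lt0r_neq0 h0)); apply: (mulfI (lt0r_neq0 h0)); rewrite -E1 -E2.
have A1 : `|ars (p.1 + k, p.2 + l) - ars p| <= e by apply/D1/near.
have A2 : `|asr (p.1 + k', p.2 + l') - asr p| <= e by apply/D2/near.
have : `|ars p - asr p| <= e + e.
  rewrite -(subrK (ars (p.1 + k, p.2 + l)) (ars p)) -addrA (le_trans (ler_normD _ _)) //.
  by rewrite lerD // ?[`|ars p - _|]distrC // same.
apply/negP; rewrite -ltNge.
have -> : `|ars p - asr p| = 4 * e by rewrite /e mulrC divfK.
by move: e0; clearbody e; lra.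
Qed.

(** Compactness of the segment. *)
Lemma tube (T : topologicalType) (x : T) (P : T * R -> Prop) :
  (forall s : R, seg s -> \forall q \near (x, s), P q) ->
  \forall y \near x, forall s : R, seg s -> P (y, s).
Proof.
move=> H; have /compact_near_coveringP := @segment_compact R 0 1.
move=> /(_ _ (nbhs x) (fun y s => P (y, s))) /= K.
near=> y => s s01; move: s s01; near: y; apply: K => s s01.
have [[A B] /= [Ax Bs] AB] := H s s01.
by exists (B, A) => //= -[s' y] /= [Bs' Ay]; apply: (AB (y, s')).
Unshelve. all: by end_near. Qed.

End RealCalculus.


(** * Integrals over the unit interval depending on a parameter *)

Lemma continuous_at_pair (T U V : topologicalType) (f : T -> U) (g : T -> V) (x : T) :
  {for x, continuous f} -> {for x, continuous g} ->
  {for x, continuous (fun t => (f t, g t))}.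
Proof. by move=> cf cg; exact: (cvg_pair cf cg). Qed.

Section UnitIntegral.
Variable R : realType.

Lemma seg0 : seg (0 : R).
Proof. by rewrite /seg /= in_itv /= lexx ler01. Qed.

Lemma seg1 : seg (1 : R).
Proof. by rewrite /seg /= in_itv /= lexx ler01. Qed.

Lemma seg_interior (s : R) : 0 < s < 1 -> seg s.
Proof. by rewrite /seg /= in_itv /= => /andP[/ltW -> /ltW ->]. Qed.

Definition int01 (f : R -> R) : R :=
  (\int[lebesgue_measure]_(s in @seg R) f s)%R.

Definition cont01 (f : R -> R) := forall s, seg s -> {for s, continuous f}.

Lemma integrable01 (f : R -> R) : cont01 f ->
  lebesgue_measure.-integrable (@seg R) (EFin \o f).
Proof.
move=> cf; apply: continuous_compact_integrable; first exact: segment_compact.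
by apply: continuous_in_subspaceT => s; rewrite inE => /cf.
Qed.

Lemma measurable_seg : measurable (@seg R).
Proof. exact: measurable_itv. Qed.

(** The end points form a null set.  This replaces the integrand of
    [path_integral], where [derive1] of a path that is smooth on the segment only
    is arbitrary at 0 and 1, by a continuous one. *)
Lemma int01_ext (f g : R -> R) : cont01 g ->
  (forall s, 0 < s < 1 -> f s = g s) -> int01 f = int01 g.
Proof.
move=> cg fg; rewrite /int01 /Rintegral.
have sub : (`]0, 1[%classic : set R) `<=` @seg R by exact: subset_itv_oo_cc.
have mg := measurable_funS measurable_seg sub (measurable_int _ (integrable01 cg)).
rewrite [in RHS](integral_itv_bndoo _ _ mg) // integral_itv_bndoo; last first.
  apply: eq_measurable_fun mg => s; rewrite inE /= in_itv /= => s01.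
  by rewrite fg.
congr fine; apply: eq_integral => s; rewrite inE /= in_itv /= => s01.
by rewrite fg.
Qed.

Lemma int01D (f g : R -> R) : cont01 f -> cont01 g ->
  int01 (fun s => f s + g s) = int01 f + int01 g.
Proof. by move=> cf cg; apply: RintegralD; [exact: measurable_seg|apply: integrable01..]. Qed.

Lemma int01B (f g : R -> R) : cont01 f -> cont01 g ->
  int01 (fun s => f s - g s) = int01 f - int01 g.
Proof. by move=> cf cg; apply: RintegralB; [exact: measurable_seg|apply: integrable01..]. Qed.

Lemma int01Z (c : R) (f : R -> R) : cont01 f ->
  int01 (fun s => c * f s) = c * int01 f.
Proof. by move=> cf; apply: RintegralZl; [exact: measurable_seg|apply: integrable01]. Qed.

Lemma int01_norm_le (f : R -> R) (C : R) : cont01 f ->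
  (forall s, seg s -> `|f s| <= C) -> `|int01 f| <= C.
Proof.
move=> cf fC; rewrite /int01; apply: le_trans.
  by apply: (@le_normr_Rintegral _ _ _ lebesgue_measure); [exact: measurable_seg|exact: integrable01].
have cn : cont01 (fun s => `|f s|).
  by move=> s s01; apply: (continuous_comp (cf s s01)); apply: norm_continuous.
apply: (@le_trans _ _ (int01 (fun=> C))).
  apply: le_Rintegral => //; first exact: measurable_seg.
    exact: integrable01.
  by apply: integrable01 => s _; exact: cvg_cst.
have := @Rintegral_cst _ _ _ lebesgue_measure (@seg R) measurable_seg C.
have lm : lebesgue_measure (@seg R) = 1%:E.
  by rewrite lebesgue_measure_itv /= lte_fin ltr01 oppr0 adde0.
by rewrite /int01 => ->; rewrite -[X in _ * fine X]/(lebesgue_measure (@seg R)) lm mulr1.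
Qed.

Lemma int01_FTC (f f' : R -> R) : (forall s, seg s -> is_derive s 1 f (f' s)) ->
  cont01 f' -> int01 f' = f 1 - f 0.
Proof.
move=> df cf'; rewrite /int01 /Rintegral (@continuous_FTC2 _ f' f) //.
- by apply: continuous_in_subspaceT => s; rewrite inE => /cf'.
- have cf : {within `[0, 1], continuous f}.
    by apply: derivable_within_continuous => s s01; have [] := df s s01.
  have /(continuous_within_itvP _ ltr01) [_ c0 c1] := cf.
  split=> // s s01; have sI : seg s by exact: subset_itv_oo_cc s01.
  by have [] := df s sI.
- move=> s s01; have sI : seg s by exact: subset_itv_oo_cc s01.
  by rewrite derive1E; have [] := df s sI.
Qed.

(** Continuity along a compact fibre is uniform along it. *)
Lemma tube_continuous (T : topologicalType) (x : T) (F : T * R -> R) :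
  (forall s : R, seg s -> {for (x, s), continuous F}) ->
  forall e, 0 < e -> \forall y \near x, forall s : R, seg s -> `|F (y, s) - F (x, s)| <= e.
Proof.
move=> cF e e0; apply: (@tube R T x (fun q => `|F q - F (x, q.2)| <= e)) => s s01.
have e2 : 0 < e / 2 by rewrite divr_gt0.
have H1 : \forall q \near (x, s), `|F (x, s) - F q| < e / 2.
  by have /cvgrPdist_lt/(_ _ e2) := cF s s01.
have H2 : \forall q \near (x, s), `|F (x, s) - F (x, q.2)| < e / 2.
  have : {for (x, s), continuous (fun q : T * R => F (x, q.2))}.
    apply: (@continuous_comp _ _ _ (fun q : T * R => (x, q.2)) F); last exact: cF.
    by apply: continuous_at_pair; [exact: cvg_cst|exact: cvg_snd].
  by move/cvgrPdist_lt/(_ _ e2).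
near=> q.
have -> : F q - F (x, q.2) = (F (x, s) - F (x, q.2)) - (F (x, s) - F q) by ring.
rewrite (le_trans (ler_normB _ _)) // (splitr e) ltW // ltrD //; by near: q.
Unshelve. all: by end_near. Qed.

Lemma int01_continuous (T : topologicalType) (x : T) (F : T * R -> R) :
  (forall s : R, seg s -> {for (x, s), continuous F}) ->
  (\forall y \near x, cont01 (fun s => F (y, s))) ->
  {for x, continuous (fun y => int01 (fun s => F (y, s)))}.
Proof.
move=> cF cFy; apply/cvgrPdist_le => e e0.
have cx := nbhs_singleton cFy.
have near_e := tube_continuous cF e0.
near=> y; rewrite distrC -int01B //; last by near: y.
apply: int01_norm_le; last by near: y.
by move=> s s01; apply: continuousB; [move: s s01; near: y|exact: cx].
Unshelve. all: by end_near. Qed.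

(** By the mean value theorem in the first variable, the increment of the
    integrand is h times a value of dF at a nearby point, which is close to
    dF (r, s) uniformly in s. *)
Lemma is_derive_int01 (U : set (R * R)) (F dF : R * R -> R) (r : R) :
  open U -> (forall s : R, seg s -> U (r, s)) ->
  (forall q, U q -> is_derive q.1 1 (fun x => F (x, q.2)) (dF q)) ->
  (forall q, U q -> {for q, continuous F}) ->
  (forall q, U q -> {for q, continuous dF}) ->
  is_derive r 1 (fun x => int01 (fun s => F (x, s))) (int01 (fun s => dF (r, s))).
Proof.
move=> oU Ur dFr cF cdF.
have nU : \forall x \near r, forall s : R, seg s -> U (x, s).
  by apply: (@tube R _ r U) => s s01; apply: open_nbhs_nbhs; split => //; apply: Ur.
have section G : (forall q, U q -> {for q, continuous G}) ->
    forall x, (forall s : R, seg s -> U (x, s)) -> cont01 (fun s => G (x, s)).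
  move=> cG x Ux s s01; apply: (@continuous_comp _ _ _ (fun s : R => (x, s)) G).
    by apply: continuous_at_pair; [exact: cvg_cst|exact: cvg_id].
  exact: cG (Ux s s01).
apply/is_derive1P => e e0.
have /tube_continuous/(_ _ e0) ndF : forall s : R, seg s -> {for (r, s), continuous dF}.
  by move=> s s01; apply: cdF; apply: Ur.
have /nbhs_normP[d /= d0 D] : \forall x \near r, (forall s : R, seg s -> U (x, s)) /\
    forall s : R, seg s -> `|dF (x, s) - dF (r, s)| <= e.
  by apply: filterS2 nU ndF.
exists d => // h hd.
have dist k : `|k| <= `|h| -> `|r - (r + k)| < d.
  by move=> kh; rewrite opprD addrA subrr sub0r normrN (le_lt_trans kh).
have cr := section _ cF _ Ur.
have crh := section _ cF _ (D _ (dist h (lexx _))).1.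
have cdr := section _ cdF _ Ur.
rewrite -int01B // -int01Z // -int01B //; last 2 first.
- by move=> s s01; apply: continuousB; [exact: crh|exact: cr].
- by move=> s s01; apply: continuousM; [exact: cvg_cst|exact: cdr].
apply: int01_norm_le.
  move=> s s01; apply: continuousB; first by apply: continuousB; [exact: crh|exact: cr].
  by apply: continuousM; [exact: cvg_cst|exact: cdr].
move=> s s01.
have [|k kh ->] := @MVT_sym R (fun x => F (x, s)) (fun x => dF (x, s)) r h.
  move=> y yh; have -> : y = r + (y - r) by rewrite addrC subrK.
  by apply: (dFr (_, _)); apply: (D _ (dist _ yh)).1.
rewrite -mulrBr normrM mulrC ler_wpM2r //.
exact: (D _ (dist _ kh)).2.
Qed.

End UnitIntegral.


(** * Complex-valued functions and the variation formula *)

Lemma continuous_at_ext (T U : topologicalType) (f g : T -> U) (x : T) :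
  f =1 g -> {for x, continuous f} -> {for x, continuous g}.
Proof. by move=> /funext ->. Qed.

Section ComplexCalculus.
Variable R : realType.
Local Notation C := R[i].
Local Notation Re := (@complex.Re R).
Local Notation Im := (@complex.Im R).
Implicit Types (F G : R -> C) (s : R).

Lemma ReD (x y : C) : Re (x + y) = Re x + Re y. Proof. by case: x y => [? ?] []. Qed.
Lemma ImD (x y : C) : Im (x + y) = Im x + Im y. Proof. by case: x y => [? ?] []. Qed.
Lemma ReN (x : C) : Re (- x) = - Re x. Proof. by case: x. Qed.
Lemma ImN (x : C) : Im (- x) = - Im x. Proof. by case: x. Qed.
Lemma ReM (x y : C) : Re (x * y) = Re x * Re y - Im x * Im y.
Proof. by case: x y => [? ?] []. Qed.
Lemma ImM (x y : C) : Im (x * y) = Re x * Im y + Im x * Re y.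
Proof. by case: x y => [? ?] []. Qed.

Lemma complex_eq (x y : C) : Re x = Re y -> Im x = Im y -> x = y.
Proof. by case: x y => [? ?] [? ?] /= -> ->. Qed.

(** [R[i]] is a normed module over itself and not over R, so derivatives in a
    real variable are taken on real and imaginary parts. *)
Definition is_cderive F s (d : C) : Prop :=
  is_derive s 1 (fun t => Re (F t)) (Re d) /\ is_derive s 1 (fun t => Im (F t)) (Im d).

Definition cont_at (T : topologicalType) (F : T -> C) (x : T) : Prop :=
  {for x, continuous (fun t => Re (F t))} /\ {for x, continuous (fun t => Im (F t))}.

Lemma is_cderive_cst (c : C) s : is_cderive (fun=> c) s 0.
Proof. by split; exact: is_derive_cst. Qed.

Lemma is_cderiveD F G s a b : is_cderive F s a -> is_cderive G s b ->
  is_cderive (fun t => F t + G t) s (a + b).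
Proof.
move=> [F1 F2] [G1 G2]; split; rewrite ?ReD ?ImD.
  by under eq_fun do rewrite ReD; exact: is_deriveD.
by under eq_fun do rewrite ImD; exact: is_deriveD.
Qed.

Lemma is_derive_mul (f g : R -> R) s (a b : R) : is_derive s 1 f a -> is_derive s 1 g b ->
  is_derive s 1 (fun t => f t * g t) (a * g s + f s * b).
Proof.
move=> df dg; have := is_deriveM df dg; rewrite /GRing.scale /= => H.
by have -> : a * g s + f s * b = f s * b + g s * a by ring.
Qed.

Lemma is_cderiveM F G s a b : is_cderive F s a -> is_cderive G s b ->
  is_cderive (fun t => F t * G t) s (a * G s + F s * b).
Proof.
move=> [F1 F2] [G1 G2]; split.
  under eq_fun do rewrite ReM; rewrite ReD !ReM.
  have := is_deriveB (is_derive_mul F1 G1) (is_derive_mul F2 G2).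
  by congr (is_derive _ _ _ _); ring.
under eq_fun do rewrite ImM; rewrite ImD !ImM.
have := is_deriveD (is_derive_mul F1 G2) (is_derive_mul F2 G1).
by congr (is_derive _ _ _ _); ring.
Qed.

Lemma cont_at_cst (T : topologicalType) (c : C) (x : T) : cont_at (fun=> c) x.
Proof. by split; exact: cvg_cst. Qed.

Lemma cont_atD (T : topologicalType) (F G : T -> C) (x : T) :
  cont_at F x -> cont_at G x -> cont_at (fun t => F t + G t) x.
Proof.
move=> [F1 F2] [G1 G2]; split.
  by apply: (continuous_at_ext (fun t => esym (ReD _ _))); exact: continuousD.
by apply: (continuous_at_ext (fun t => esym (ImD _ _))); exact: continuousD.
Qed.

Lemma cont_atN (T : topologicalType) (F : T -> C) (x : T) :
  cont_at F x -> cont_at (fun t => - F t) x.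
Proof.
move=> [F1 F2]; split.
  by apply: (continuous_at_ext (fun t => esym (ReN _))); exact: continuousN.
by apply: (continuous_at_ext (fun t => esym (ImN _))); exact: continuousN.
Qed.

Lemma cont_atM (T : topologicalType) (F G : T -> C) (x : T) :
  cont_at F x -> cont_at G x -> cont_at (fun t => F t * G t) x.
Proof.
move=> [F1 F2] [G1 G2]; split.
  by apply: (continuous_at_ext (fun t => esym (ReM _ _))); apply: continuousB; exact: continuousM.
by apply: (continuous_at_ext (fun t => esym (ImM _ _))); apply: continuousD; exact: continuousM.
Qed.

Lemma cont_at_comp (T T' : topologicalType) (h : T' -> T) (F : T -> C) (x : T') :
  {for x, continuous h} -> cont_at F (h x) -> cont_at (fun t => F (h t)) x.
Proof.
move=> ch [F1 F2]; split.
  exact: (@continuous_comp _ _ _ h (fun t => Re (F t))).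
exact: (@continuous_comp _ _ _ h (fun t => Im (F t))).
Qed.

(** [eval2] with complex instead of paired real coordinates. *)
Definition evalC (f : poly2 R) (x y : C) : C :=
  meval (fun i : 'I_2 => if i == varx then x else y) f.

Lemma evalCD f g x y : evalC (f + g) x y = evalC f x y + evalC g x y.
Proof. exact: mevalD. Qed.
Lemma evalCB f g x y : evalC (f - g) x y = evalC f x y - evalC g x y.
Proof. exact: mevalB. Qed.
Lemma evalCM f g x y : evalC (f * g) x y = evalC f x y * evalC g x y.
Proof. exact: mevalM. Qed.
Lemma evalCC (c : C) x y : evalC (mpolyC 2 c) x y = c.
Proof. exact: mevalC. Qed.
Lemma evalCZ (c : C) f x y : evalC (c *: f) x y = c * evalC f x y.
Proof. exact: mevalZ. Qed.
Lemma evalC_mderivD i f g x y : evalC (mderiv i (f + g)) x y =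
  evalC (mderiv i f) x y + evalC (mderiv i g) x y.
Proof. by rewrite mderivD evalCD. Qed.
Lemma evalC_mderivM i f g x y : evalC (mderiv i (f * g)) x y =
  evalC (mderiv i f) x y * evalC g x y + evalC f x y * evalC (mderiv i g) x y.
Proof. by rewrite mderivM evalCD (evalCM _ g) (evalCM f). Qed.
Lemma evalC0 x y : evalC 0 x y = 0.
Proof. by rewrite -(mpolyC0 2 C) evalCC. Qed.
Lemma evalC1 x y : evalC 1 x y = 1.
Proof. by rewrite -(mpolyC1 2 C) evalCC. Qed.
Lemma evalCX x y : evalC (mpolyX _ (mnm1 varx)) x y = x.
Proof. by rewrite /evalC mevalXU. Qed.
Lemma evalCY x y : evalC (mpolyX _ (mnm1 vary)) x y = y.
Proof. by rewrite /evalC mevalXU. Qed.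

Lemma poly2_ind (P : poly2 R -> Prop) :
  (forall c, P (mpolyC 2 c)) -> P (mpolyX _ (mnm1 varx)) -> P (mpolyX _ (mnm1 vary)) ->
  (forall f g, P f -> P g -> P (f + g)) -> (forall f g, P f -> P g -> P (f * g)) ->
  forall f, P f.
Proof.
move=> PC PX PY PD PM f.
have P1 : P 1 by rewrite -mpolyC1.
have Pexp g k : P g -> P (g ^+ k).
  by move=> Pg; elim: k => [|k IH]; rewrite ?expr0 // exprS; apply: PM.
rewrite (mpolyE f); elim/big_rec: _ => [|m g _ Pg]; first by rewrite -mpolyC0.
apply: PD => //; rewrite -mul_mpolyC; apply: (PM) => //.
by rewrite mpolyX_bimon; apply: (PM); apply: (Pexp).
Qed.

Lemma is_cderive_evalC (f : poly2 R) (X Y : R -> C) s (dX dY : C) :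
  is_cderive X s dX -> is_cderive Y s dY ->
  is_cderive (fun t => evalC f (X t) (Y t)) s
    (evalC (mderiv varx f) (X s) (Y s) * dX + evalC (mderiv vary f) (X s) (Y s) * dY).
Proof.
move=> hX hY; elim/poly2_ind: f => [c|||f g IHf IHg|f g IHf IHg].
- under eq_fun do rewrite evalCC; rewrite !mderivC !evalC0 !mul0r addr0.
  exact: is_cderive_cst.
- under eq_fun do rewrite evalCX.
  rewrite !mderivX !mnm1E eqxx scale0r evalC0 mul0r addr0 scale1r.
  have -> : mnm_sub (mnm1 varx) (mnm1 varx) = mnm0 by apply/mnmP => l; rewrite mnmBE subnn mnm0E.
  by rewrite mpolyX0 evalC1 mul1r.
- under eq_fun do rewrite evalCY.
  rewrite !mderivX !mnm1E eqxx scale0r evalC0 mul0r add0r scale1r.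
  have -> : mnm_sub (mnm1 vary) (mnm1 vary) = mnm0 by apply/mnmP => l; rewrite mnmBE subnn mnm0E.
  by rewrite mpolyX0 evalC1 mul1r.
- rewrite (_ : (fun t => evalC (f + g) (X t) (Y t)) =
    (fun t => evalC f (X t) (Y t) + evalC g (X t) (Y t))); last by apply/funext => t; exact: evalCD.
  rewrite 2!evalC_mderivD.
  move: (is_cderiveD IHf IHg).
  move: (evalC (mderiv varx f) _ _) (evalC (mderiv vary f) _ _)
    (evalC (mderiv varx g) _ _) (evalC (mderiv vary g) _ _) => c d e e'.
  by congr is_cderive; ring.
- rewrite (_ : (fun t => evalC (f * g) (X t) (Y t)) =
    (fun t => evalC f (X t) (Y t) * evalC g (X t) (Y t))); last by apply/funext => t; exact: evalCM.
  rewrite 2!evalC_mderivM.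
  move: (is_cderiveM IHf IHg).
  move: (evalC f _ _) (evalC g _ _) (evalC (mderiv varx f) _ _) (evalC (mderiv vary f) _ _)
    (evalC (mderiv varx g) _ _) (evalC (mderiv vary g) _ _) => a b c d e e'.
  by congr is_cderive; ring.
Qed.

Lemma cont_at_evalC (T : topologicalType) (f : poly2 R) (X Y : T -> C) (x : T) :
  cont_at X x -> cont_at Y x -> cont_at (fun t => evalC f (X t) (Y t)) x.
Proof.
move=> hX hY; elim/poly2_ind: f => [c|||f g IHf IHg|f g IHf IHg].
- by under eq_fun do rewrite evalCC; exact: cont_at_cst.
- by under eq_fun do rewrite evalCX.
- by under eq_fun do rewrite evalCY.
- by under eq_fun do rewrite evalCD; exact: cont_atD.
- by under eq_fun do rewrite evalCM; exact: cont_atM.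
Qed.

Definition cint (F : R -> C) : C :=
  int01 (fun s => Re (F s)) +i* int01 (fun s => Im (F s)).

Definition ccont01 F := forall s, seg s -> cont_at F s.

Lemma ccont01_Re F : ccont01 F -> cont01 (fun s => Re (F s)).
Proof. by move=> cF s /cF[]. Qed.

Lemma ccont01_Im F : ccont01 F -> cont01 (fun s => Im (F s)).
Proof. by move=> cF s /cF[]. Qed.

Lemma cint_ext F G : ccont01 G -> (forall s, 0 < s < 1 -> F s = G s) -> cint F = cint G.
Proof.
move=> cG FG; rewrite /cint; congr (_ +i* _).
  by apply: int01_ext => [|s /FG ->]//; exact: ccont01_Re.
by apply: int01_ext => [|s /FG ->]//; exact: ccont01_Im.
Qed.

Lemma cintD F G : ccont01 F -> ccont01 G ->
  cint (fun s => F s + G s) = cint F + cint G.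
Proof.
move=> cF cG; apply: complex_eq => /=.
  under eq_fun do rewrite ReD.
  by rewrite int01D //; exact: ccont01_Re.
under eq_fun do rewrite ImD.
by rewrite int01D //; exact: ccont01_Im.
Qed.

Lemma cintZ (c : C) F : ccont01 F -> cint (fun s => c * F s) = c * cint F.
Proof.
move=> cF; have cR := ccont01_Re cF; have cI := ccont01_Im cF.
have cZ (a : R) (f : R -> R) : cont01 f -> cont01 (fun s => a * f s).
  by move=> cf s s01; apply: continuousM; [exact: cvg_cst|exact: cf].
apply: complex_eq; rewrite ?ReM ?ImM /=.
  under eq_fun do rewrite ReM.
  by rewrite int01B ?int01Z //; exact: cZ.
under eq_fun do rewrite ImM.
by rewrite int01D ?int01Z //; exact: cZ.
Qed.

Lemma cint_FTC F F' : (forall s, seg s -> is_cderive F s (F' s)) -> ccont01 F' ->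
  cint F' = F 1 - F 0.
Proof.
move=> dF cF'; apply: complex_eq; rewrite ?ReD ?ImD ?ReN ?ImN /=.
  by apply: (@int01_FTC R (fun s => Re (F s))); [move=> s /dF[]|exact: ccont01_Re].
by apply: (@int01_FTC R (fun s => Im (F s))); [move=> s /dF[]|exact: ccont01_Im].
Qed.

Lemma is_cderive_cint (U : set (R * R)) (F dF : R * R -> C) (r : R) :
  open U -> (forall s : R, seg s -> U (r, s)) ->
  (forall q, U q -> is_cderive (fun x => F (x, q.2)) q.1 (dF q)) ->
  (forall q, U q -> cont_at F q) -> (forall q, U q -> cont_at dF q) ->
  is_cderive (fun x => cint (fun s => F (x, s))) r (cint (fun s => dF (r, s))).
Proof.
move=> oU Ur dFr cF cdF; split=> /=.
  apply: (@is_derive_int01 R U (fun q => Re (F q)) (fun q => Re (dF q))) => // q Uq.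
  - by case: (dFr _ Uq).
  - by case: (cF _ Uq).
  - by case: (cdF _ Uq).
apply: (@is_derive_int01 R U (fun q => Im (F q)) (fun q => Im (dF q))) => // q Uq.
- by case: (dFr _ Uq).
- by case: (cF _ Uq).
- by case: (cdF _ Uq).
Qed.

(** What the variation formula needs of a map of two real parameters: both first
    derivatives, and a common value of the two mixed second derivatives. *)
Definition mixedC2 (U : set (R * R)) (z zr zs zrs : R * R -> C) : Prop :=
  forall q, U q ->
  [/\ is_cderive (fun r => z (r, q.2)) q.1 (zr q),
      is_cderive (fun s => z (q.1, s)) q.2 (zs q),
      is_cderive (fun r => zs (r, q.2)) q.1 (zrs q),
      is_cderive (fun s => zr (q.1, s)) q.2 (zrs q) &
      [/\ cont_at z q, cont_at zr q, cont_at zs q & cont_at zrs q]].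

(** Differentiate under the integral sign.  The r-derivative dF of the integrand
    and the s-derivative dB of omega(Gamma_r) contain the same mixed second
    derivatives; their difference is d omega(Gamma_r, Gamma_s), and dB is
    integrated by the fundamental theorem of calculus. *)
Lemma variation (w : form1 R) (U : set (R * R)) (r : R)
    (x xr xs xrs y yr ys yrs : R * R -> C) :
  open U -> (forall s : R, seg s -> U (r, s)) ->
  mixedC2 U x xr xs xrs -> mixedC2 U y yr ys yrs ->
  let P q := evalC w.1 (x q) (y q) in
  let Q q := evalC w.2 (x q) (y q) in
  let B q := P q * xr q + Q q * yr q in
  is_cderive (fun t => cint (fun s => P (t, s) * xs (t, s) + Q (t, s) * ys (t, s))) r
    (B (r, 1) - B (r, 0) +
     cint (fun s => evalC (d1 w) (x (r, s)) (y (r, s)) *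
        (xr (r, s) * ys (r, s) - xs (r, s) * yr (r, s)))).
Proof.
move=> oU Ur Dx Dy P Q B.
pose D f q := evalC f (x q) (y q).
have cD f q : U q -> cont_at (D f) q.
  by move=> Uq; have [_ _ _ _ [cx _ _ _]] := Dx q Uq; have [_ _ _ _ [cy _ _ _]] := Dy q Uq;
     exact: cont_at_evalC.
pose dF q := (D (mderiv varx w.1) q * xr q + D (mderiv vary w.1) q * yr q) * xs q + P q * xrs q +
  ((D (mderiv varx w.2) q * xr q + D (mderiv vary w.2) q * yr q) * ys q + Q q * yrs q).
pose dB q := (D (mderiv varx w.1) q * xs q + D (mderiv vary w.1) q * ys q) * xr q + P q * xrs q +
  ((D (mderiv varx w.2) q * xs q + D (mderiv vary w.2) q * ys q) * yr q + Q q * yrs q).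
pose W q := D (d1 w) q * (xr q * ys q - xs q * yr q).
have dFE q : dF q = dB q + W q.
  have green (px py qx qy p' q' a b c d e g : C) :
    (px * a + py * d) * b + p' * c + ((qx * a + qy * d) * e + q' * g) =
    (px * b + py * e) * a + p' * c + ((qx * b + qy * e) * d + q' * g) +
    (qx - py) * (a * e - b * d) by ring.
  have -> : W q = (D (mderiv varx w.2) q - D (mderiv vary w.1) q) *
      (xr q * ys q - xs q * yr q) by rewrite /W /D /d1 evalCB.
  exact: green.
have sect (G : R * R -> C) : (forall q, U q -> cont_at G q) -> ccont01 (fun s => G (r, s)).
  move=> cG s s01; apply: (cont_at_comp (h := fun s => (r, s))) (cG _ (Ur s s01)).
  by apply: continuous_at_pair; [exact: cvg_cst|exact: cvg_id].
have comb q f g h (u v z k : R * R -> C) : U q ->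
    cont_at u q -> cont_at v q -> cont_at z q -> cont_at k q ->
    cont_at (fun q => (D f q * u q + D g q * v q) * z q + D h q * k q) q.
  move=> Uq cu cv cz ck.
  exact: (cont_atD (cont_atM (cont_atD (cont_atM (cD f q Uq) cu) (cont_atM (cD g q Uq) cv)) cz)
    (cont_atM (cD h q Uq) ck)).
have cdB q : U q -> cont_at dB q.
  move=> Uq; have [_ _ _ _ [cx1 cx2 cx3 cx4]] := Dx q Uq.
  have [_ _ _ _ [cy1 cy2 cy3 cy4]] := Dy q Uq.
  exact: (cont_atD (comb q _ _ w.1 _ _ _ _ Uq cx3 cy3 cx2 cx4)
                   (comb q _ _ w.2 _ _ _ _ Uq cx3 cy3 cy2 cy4)).
have cW q : U q -> cont_at W q.
  move=> Uq; have [_ _ _ _ [cx1 cx2 cx3 cx4]] := Dx q Uq.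
  have [_ _ _ _ [cy1 cy2 cy3 cy4]] := Dy q Uq.
  exact: (cont_atM (cD (d1 w) q Uq) (cont_atD (cont_atM cx2 cy3) (cont_atN (cont_atM cx3 cy2)))).
have -> : B (r, 1) - B (r, 0) + cint (fun s => W (r, s)) = cint (fun s => dF (r, s)).
  under [in RHS]eq_fun do rewrite dFE.
  rewrite cintD; [|exact: sect cdB|exact: sect cW].
  congr (_ + _); symmetry; apply: (@cint_FTC (fun s => B (r, s))); last exact: sect cdB.
  move=> s s01; have Uq := Ur s s01.
  have [_ dxs _ dxrs _] := Dx _ Uq; have [_ dys _ dyrs _] := Dy _ Uq.
  apply: is_cderiveD; apply: is_cderiveM => //.
    exact: (is_cderive_evalC w.1 dxs dys).
  exact: (is_cderive_evalC w.2 dxs dys).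
have dint := @is_cderive_cint U (fun q => P q * xs q + Q q * ys q) dF r oU Ur.
apply: dint => q Uq.
- have [dxr _ dxs _ _] := Dx _ Uq; have [dyr _ dys _ _] := Dy _ Uq.
  apply: is_cderiveD.
    have := is_cderiveM (is_cderive_evalC w.1 dxr dyr) dxs.
    by case: (q).
  have := is_cderiveM (is_cderive_evalC w.2 dxr dyr) dys.
  by case: (q).
- have [_ _ _ _ [cx1 cx2 cx3 cx4]] := Dx q Uq; have [_ _ _ _ [cy1 cy2 cy3 cy4]] := Dy q Uq.
  exact: (cont_atD (cont_atM (cD w.1 q Uq) cx3) (cont_atM (cD w.2 q Uq) cy3)).
- have -> : dF = (fun q => dB q + W q) by apply/funext.
  by apply: cont_atD; [exact: cdB|exact: cW].
Qed.

End ComplexCalculus.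


(** * Second derivatives of compositions *)

Section SmoothComposition.
Variable R : realType.

(** The real counterpart of [mixedC2]. *)
Definition mixedC2_real (U : set (R * R)) (a ar as_ ars : R * R -> R) : Prop :=
  forall q, U q ->
  [/\ is_derive q.1 1 (fun r => a (r, q.2)) (ar q),
      is_derive q.2 1 (fun s => a (q.1, s)) (as_ q),
      is_derive q.1 1 (fun r => as_ (r, q.2)) (ars q),
      is_derive q.2 1 (fun s => ar (q.1, s)) (ars q) &
      [/\ {for q, continuous a}, {for q, continuous ar},
          {for q, continuous as_} & {for q, continuous ars}]].

(** Two continuous derivatives in all directions; the directional form of class
    C^2 that [Ck] provides. *)
Definition directionalC2 (V : normedModType R) (O : set V) (u : V -> R)
    (Du : V -> V -> R) (DDu : V -> V -> V -> R) : Prop :=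
  forall x, O x ->
  [/\ forall v, is_derive x v u (Du v x),
      forall v w, is_derive x w (Du v) (DDu v w x),
      {for x, continuous u}, forall v, {for x, continuous (Du v)} &
      forall v w, {for x, continuous (DDu v w)}].

Lemma is_derive_linear_comp (V W : normedModType R) (phi : W -> R) (f : V -> W) (x v : V) :
  continuous phi -> (forall a y z, phi (a *: y + z) = a * phi y + phi z) ->
  derivable f x v -> is_derive x v (phi \o f) (phi ('D_v f x)).
Proof.
move=> cphi lphi df.
have phiZ a y : phi (a *: y) = a * phi y.
  have := lphi 1 0 0; rewrite scale1r addr0 mul1r => /eqP.
  rewrite -subr_eq0 opprD addrA subrr sub0r oppr_eq0 => /eqP p0.
  by have := lphi a y 0; rewrite p0 !addr0.
have phiB y z : phi (y - z) = phi y - phi z.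
  by rewrite addrC -[- z]scaleN1r lphi mulN1r addrC.
have E : (fun h : R => h^-1 *: ((phi \o f) (h *: v + x) - (phi \o f) x)) =
         phi \o (fun h : R => h^-1 *: (f (h *: v + x) - f x)).
  by apply/funext => h /=; rewrite phiZ phiB.
have cv : (phi \o (fun h : R => h^-1 *: (f (h *: v + x) - f x))) @ 0^' --> phi ('D_v f x).
  exact: (continuous_cvg _ (cphi _) df).
split; first by rewrite /derivable /= E; apply/cvg_ex; exists (phi ('D_v f x)).
by rewrite /derive /= E; apply/cvg_lim.
Qed.

(** A continuous linear functional commutes with directional derivatives. *)
Lemma Ck_directionalC2 (V W : normedModType R) (phi : W -> R) (O : set V) (f : V -> W) :
  continuous phi -> (forall a y z, phi (a *: y + z) = a * phi y + phi z) ->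
  (forall k, Ck k O f) ->
  directionalC2 O (phi \o f) (fun v x => phi ('D_v f x)) (fun v w x => phi ('D_w ('D_v f) x)).
Proof.
move=> cphi lphi Cf x Ox.
have C2 v := Cf 2 v; have C1 v := Cf 1 v; have C0 := Cf 0.
split=> [v|v w||v|v w].
- by apply: is_derive_linear_comp => //; apply: (C1 v).1.
- by apply: (@is_derive_linear_comp _ _ phi ('D_v f)) => //; apply: ((C2 v).2 w).1.
- by apply: (@continuous_comp _ _ _ f phi); [exact: C0|exact: cphi].
- by apply: (@continuous_comp _ _ _ ('D_v f) phi); [exact: (C1 v).2|exact: cphi].
- by apply: (@continuous_comp _ _ _ ('D_w ('D_v f)) phi); [exact: ((C2 v).2 w).2|exact: cphi].
Qed.

Lemma is_derive_sumM (N : nat) (a b : 'I_N -> R -> R) (a' b' : 'I_N -> R) (s : R) :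
  (forall i, is_derive s 1 (a i) (a' i)) -> (forall i, is_derive s 1 (b i) (b' i)) ->
  is_derive s 1 (fun t => \sum_i a i t * b i t) (\sum_i (a' i * b i s + a i s * b' i)).
Proof.
move=> da db.
have -> : (fun t => \sum_i a i t * b i t) = \sum_i (fun t => a i t * b i t).
  by apply/funext => t; rewrite fct_sumE.
by apply: is_derive_sum => i; exact: is_derive_mul.
Qed.

(** Two applications of the chain rule express both mixed derivatives through
    those of u, and [schwarz] on the parameter plane identifies them. *)
Lemma directionalC2_comp (V : normedModType R) (O : set V) (u : V -> R) Du DDu (N : nat)
    (e : 'I_N -> V) (U : set (R * R)) (c cr cs crs : 'I_N -> R * R -> R) :
  open O -> open U -> directionalC2 O u Du DDu ->
  (forall i, mixedC2_real U (c i) (cr i) (cs i) (crs i)) ->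
  (forall q, U q -> O (\sum_i c i q *: e i)) ->
  exists ar as_ ars, mixedC2_real U (fun q => u (\sum_i c i q *: e i)) ar as_ ars.
Proof.
move=> oO oU Cu Cc UO; (* the two mixed derivatives, in either order of differentiation *)
pose p q := \sum_i c i q *: e i.
pose ar q := \sum_i cr i q * Du (e i) (p q).
pose as_ q := \sum_i cs i q * Du (e i) (p q).
pose ars q := \sum_i (crs i q * Du (e i) (p q) +
  cr i q * \sum_j cs j q * DDu (e i) (e j) (p q)).
pose asr q := \sum_i (crs i q * Du (e i) (p q) +
  cs i q * \sum_j cr j q * DDu (e i) (e j) (p q)).
have cp q : U q -> {for q, continuous p}.
  move=> Uq; apply: continuous_at_sum => i _.
  have [_ _ _ _ [ci _ _ _]] := Cc i q Uq.
  exact: (cvgZr_tmp ci).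
have cDu q i : U q -> {for q, continuous (fun q => Du (e i) (p q))}.
  move=> Uq; apply: (@continuous_comp _ _ _ p (Du (e i)) q (cp q Uq)).
  by have [_ _ _ + _] := Cu _ (UO q Uq); apply.
have cDDu q i j : U q -> {for q, continuous (fun q => DDu (e i) (e j) (p q))}.
  move=> Uq; apply: (@continuous_comp _ _ _ p (DDu (e i) (e j)) q (cp q Uq)).
  by have [_ _ _ _] := Cu _ (UO q Uq); apply.
have dr q v Dv : U q -> (forall x, O x -> forall w, is_derive x w v (Dv w x)) ->
    (forall x, O x -> forall w, {for x, continuous (Dv w)}) ->
    is_derive q.1 1 (fun r => v (p (r, q.2))) (\sum_i cr i q * Dv (e i) (p q)).
  move=> Uq dv cv.
  have := @curve_chain R V O v N e (fun i => Dv (e i)) (fun i r => c i (r, q.2))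
    (fun i => cr i q) q.1 oO (fun i x Ox => dv x Ox (e i)) (fun i x Ox => cv x Ox (e i)).
  have -> : (q.1, q.2) = q by case: (q).
  by apply=> [i|]; [have [] := Cc i q Uq|exact: UO].
have ds q v Dv : U q -> (forall x, O x -> forall w, is_derive x w v (Dv w x)) ->
    (forall x, O x -> forall w, {for x, continuous (Dv w)}) ->
    is_derive q.2 1 (fun s => v (p (q.1, s))) (\sum_i cs i q * Dv (e i) (p q)).
  move=> Uq dv cv.
  have := @curve_chain R V O v N e (fun i => Dv (e i)) (fun i s => c i (q.1, s))
    (fun i => cs i q) q.2 oO (fun i x Ox => dv x Ox (e i)) (fun i x Ox => cv x Ox (e i)).
  have -> : (q.1, q.2) = q by case: (q).
  by apply=> [i|]; [have [] := Cc i q Uq|exact: UO].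
have dDu x : O x -> forall w, is_derive x w u (Du w x) by move=> /Cu[].
have cDu' x : O x -> forall w, {for x, continuous (Du w)} by move=> /Cu[].
have dDDu i x : O x -> forall w, is_derive x w (Du (e i)) (DDu (e i) w x).
  by move=> /Cu[_ + _ _ _] w; apply.
have cDDu' i x : O x -> forall w, {for x, continuous (DDu (e i) w)}.
  by move=> /Cu[_ _ _ _ +] w; apply.
have d1 q : U q -> is_derive q.1 1 (fun r => u (p (r, q.2))) (ar q).
  by move=> Uq; exact: dr.
have d2 q : U q -> is_derive q.2 1 (fun s => u (p (q.1, s))) (as_ q).
  by move=> Uq; exact: ds.
have d3 q : U q -> is_derive q.1 1 (fun r => as_ (r, q.2)) (asr q).
  move=> Uq; have := @is_derive_sumM N (fun i r => cs i (r, q.2))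
    (fun i r => Du (e i) (p (r, q.2))) (fun i => crs i q)
    (fun i => \sum_j cr j q * DDu (e i) (e j) (p q)) q.1.
  have -> : (q.1, q.2) = q by case: (q).
  by apply=> i; [have [] := Cc i q Uq|apply: dr => // x; exact: cDDu'].
have d4 q : U q -> is_derive q.2 1 (fun s => ar (q.1, s)) (ars q).
  move=> Uq; have := @is_derive_sumM N (fun i s => cr i (q.1, s))
    (fun i s => Du (e i) (p (q.1, s))) (fun i => crs i q)
    (fun i => \sum_j cs j q * DDu (e i) (e j) (p q)) q.2.
  have -> : (q.1, q.2) = q by case: (q).
  by apply=> i; [have [] := Cc i q Uq|apply: ds => // x; exact: cDDu'].
have c4 q : U q -> {for q, continuous ars}.
  move=> Uq; apply: continuous_at_sum => i _.
  have [_ _ _ _ [_ ci _ di]] := Cc i q Uq.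
  apply: (@continuousD _ _ _ (fun q => crs i q * Du (e i) (p q))).
    by apply: continuousM => //; exact: cDu.
  apply: (@continuousM _ _ (cr i)) => //; apply: continuous_at_sum => j _.
  have [_ _ _ _ [_ _ cj _]] := Cc j q Uq.
  by apply: continuousM => //; exact: cDDu.
have c3 q : U q -> {for q, continuous asr}.
  move=> Uq; apply: continuous_at_sum => i _.
  have [_ _ _ _ [_ _ ci di]] := Cc i q Uq.
  apply: (@continuousD _ _ _ (fun q => crs i q * Du (e i) (p q))).
    by apply: continuousM => //; exact: cDu.
  apply: (@continuousM _ _ (cs i)) => //; apply: continuous_at_sum => j _.
  have [_ _ _ _ [_ cj _ _]] := Cc j q Uq.
  by apply: continuousM => //; exact: cDDu.
exists ar, as_, ars => q Uq; split; [exact: d1|exact: d2| |exact: d4|split].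
- rewrite (@schwarz R U (fun q => u (p q)) ar as_ ars asr q oU Uq d1 d2 d4 d3 (c4 _ Uq) (c3 _ Uq)).
  exact: d3.
- apply: (@continuous_comp _ _ _ p u q (cp q Uq)).
  by have [_ _ + _ _] := Cu _ (UO q Uq).
- apply: continuous_at_sum => i _; have [_ _ _ _ [_ ci _ _]] := Cc i q Uq.
  by apply: continuousM => //; exact: cDu.
- apply: continuous_at_sum => i _; have [_ _ _ _ [_ _ ci _]] := Cc i q Uq.
  by apply: continuousM => //; exact: cDu.
- exact: c4.
Qed.

(** The four real coordinates of a point of C^2. *)
Definition coord (a b : bool) (p : (R * R) * (R * R)) : R :=
  let z := if a then p.1 else p.2 in if b then z.1 else z.2.

Lemma coord_continuous a b : continuous (coord a b).
Proof.
have c1 (X Y : topologicalType) : continuous (@fst X Y) by move=> x; exact: cvg_fst.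
have c2 (X Y : topologicalType) : continuous (@snd X Y) by move=> x; exact: cvg_snd.
move=> x; case: a; case: b.
- exact: (@continuous_comp _ _ _ fst fst x (c1 _ _ _) (c1 _ _ _)).
- exact: (@continuous_comp _ _ _ fst snd x (c1 _ _ _) (c2 _ _ _)).
- exact: (@continuous_comp _ _ _ snd fst x (c2 _ _ _) (c1 _ _ _)).
- exact: (@continuous_comp _ _ _ snd snd x (c2 _ _ _) (c2 _ _ _)).
Qed.

Lemma coord_linear a b (k : R) (y z : (R * R) * (R * R)) :
  coord a b (k *: y + z) = k * coord a b y + coord a b z.
Proof. by case: a; case: b. Qed.

Lemma Ck_coord (V : normedModType R) (O : set V) (f : V -> (R * R) * (R * R)) a b :
  (forall k, Ck k O f) ->
  directionalC2 O (coord a b \o f) (fun v x => coord a b ('D_v f x))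
    (fun v w x => coord a b ('D_w ('D_v f) x)).
Proof. exact: Ck_directionalC2 (@coord_continuous a b) (@coord_linear a b). Qed.

Lemma mixedC2_comp (V : normedModType R) (O : set V) (G : V -> (R * R) * (R * R)) (N : nat)
    (e : 'I_N -> V) (U : set (R * R)) (c cr cs crs : 'I_N -> R * R -> R) :
  open O -> open U -> (forall k, Ck k O G) ->
  (forall i, mixedC2_real U (c i) (cr i) (cs i) (crs i)) ->
  (forall q, U q -> O (\sum_i c i q *: e i)) ->
  (exists xr xs xrs, mixedC2 U (fun q => cplx (G (\sum_i c i q *: e i)).1) xr xs xrs) /\
  (exists yr ys yrs, mixedC2 U (fun q => cplx (G (\sum_i c i q *: e i)).2) yr ys yrs).
Proof.
move=> oO oU CG Cc UO.
have pair a : exists xr xs xrs,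
    mixedC2 U (fun q => coord a true (G (\sum_i c i q *: e i)) +i*
                       coord a false (G (\sum_i c i q *: e i))) xr xs xrs.
  have [ar [as_ [ars A]]] := directionalC2_comp oO oU (Ck_coord a true CG) Cc UO.
  have [br [bs [brs B]]] := directionalC2_comp oO oU (Ck_coord a false CG) Cc UO.
  exists (fun q => ar q +i* br q), (fun q => as_ q +i* bs q), (fun q => ars q +i* brs q).
  move=> q Uq; have [a1 a2 a3 a4 [a5 a6 a7 a8]] := A q Uq.
  by have [b1 b2 b3 b4 [b5 b6 b7 b8]] := B q Uq; split; [split..|split; split].
by split; [exact: (pair true)|exact: (pair false)].
Qed.

End SmoothComposition.


(** * Paths and triangles in level curves *)

Section Paths.
Variable R : realType.
Local Notation C := R[i].
Local Notation C2 := ((R * R) * (R * R))%type.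

Lemma is_cderive_unique (F : R -> C) (s : R) (a b : C) :
  is_cderive F s a -> is_cderive F s b -> a = b.
Proof. by move=> [[_ a1] [_ a2]] [[_ b1] [_ b2]]; apply: complex_eq; congruence. Qed.

(** A two-sided derivative at a point of the segment, end points included, is a
    limit along the segment. *)
Lemma is_derive_affine_on_seg (f : R -> R) (s d a b : R) : seg s ->
  is_derive s 1 f d -> (forall t, seg t -> f t = a + b * t) -> d = b.
Proof.
move=> s01 df fE; apply/eqP; rewrite -subr_eq0 -normr_le0; apply/ler_addgt0Pl => e e0.
rewrite addr0; have [r r0 H] := (is_derive1P f s d).1 df _ e0.
have [k [k0 kr sk]] : exists k, [/\ k != 0, `|k| < r & seg (s + k)].
  move: s01; rewrite /seg /= in_itv /= => /andP[s0 s1].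
  (* a step of length at most 1/2 that stays in [0, 1], to the right or to the
     left of s *)
  pose m := Num.min r 1 / 2; have m0 : 0 < m by rewrite divr_gt0 // lt_min r0 ltr01.
  have mr : m < r.
    by rewrite /m ltr_pdivrMr // (@le_lt_trans _ _ r) ?ge_min ?lexx // ltr_pMr // ltr1n.
  have m1 : m <= 1 / 2 by rewrite /m ler_pM2r ?invr_gt0 // ge_min lexx orbT.
  have [s2|s2] := leP s (1 / 2).
    exists m; rewrite gtr0_norm // gt_eqF //; split=> //.
    by rewrite in_itv /=; apply/andP; split; lra.
  exists (- m); rewrite normrN gtr0_norm // oppr_eq0 gt_eqF //; split=> //.
  by rewrite in_itv /=; apply/andP; split; lra.
have := H k kr; rewrite !fE //.
have -> : a + b * (s + k) - (a + b * s) - k * d = (b - d) * k by ring.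
by rewrite normrM ler_pM2r ?normr_gt0 // distrC.
Qed.

Lemma is_cderive_affine_on_seg (F : R -> C) (s : R) (d a b : C) : seg s ->
  is_cderive F s d -> (forall t, seg t -> F t = a + b * (t%:C)%C) -> d = b.
Proof.
move=> s01 [d1 d2] FE; apply: complex_eq.
  apply: (is_derive_affine_on_seg s01 d1 (a := complex.Re a)) => t /FE ->.
  by rewrite ReD ReM /= mulr0 subr0.
apply: (is_derive_affine_on_seg s01 d2 (a := complex.Im a)) => t /FE ->.
by rewrite ImD ImM /= mulr0 add0r.
Qed.

(** X and Y are differentiable across the end points, whereas g is only required
    to agree with them on the segment. *)
Definition C1path (g : R -> C2) (X Y dX dY : R -> C) : Prop :=
  forall s, seg s ->
  [/\ cplx (g s).1 = X s, cplx (g s).2 = Y s, is_cderive X s (dX s),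
      is_cderive Y s (dY s) & cont_at dX s /\ cont_at dY s].

Definition C1able (g : R -> C2) := exists X Y dX dY, C1path g X Y dX dY.

Lemma is_derive_pair (V W1 W2 : normedModType R) (f : V -> W1) (g : V -> W2)
    (x v : V) (a : W1) (b : W2) :
  is_derive x v f a -> is_derive x v g b ->
  is_derive x v (fun t => (f t, g t)) (a, b).
Proof.
move=> [df <-] [dg <-].
have cv : (fun h : R => h^-1 *: ((f (h *: v + x), g (h *: v + x)) - (f x, g x)))
    @ 0^' --> ('D_v f x, 'D_v g x).
  exact: (cvg_pair df dg).
by split; [apply/cvg_ex; exists ('D_v f x, 'D_v g x) | apply/cvg_lim].
Qed.

Lemma cont_at_of_is_cderive (F : R -> C) (s : R) (d : C) : is_cderive F s d -> cont_at F s.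
Proof.
by move=> [/is_derive1_continuous d1 /is_derive1_continuous d2].
Qed.

Lemma C1path_derive1 (g : R -> C2) (X Y dX dY : R -> C) (s : R) :
  C1path g X Y dX dY -> 0 < s < 1 ->
  cplx (derive1 g s).1 = dX s /\ cplx (derive1 g s).2 = dY s.
Proof.
move=> gP s01.
have sI := seg_interior s01.
have [gX gY [x1 x2] [y1 y2] _] := gP s sI.
have dg : is_derive s 1 g ((complex.Re (dX s), complex.Im (dX s)),
                           (complex.Re (dY s), complex.Im (dY s))).
  have := is_derive_pair (is_derive_pair x1 x2) (is_derive_pair y1 y2).
  apply: near_eq_is_derive; move: (s01) => /andP[s0 s1].
  have : nbhs s (`]0, 1[%classic : set R).
    by apply: open_nbhs_nbhs; split; [exact: interval_open|rewrite /= in_itv /= s0].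
  apply: filterS => t t01; have tI : seg t by exact: subset_itv_oo_cc t01.
  have [<- <- _ _ _] := gP t tI; rewrite /cplx /=.
  by case: (g t) => [[? ?] [? ?]].
rewrite derive1E; have [_ ->] := dg; rewrite /cplx /=.
by case: (dX s) (dY s) => [? ?] [? ?].
Qed.

Lemma path_integralE (w : form1 R) (g : R -> C2) (X Y dX dY : R -> C) :
  C1path g X Y dX dY ->
  path_integral w g =
  cint (fun s => evalC w.1 (X s) (Y s) * dX s + evalC w.2 (X s) (Y s) * dY s).
Proof.
move=> gP; rewrite /path_integral -/(cint _); apply: cint_ext => s s01.
  have [_ _ dXs dYs [cX cY]] := gP s s01.
  have cXs := cont_at_of_is_cderive dXs; have cYs := cont_at_of_is_cderive dYs.
  exact: (cont_atD (cont_atM (cont_at_evalC _ cXs cYs) cX)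
                   (cont_atM (cont_at_evalC _ cXs cYs) cY)).
have sI := seg_interior s01.
have [gX gY _ _ _] := gP s sI; have [-> ->] := C1path_derive1 gP s01.
by rewrite /eval2 -/(evalC _ _ _) -/(evalC w.2 _ _) gX gY.
Qed.

Lemma smooth_path_C1 (g : R -> C2) (O : set R) (G : R -> C2) :
  open O -> @seg R `<=` O -> (forall k, Ck k O G) -> (forall s, seg s -> g s = G s) ->
  C1path g (fun s => cplx (G s).1) (fun s => cplx (G s).2)
    (fun s => cplx ('D_1 G s).1) (fun s => cplx ('D_1 G s).2).
Proof.
move=> oO sO CG gG s s01; have Os := sO _ s01.
have d a b : is_derive s 1 (fun t => coord a b (G t)) (coord a b ('D_1 G s)).
  by have [dG _ _ _ _] := Ck_coord a b CG Os; exact: dG.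
have k a b : {for s, continuous (fun t => coord a b ('D_1 G t))}.
  by have [_ _ _ cG _] := Ck_coord a b CG Os; exact: cG.
rewrite (gG s s01); split; [by []|by []| | |].
- by split; [exact: (d true true)|exact: (d true false)].
- by split; [exact: (d false true)|exact: (d false false)].
- split; split; [exact: (k true true)|exact: (k true false)|
    exact: (k false true)|exact: (k false false)].
Qed.

Lemma path_in_C1 (H : poly2 R) (t : C) (g : R -> C2) : path_in H t g -> C1able g.
Proof.
move=> [[dom [G [oO sO CG gG]] ] _].
by do 4 eexists; exact: smooth_path_C1 oO sO CG gG.
Qed.

(** The kernel of a nonzero linear form on C^2 is a line. *)
Lemma det_kernel_eq0 (a b u v u' v' : C) : (a != 0) || (b != 0) ->
  a * u + b * v = 0 -> a * u' + b * v' = 0 -> u * v' - u' * v = 0.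
Proof.
move=> ab E E'.
have Ea : a * (u * v' - u' * v) = 0.
  have -> : a * (u * v' - u' * v) = (a * u + b * v) * v' - (a * u' + b * v') * v by ring.
  by rewrite E E' !mul0r subr0.
have Eb : b * (u * v' - u' * v) = 0.
  have -> : b * (u * v' - u' * v) = (a * u' + b * v') * u - (a * u + b * v) * u' by ring.
  by rewrite E E' !mul0r subr0.
by case/orP: ab => n0; apply: (mulfI n0); rewrite ?Ea ?Eb mulr0.
Qed.

Lemma noncritical_grad (H : poly2 R) (t : C) (p : C2) : ~ critical_value H t ->
  level H t p -> (eval2 (mderiv varx H) p != 0) || (eval2 (mderiv vary H) p != 0).
Proof.
move=> nc lp; apply/orP.
have [h0|] := eqVneq (eval2 (mderiv varx H) p) 0; last by left.
have [h1|] := eqVneq (eval2 (mderiv vary H) p) 0; last by right.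
case: nc; exists p; [exact: lp|move=> i].
suff [->|->] : i = varx \/ i = vary; [exact: h0|exact: h1|].
by case: i => [[|[|k]] lt_i] //; [left|right]; apply: val_inj.
Qed.

Lemma mixedC2_real_bilinear (U : set (R * R)) (a b c d : R) :
  mixedC2_real U (fun q => a + q.1 * b + q.2 * c + q.1 * q.2 * d)
    (fun q => b + q.2 * d) (fun q => c + q.1 * d) (fun=> d).
Proof.
have lin (f : R -> R) (k l s : R) : (forall t, f t = k + t * l) -> is_derive s 1 f l.
  move=> fE; have -> : f = cst k + (fun t => t * l) by apply/funext.
  rewrite -[l in X in is_derive _ _ _ X]add0r; apply: is_deriveD.
  have := is_derive_mul (is_derive_id s (1 : R)) (is_derive_cst l s (1 : R)).
  by rewrite mul1r mulr0 addr0.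
have c1 (q : R * R) : {for q, continuous (@fst R R)} by exact: cvg_fst.
have c2 (q : R * R) : {for q, continuous (@snd R R)} by exact: cvg_snd.
have cc (k : R) (q : R * R) : {for q, continuous (fun=> k)} by exact: cvg_cst.
move=> q _; split.
- by apply: (lin _ (a + q.2 * c) _) => t /=; ring.
- by apply: (lin _ (a + q.1 * b) _) => t /=; ring.
- by apply: (lin _ c _) => t /=; ring.
- by apply: (lin _ b _) => t /=; ring.
split.
- apply: (@continuousD _ _ _ (fun q : R * R => a + q.1 * b + q.2 * c)).
    apply: (@continuousD _ _ _ (fun q : R * R => a + q.1 * b)).
      by apply: (@continuousD _ _ _ (fun=> a)) => //; apply: continuousM.
    exact: continuousM.
  by apply: (@continuousM _ _ (fun q : R * R => q.1 * q.2)) => //; apply: continuousM.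
- by apply: (@continuousD _ _ _ (fun=> b)) => //; apply: continuousM.
- by apply: (@continuousD _ _ _ (fun=> c)) => //; apply: continuousM.
- exact: cc.
Qed.

(** The velocity of a curve along which H varies affinely is mapped by dH to the
    slope; the slope 0 expresses tangency to a level curve. *)
Lemma is_cderive_tangent (H : poly2 R) (X Y : R -> C) (s : R) (dX dY a b : C) :
  seg s -> is_cderive X s dX -> is_cderive Y s dY ->
  (forall t, seg t -> evalC H (X t) (Y t) = a + b * (t%:C)%C) ->
  evalC (mderiv varx H) (X s) (Y s) * dX + evalC (mderiv vary H) (X s) (Y s) * dY = b.
Proof.
move=> s01 hX hY HE.
exact: (is_cderive_affine_on_seg s01 (is_cderive_evalC H hX hY) HE).
Qed.

(** In the coordinates (r, s) |-> (r (1 - s), r s) the side r = 0 collapses to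
    a vertex, r = 1 is the hypotenuse, and s = 0, s = 1 are the legs.  Both
    partial derivatives are tangent to the level curve, so their determinant
    vanishes and [variation] gives d/dr J (r) = B (r, 1) - B (r, 0) for the
    integral J (r) along the segment of parameter r.  It remains to integrate
    over r, with J 0 = 0. *)
Lemma triangle_stokes (H : poly2 R) (t : C) (w : form1 R) (f : R * R -> C2) :
  ~ critical_value H t -> triangle_in H t f ->
  [/\ C1able (fun s => f (1 - s, s)),
      C1able (fun s => f (0, s)),
      C1able (fun s => f (s, 0)) &
      path_integral w (fun s => f (1 - s, s)) - path_integral w (fun s => f (0, s))
        + path_integral w (fun s => f (s, 0)) = 0].
Proof.
move=> nc [[dom [G [oO tO CG fG]] ] lf].
have s00 := seg0 R; have s11 := seg1 R.
pose m (q : R * R) : R * R := (q.1 * (1 - q.2), q.1 * q.2).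
pose U : set (R * R) := m @^-1` dom.
pose e (i : 'I_2) : R * R := if i == ord0 then (1, 0) else (0, 1).
pose b (i : 'I_2) : R := if i == ord0 then 1 else 0.
pose d (i : 'I_2) : R := if i == ord0 then -1 else 1.
pose c (i : 'I_2) (q : R * R) : R := 0 + q.1 * b i + q.2 * 0 + q.1 * q.2 * d i.
have mE q : \sum_i c i q *: e i = m q.
  rewrite !big_ord_recl big_ord0 /c /e /b /d /m /=.
  by congr (_, _) => /=; rewrite scaler0 ?addr0 ?add0r [_%:A]mulr1; ring.
have Cc i := @mixedC2_real_bilinear U 0 (b i) 0 (d i).
have cm : continuous m.
  move=> q; apply: (@continuous_at_pair _ _ _ (fun q : R * R => q.1 * (1 - q.2))
    (fun q : R * R => q.1 * q.2) q).
    apply: (@continuousM _ _ (fun q : R * R => q.1)); first exact: cvg_fst.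
    by apply: (@continuousB _ _ _ (fun q : R * R => 1 : R)); [exact: cvg_cst|exact: cvg_snd].
  by apply: (@continuousM _ _ (fun q : R * R => q.1)); [exact: cvg_fst|exact: cvg_snd].
have oU : open U by move/continuousP: cm; apply.
have UO q : U q -> dom (\sum_i c i q *: e i) by rewrite mE.
have [[xr [xs [xrs Dx]]] [yr [ys [yrs Dy]]]] := mixedC2_comp oO oU CG Cc UO.
set x := fun q => cplx (G (\sum_i c i q *: e i)).1 in Dx.
set y := fun q => cplx (G (\sum_i c i q *: e i)).2 in Dy.
have m_tri r s : seg r -> seg s -> tri (m (r, s)).
  rewrite /seg /= !in_itv /= => /andP[r0 r1] /andP[s0 s1].
  rewrite /tri /m /=; split; [by apply: mulr_ge0 => //; lra|exact: mulr_ge0|].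
  by rewrite -mulrDr subrK mulr1.
have sU r s : seg r -> seg s -> U (r, s) by move=> r01 s01; apply/tO/m_tri.
have lev r s : seg r -> seg s -> evalC H (x (r, s)) (y (r, s)) = t.
  move=> r01 s01; have := lf _ (m_tri _ _ r01 s01).
  by rewrite fG; [rewrite /level /eval2 /= /x /y mE|exact: m_tri].
have tan r s : seg r -> seg s -> xr (r, s) * ys (r, s) - xs (r, s) * yr (r, s) = 0.
  move=> r01 s01; have [dxr dxs _ _ _] := Dx _ (sU r s r01 s01).
  have [dyr dys _ _ _] := Dy _ (sU r s r01 s01).
  apply: (@det_kernel_eq0 (evalC (mderiv varx H) (x (r, s)) (y (r, s)))
                          (evalC (mderiv vary H) (x (r, s)) (y (r, s)))).
  - have := noncritical_grad nc (lf _ (m_tri _ _ r01 s01)).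
    by rewrite fG; [rewrite /eval2 /x /y mE|exact: m_tri].
  - apply: (is_cderive_tangent r01 dxr dyr (a := t)) => r' r'01.
    by rewrite lev // mul0r addr0.
  - apply: (is_cderive_tangent s01 dxs dys (a := t)) => s' s'01.
    by rewrite lev // mul0r addr0.
pose P q := evalC w.1 (x q) (y q); pose Q q := evalC w.2 (x q) (y q).
pose B q := P q * xr q + Q q * yr q.
pose J r := cint (fun s => P (r, s) * xs (r, s) + Q (r, s) * ys (r, s)).
have edge_s r (g : R -> C2) : seg r -> (forall s, seg s -> g s = G (m (r, s))) ->
    C1path g (fun s => x (r, s)) (fun s => y (r, s)) (fun s => xs (r, s)) (fun s => ys (r, s)).
  move=> r01 gE s s01; rewrite gE // -mE.
  have [_ dxs _ _ [_ _ cxs _]] := Dx _ (sU r s r01 s01).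
  have [_ dys _ _ [_ _ cys _]] := Dy _ (sU r s r01 s01).
  have cr : {for s, continuous (fun s : R => (r, s))}.
    by apply: continuous_at_pair; [exact: cvg_cst|exact: cvg_id].
  by split=> //; split; [exact: (cont_at_comp cr cxs)|exact: (cont_at_comp cr cys)].
have edge_r s (g : R -> C2) : seg s -> (forall r, seg r -> g r = G (m (r, s))) ->
    C1path g (fun r => x (r, s)) (fun r => y (r, s)) (fun r => xr (r, s)) (fun r => yr (r, s)).
  move=> s01 gE r r01; rewrite gE // -mE.
  have [dxr _ _ _ [_ cxr _ _]] := Dx _ (sU r s r01 s01).
  have [dyr _ _ _ [_ cyr _ _]] := Dy _ (sU r s r01 s01).
  have cr : {for r, continuous (fun r : R => (r, s))}.
    by apply: continuous_at_pair; [exact: cvg_id|exact: cvg_cst].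
  by split=> //; split; [exact: (cont_at_comp cr cxr)|exact: (cont_at_comp cr cyr)].
have E1 : C1path (fun s => f (1 - s, s)) (fun s => x (1, s)) (fun s => y (1, s))
    (fun s => xs (1, s)) (fun s => ys (1, s)).
  apply: edge_s => // s s01; have mE1 : m (1, s) = (1 - s, s) by rewrite /m /= !mul1r.
  by rewrite -mE1 fG //; exact: m_tri.
have E2 : C1path (fun s => f (0, s)) (fun r => x (r, 1)) (fun r => y (r, 1))
    (fun r => xr (r, 1)) (fun r => yr (r, 1)).
  apply: edge_r => // s s01; have mE1 : m (s, 1) = (0, s) by rewrite /m /= subrr mulr0 mulr1.
  by rewrite -mE1 fG //; exact: m_tri.
have E3 : C1path (fun s => f (s, 0)) (fun r => x (r, 0)) (fun r => y (r, 0))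
    (fun r => xr (r, 0)) (fun r => yr (r, 0)).
  apply: edge_r => // s s01; have mE1 : m (s, 0) = (s, 0) by rewrite /m /= subr0 mulr0 mulr1.
  by rewrite mE1 fG // -mE1; exact: m_tri.
split; [by do 4 eexists; exact: E1|by do 4 eexists; exact: E2|by do 4 eexists; exact: E3|].
rewrite (path_integralE w E1) (path_integralE w E2) (path_integralE w E3).
have cP q : U q -> cont_at P q /\ cont_at Q q.
  move=> Uq; have [_ _ _ _ [cx _ _ _]] := Dx q Uq; have [_ _ _ _ [cy _ _ _]] := Dy q Uq.
  by split; exact: cont_at_evalC.
have cB s r : seg s -> seg r -> cont_at (fun r => B (r, s)) r.
  move=> s01 r01; have Uq := sU r s r01 s01.
  have cr : {for r, continuous (fun r : R => (r, s))}.
    by apply: continuous_at_pair; [exact: cvg_id|exact: cvg_cst].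
  apply: (cont_at_comp (h := fun r => (r, s)) (F := B) cr).
  have [_ _ _ _ [_ cx _ _]] := Dx _ Uq; have [_ _ _ _ [_ cy _ _]] := Dy _ Uq.
  have [c1 c2] := cP _ Uq.
  exact: (cont_atD (cont_atM c1 cx) (cont_atM c2 cy)).
have dJ r : seg r -> is_cderive J r (B (r, 1) + (-1) * B (r, 0)).
  move=> r01; have := variation w oU (fun s s01 => sU r s r01 s01) Dx Dy.
  cbv zeta.
  have -> : cint (fun s => evalC (d1 w) (x (r, s)) (y (r, s)) *
      (xr (r, s) * ys (r, s) - xs (r, s) * yr (r, s))) = 0.
    rewrite -[RHS](mul0r (cint (fun=> 0))) -cintZ; last by move=> *; exact: cont_at_cst.
    apply: cint_ext => [s s01|s /seg_interior s01].
      by apply: cont_atM; exact: cont_at_cst.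
    by rewrite tan ?mulr0.
  by rewrite addr0 mulN1r.
have cB0 : ccont01 (fun r => (-1) * B (r, 0)).
  by move=> r r01; apply: cont_atM; [exact: cont_at_cst|exact: cB].
have cB1 : ccont01 (fun r => B (r, 1)) by move=> r r01; exact: cB.
have := cint_FTC dJ (fun r r01 => cont_atD (cB1 r r01) (cB0 r r01)).
rewrite cintD // cintZ; last by move=> r r01; exact: cB.
have -> : J 0 = 0.
  rewrite -[RHS](mul0r (cint (fun=> 0))) -cintZ; last by move=> *; exact: cont_at_cst.
  apply: cint_ext => [s s01|s /seg_interior s01].
    by apply: cont_atM; exact: cont_at_cst.
  have [_ dxs _ _ _] := Dx _ (sU 0 s s00 s01).
  have [_ dys _ _ _] := Dy _ (sU 0 s s00 s01).
  have m0 s' : m (0, s') = (0, 0) by rewrite /m /= !mul0r.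
  have xs0 : xs (0, s) = 0.
    apply: (is_cderive_unique dxs); rewrite /x /=.
    under eq_fun do rewrite mE m0; exact: is_cderive_cst.
  have ys0 : ys (0, s) = 0.
    apply: (is_cderive_unique dys); rewrite /y /=.
    under eq_fun do rewrite mE m0; exact: is_cderive_cst.
  by rewrite xs0 ys0 !mulr0 addr0.
rewrite subr0 -/(J 1) => <-; rewrite mulN1r.
by rewrite [X in X + _]addrAC subrr sub0r addNr.
Qed.

End Paths.


(** * Formal sums, cycles and homology *)

Section FormalSums.
Variables (T : eqType) (E : T -> T -> bool) (V : zmodType) (phi : T -> V).
Hypothesis Exx : forall a, E a a.
Hypothesis Esym : forall a b, E a b = E b a.
Hypothesis Etrans : forall a b c, E a b -> E b c -> E a c.

(** Group the terms by E-classes: phi is constant on a class and the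
    coefficients of a class add up to zero.  The induction removes the class of
    the first term. *)
Lemma formal_sum_eq0 (L : seq (int * T)) (D : T -> Prop) :
  (forall a b, D a -> D b -> E a b -> phi a = phi b) ->
  (forall g, \sum_(e <- L | E e.2 g) e.1 = 0) ->
  (forall e, e \in L -> D e.2) ->
  \sum_(e <- L) phi e.2 *~ e.1 = 0.
Proof.
move=> Ephi; have [k] := ubnP (size L); elim: k L => // k IH [|e0 L] /=.
  by rewrite big_nil.
rewrite ltnS => sL coef0 DL.
set L0 := e0 :: L in coef0 DL *.
have De0 : D e0.2 by apply: DL; rewrite mem_head.
rewrite (bigID (fun e => E e.2 e0.2)) /=.
have -> : \sum_(e <- L0 | E e.2 e0.2) phi e.2 *~ e.1 = 0.
  transitivity (\sum_(e <- L0 | E e.2 e0.2) phi e0.2 *~ e.1).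
    rewrite big_seq_cond [in RHS]big_seq_cond; apply: eq_bigr => e /andP[/DL De Ee].
    by rewrite (Ephi _ _ De De0 Ee).
  by rewrite -(raddf_sum ( *~%R (phi e0.2))) coef0.
rewrite add0r -big_filter; apply: IH.
- rewrite /= Exx /=; apply: leq_ltn_trans sL.
  by rewrite size_filter count_size.
- move=> g; rewrite big_filter_cond.
  have [Eg|nEg] := boolP (E e0.2 g).
    rewrite big1_idem ?addr0 // => e /andP[ne Eeg].
    by move: ne; rewrite (Etrans Eeg) // Esym.
  rewrite -[RHS](coef0 g); apply: eq_bigl => e; apply: andb_idl => Eeg.
  by apply: contra nEg => Ee; rewrite (Etrans _ Eeg) // Esym.
- by move=> e; rewrite mem_filter => /andP[_ /DL].
Qed.

End FormalSums.

Section ChainIntegrals.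
Variable R : realType.
Local Notation C := R[i].
Local Notation C2 := ((R * R) * (R * R))%type.

(** The boundary of a cycle vanishes as a formal sum of points. *)
Lemma cycle_boundary_eq0 (V : zmodType) (H : poly2 R) (t : C) (c : chain1 R) (phi : C2 -> V) :
  is_cycle H t c -> \sum_(e <- c) (phi (e.2 1) - phi (e.2 0)) *~ e.1 = 0.
Proof.
move=> [_ bdry].
(* the boundary of c as a formal sum of points *)
pose L : seq (int * C2) := flatten [seq [:: (e.1, e.2 1); (- e.1, e.2 0)] | e <- c].
have sumL (W : zmodType) (F : int * C2 -> W) P :
    \sum_(e <- L | P e) F e = \sum_(e <- c) ((if P (e.1, e.2 1) then F (e.1, e.2 1) else 0)
      + (if P (- e.1, e.2 0) then F (- e.1, e.2 0) else 0)).
  rewrite /L big_flatten big_map; apply: eq_bigr => e _.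
  by rewrite !big_cons big_nil /=; do 2!case: ifP => _; rewrite ?addr0 ?add0r ?addr0.
transitivity (\sum_(e <- L) phi e.2 *~ e.1).
  by rewrite sumL; apply: eq_bigr => e _; rewrite /= mulrzBl mulrNz.
apply: (@formal_sum_eq0 _ eq_op _ phi _ _ _ L (fun=> True)) => //.
- by move=> a b d /eqP -> /eqP ->.
- by move=> a b _ _ /eqP ->.
- move=> p; rewrite sumL -[RHS](bdry p); apply: eq_bigr => e _ /=.
  by case: eqP; case: eqP; rewrite ?subrr ?subr0 ?sub0r ?mulr0 ?mulr1 ?mulrN1 ?addr0 ?add0r ?subrr.
Qed.

Lemma C1able_ext_integral (w : form1 R) (g g' : R -> C2) : C1able g ->
  (forall s, seg s -> g s = g' s) -> path_integral w g = path_integral w g'.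
Proof.
move=> [X [Y [dX [dY gP]]]] gg'.
have g'P : C1path g' X Y dX dY by move=> s s01; rewrite -gg' //; exact: gP.
by rewrite (path_integralE w gP) (path_integralE w g'P).
Qed.

(** The formal sum c - c' - boundary2 b has zero coefficients, so by
    [formal_sum_eq0] integrals over it add up to zero, and the boundary
    contributes zero by [triangle_stokes]. *)
Lemma homologous_integral (H : poly2 R) (t : C) (w : form1 R) (c c' : chain1 R) :
  ~ critical_value H t ->
  (forall e, e \in c -> C1able e.2) -> (forall e, e \in c' -> C1able e.2) ->
  homologous H t c c' -> chain_integral w c = chain_integral w c'.
Proof.
move=> nc Cc Cc' [b bT coefE].
pose opp (l : chain1 R) : chain1 R := [seq (- e.1, e.2) | e <- l].
pose L := c ++ opp c' ++ opp (boundary2 b).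
have sum_opp (l : chain1 R) : \sum_(e <- opp l) path_integral w e.2 *~ e.1 = - chain_integral w l.
  by rewrite big_map -sumrN; apply: eq_bigr => e _ /=; rewrite mulrNz.
have bd0 : chain_integral w (boundary2 b) = 0.
  rewrite /chain_integral big_flatten big_map big_seq big1 // => e /bT eT.
  have sum3 (x y z : C) (k : int) : x - y + z = 0 ->
      x *~ k + (y *~ (- k) + (z *~ k + 0)) = 0.
    by move=> xyz; rewrite addr0 addrA mulrNz -mulNrz -!mulrzDl xyz mul0rz.
  have [_ _ _ stokes] := triangle_stokes w nc eT.
  by rewrite !big_cons big_nil; exact: sum3 stokes.
apply/eqP; rewrite -subr_eq0; apply/eqP.
have : \sum_(e <- L) path_integral w e.2 *~ e.1 = 0; last first.
  by rewrite /L !big_cat /= !sum_opp bd0 oppr0 addr0.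
pose E (a g : R -> C2) := `[< forall s, seg s -> a s = g s >].
apply: (@formal_sum_eq0 _ E _ _ _ _ _ L (@C1able R)).
- by move=> a; apply/asboolP.
- by move=> a g; apply/asboolP/asboolP => h s s01; rewrite h.
- by move=> a g k /asboolP h1 /asboolP h2; apply/asboolP => s s01; rewrite h1 ?h2.
- by move=> a g Ca _ /asboolP; exact: C1able_ext_integral.
- move=> g; have /eqP := coefE g; rewrite -subr_eq0 => /eqP.
  rewrite /L !big_cat /= !big_map /= !sumrN addrA; exact.
- move=> e; rewrite !mem_cat => /or3P[/Cc //|/mapP[e' /Cc' + ->]//|/mapP[e' e'b ->]] /=.
  move: e'b => /flatten_mapP[T /bT eT].
  have [E1 E2 E3 _] := triangle_stokes w nc eT.
  by rewrite !inE => /or3P[] /eqP -> /=.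
Qed.

End ChainIntegrals.


(** * Gelfand-Leray integrals *)

Section GelfandLeray.
Variable R : realType.
Local Notation C := R[i].
Local Notation C2 := ((R * R) * (R * R))%type.
Local Notation Re := (@complex.Re R).
Local Notation Im := (@complex.Im R).

Definition cbar (z : C) : C := Re z +i* (- Im z).

Lemma cont_at_bar (T : topologicalType) (F : T -> C) (x : T) :
  cont_at F x -> cont_at (fun t => cbar (F t)) x.
Proof. by move=> [F1 F2]; split => //=; exact: continuousN. Qed.

Lemma ReV (z : C) : Re z^-1 = Re z / (Re z ^+ 2 + Im z ^+ 2).
Proof. by case: z. Qed.

Lemma ImV (z : C) : Im z^-1 = - (Im z / (Re z ^+ 2 + Im z ^+ 2)).
Proof. by case: z. Qed.

Lemma sqr_norm_neq0 (z : C) : z != 0 -> Re z ^+ 2 + Im z ^+ 2 != 0.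
Proof.
apply: contra; rewrite paddr_eq0 ?sqr_ge0 // !sqrf_eq0 => /andP[/eqP r /eqP i].
by apply/eqP/complex_eq; rewrite ?r ?i.
Qed.

Lemma cont_atV (T : topologicalType) (F : T -> C) (x : T) :
  F x != 0 -> cont_at F x -> cont_at (fun t => (F t)^-1) x.
Proof.
move=> Fx [F1 F2].
have cden : {for x, continuous (fun t => (Re (F t) ^+ 2 + Im (F t) ^+ 2)^-1)}.
  apply: cvgV; first exact: sqr_norm_neq0.
  apply: (@continuousD _ _ _ (fun t => Re (F t) ^+ 2)).
    exact: (@continuousM _ _ (fun t => Re (F t))).
  exact: (@continuousM _ _ (fun t => Im (F t))).
split.
  by apply: (continuous_at_ext (fun t => esym (ReV _))); exact: continuousM.
apply: (continuous_at_ext (fun t => esym (ImV _))).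
by apply: (@continuousN _ _ _ (fun t => Im (F t) / _)); exact: continuousM.
Qed.

Lemma bar_norm_neq0 (a b : C) : (a != 0) || (b != 0) -> a * cbar a + b * cbar b != 0.
Proof.
have E (z : C) : Re (z * cbar z) = Re z ^+ 2 + Im z ^+ 2 by rewrite ReM /=; ring.
move=> ab; apply/eqP => /(congr1 Re) /eqP; rewrite ReD !E /=.
have nn (z : C) : 0 <= Re z ^+ 2 + Im z ^+ 2 by rewrite addr_ge0 ?sqr_ge0.
by rewrite paddr_eq0 //; case/orP: ab => /sqr_norm_neq0/negPf ->; rewrite ?andbF.
Qed.

(** The scalar l such that (u, v) = l (- b, a), for (u, v) in the kernel of the
    linear form (a, b).  The Hermitian formula is continuous wherever (a, b) is
    nonzero, whichever of a and b vanishes. *)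
Definition tangent_coef (a b u v : C) : C :=
  (v * cbar a - u * cbar b) / (a * cbar a + b * cbar b).

Lemma tangent_coefE (a b u v : C) : (a != 0) || (b != 0) -> a * u + b * v = 0 ->
  u = - (tangent_coef a b u v * b) /\ v = tangent_coef a b u v * a.
Proof.
move=> /bar_norm_neq0 d0 E; rewrite /tangent_coef.
move: (cbar a) (cbar b) d0 => a' b' d0; split; apply: (mulIf d0).
  have -> : - ((v * a' - u * b') / (a * a' + b * b') * b) * (a * a' + b * b') =
    - ((v * a' - u * b') * b) by field.
  have -> : u * (a * a' + b * b') = (a * u + b * v) * a' - (v * a' - u * b') * b by ring.
  by rewrite E mul0r sub0r.
have -> : (v * a' - u * b') / (a * a' + b * b') * a * (a * a' + b * b') =
  (v * a' - u * b') * a by field.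
have -> : v * (a * a' + b * b') = (a * u + b * v) * b' + (v * a' - u * b') * a by ring.
by rewrite E mul0r add0r.
Qed.

(** Substituting (u, v) = l (- b, a) turns the determinant into l times the value
    of the linear form at (u', v'). *)
Lemma det_tangent_coef (a b u v u' v' h : C) : (a != 0) || (b != 0) ->
  a * u + b * v = 0 -> a * u' + b * v' = h ->
  u' * v - u * v' = h * tangent_coef a b u v.
Proof.
move=> ab E <-; have [u_eq v_eq] := tangent_coefE ab E.
move: (tangent_coef a b u v) u_eq v_eq => l -> ->; ring.
Qed.

Lemma cont_at_tangent_coef (T : topologicalType) (a b u v : T -> C) (x : T) :
  (a x != 0) || (b x != 0) ->
  cont_at a x -> cont_at b x -> cont_at u x -> cont_at v x ->
  cont_at (fun t => tangent_coef (a t) (b t) (u t) (v t)) x.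
Proof.
move=> ab ca cb cu cv; have ca' := cont_at_bar ca; have cb' := cont_at_bar cb.
apply: (@cont_atM _ _ (fun t => v t * cbar (a t) - u t * cbar (b t))).
  exact: (cont_atD (cont_atM cv ca') (cont_atN (cont_atM cu cb'))).
apply: (@cont_atV _ (fun t => a t * cbar (a t) + b t * cbar (b t))).
  exact: bar_norm_neq0.
exact: (cont_atD (cont_atM ca ca') (cont_atM cb cb')).
Qed.

Variable H : poly2 R.
Let Hx := mderiv varx H.
Let Hy := mderiv vary H.

(** The value on a velocity (u, v) of the quotient of f dx /\ dy by dH. *)
Definition gl_integrand (f : poly2 R) (x y u v : C) : C :=
  evalC f x y * tangent_coef (evalC Hx x y) (evalC Hy x y) u v.

Definition gl_path (f : poly2 R) (g : R -> C2) : C :=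
  cint (fun s => gl_integrand f (cplx (g s).1) (cplx (g s).2)
                         (cplx (derive1 g s).1) (cplx (derive1 g s).2)).

Definition gl_integral (f : poly2 R) (c : chain1 R) : C :=
  \sum_(e <- c) gl_path f e.2 *~ e.1.

Lemma cont_at_gl_integrand (T : topologicalType) f (X Y u v : T -> C) (x : T) :
  (evalC Hx (X x) (Y x) != 0) || (evalC Hy (X x) (Y x) != 0) ->
  cont_at X x -> cont_at Y x -> cont_at u x -> cont_at v x ->
  cont_at (fun t => gl_integrand f (X t) (Y t) (u t) (v t)) x.
Proof.
move=> nz cX cY cu cv.
apply: (@cont_atM _ _ (fun t => evalC f (X t) (Y t))); first exact: cont_at_evalC.
apply: (@cont_at_tangent_coef _ (fun t => evalC Hx (X t) (Y t))
  (fun t => evalC Hy (X t) (Y t))) => //; exact: cont_at_evalC.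
Qed.

Section OnePath.
Variables (t : C) (g : R -> C2).
Hypothesis nc : ~ critical_value H t.
Hypothesis gt : forall s, seg s -> level H t (g s).
Variables (X Y dX dY : R -> C).
Hypothesis gP : C1path g X Y dX dY.

Lemma level_C1path s : seg s -> evalC H (X s) (Y s) = t.
Proof. by move=> s01; have [<- <- _ _ _] := gP s01; exact: gt. Qed.

Lemma grad_C1path s : seg s ->
  (evalC Hx (X s) (Y s) != 0) || (evalC Hy (X s) (Y s) != 0).
Proof.
by move=> s01; have := noncritical_grad nc (gt s01); have [<- <- _ _ _] := gP s01.
Qed.

Lemma cont_gl_integrand f : ccont01 (fun s => gl_integrand f (X s) (Y s) (dX s) (dY s)).
Proof.
move=> s s01; have [_ _ hX hY [cdX cdY]] := gP s01.
apply: cont_at_gl_integrand => //; [exact: grad_C1path|exact: cont_at_of_is_cderive hX|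
  exact: cont_at_of_is_cderive hY].
Qed.

Lemma gl_pathE f : gl_path f g = cint (fun s => gl_integrand f (X s) (Y s) (dX s) (dY s)).
Proof.
apply: cint_ext; first exact: cont_gl_integrand.
move=> s s01; have [-> ->] := C1path_derive1 gP s01.
have sI := seg_interior s01.
by have [-> -> _ _ _] := gP sI.
Qed.

Lemma gl_pathD f1 f2 : gl_path (f1 + f2) g = gl_path f1 g + gl_path f2 g.
Proof.
rewrite !gl_pathE -cintD; [|exact: cont_gl_integrand..].
by congr cint; apply/funext => s; rewrite /gl_integrand evalCD mulrDl.
Qed.

Lemma gl_pathZ (c : C) f : gl_path (c *: f) g = c * gl_path f g.
Proof.
rewrite !gl_pathE -cintZ; last exact: cont_gl_integrand.
by congr cint; apply/funext => s; rewrite /gl_integrand evalCZ mulrA.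
Qed.

Lemma gl_pathMH f : gl_path (H * f) g = t * gl_path f g.
Proof.
rewrite gl_pathE (gl_pathE f) -cintZ; last exact: cont_gl_integrand.
apply: cint_ext; first by move=> s s01; apply: cont_atM; [exact: cont_at_cst|exact: cont_gl_integrand].
move=> s /seg_interior sI.
by rewrite /gl_integrand evalCM level_C1path // mulrA.
Qed.

(** With (dX, dY) = l (- H_y, H_x), the Gelfand-Leray integrand of
    H_x Q - H_y P is l (H_x Q - H_y P) = P dX + Q dY. *)
Lemma gl_path_wedge (P Q : poly2 R) :
  gl_path (Hx * Q - Hy * P) g = path_integral (P, Q) g.
Proof.
rewrite gl_pathE (path_integralE (P, Q) gP); apply: cint_ext => /= [s s01|s].
  have [_ _ hX hY [cdX cdY]] := gP s01.
  have cX := cont_at_of_is_cderive hX; have cY := cont_at_of_is_cderive hY.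
  exact: (cont_atD (cont_atM (cont_at_evalC _ cX cY) cdX)
                   (cont_atM (cont_at_evalC _ cX cY) cdY)).
move=> /seg_interior sI.
have [_ _ hX hY _] := gP sI.
have tan : evalC Hx (X s) (Y s) * dX s + evalC Hy (X s) (Y s) * dY s = 0.
  apply: (is_cderive_tangent sI hX hY (a := t)) => s' s'01.
  by rewrite level_C1path // mul0r addr0.
rewrite /gl_integrand; have [] := tangent_coefE (grad_C1path sI) tan.
move: (tangent_coef _ _ _ _) => l -> ->.
rewrite evalCB !evalCM /Hx /Hy /=.
move: (evalC (mderiv varx H) _ _) (evalC (mderiv vary H) _ _) (evalC P _ _) (evalC Q _ _) => a b p q.
by ring.
Qed.

End OnePath.
End GelfandLeray.


(** * Moving one path across the fibres *)

Section PathFamily.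
Variable R : realType.
Local Notation C := R[i].
Local Notation C2 := ((R * R) * (R * R))%type.
Local Notation V6 := ((R * R) * ((R * R) * (R * R)))%type.

Definition basis6 (i : 'I_6) : V6 :=
  nth 0 [:: ((1, 0), 0); ((0, 1), 0); (0, ((1, 0), 0)); (0, ((0, 1), 0));
            (0, (0, (1, 0))); (0, (0, (0, 1)))] i.

(** Coordinates in the basis [basis6] of the space of pairs (t, p), with t in
    C = R^2 and p in C^2 = R^4. *)
Definition coords6 (t : R * R) (p : C2) (i : 'I_6) : R :=
  nth 0 [:: t.1; t.2; p.1.1; p.1.2; p.2.1; p.2.2] i.

Lemma basis6E t p : \sum_i coords6 t p i *: basis6 i = (t, p).
Proof.
rewrite !big_ord_recl big_ord0 /coords6 /basis6 /=.
have m1 (a : R) : a *: (1 : R) = a by exact: mulr1.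
have m0 (a : R) : a *: (0 : R) = 0 by exact: mulr0.
case: t p => [t1 t2] [[p1 p2] [p3 p4]].
by congr ((_, _), ((_, _), (_, _))); rewrite /= ?m0 ?m1 ?addr0 ?add0r.
Qed.

Lemma coords6P i : [\/ forall t p, coords6 t p i = t.1, forall t p, coords6 t p i = t.2 |
  exists a b, forall t p, coords6 t p i = coord a b p].
Proof.
case: i => [[|[|[|[|[|[|k']]]]]] // lt_i]; rewrite /coords6 /=.
- by constructor 1.
- by constructor 2.
- by constructor 3; exists true, true.
- by constructor 3; exists true, false.
- by constructor 3; exists false, true.
- by constructor 3; exists false, false.
Qed.

Lemma cint_eq (F F' : R -> C) : (forall s, seg s -> F s = F' s) -> cint F = cint F'.
Proof.
by move=> FF'; congr (_ +i* _); apply: eq_Rintegral => s; rewrite inE => /FF' ->.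
Qed.

Lemma is_cderive_near_eq (F F' : R -> C) (s : R) (d : C) :
  (\forall t \near s, F t = F' t) -> is_cderive F s d -> is_cderive F' s d.
Proof.
move=> nFF' [d1 d2]; split.
  by apply: near_eq_is_derive d1; apply: filterS nFF' => t ->.
by apply: near_eq_is_derive d2; apply: filterS nFF' => t ->.
Qed.

Lemma mixedC2_real_affine (U : set (R * R)) (a b : R) :
  mixedC2_real U (fun q => a + q.1 * b) (fun=> b) (fun=> 0) (fun=> 0).
Proof.
have := @mixedC2_real_bilinear R U a b 0 0.
have -> : (fun q : R * R => a + q.1 * b + q.2 * 0 + q.1 * q.2 * 0) = (fun q => a + q.1 * b).
  by apply/funext => q; ring.
have -> : (fun q : R * R => b + q.2 * 0) = (fun=> b) by apply/funext => q; ring.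
by have -> : (fun q : R * R => 0 + q.1 * 0) = (fun=> 0 : R) by apply/funext => q; ring.
Qed.

Lemma mixedC2_real_snd (U : set (R * R)) (O : set R) (g g' : R -> R) :
  (forall q, U q -> O q.2) ->
  (forall s, O s -> is_derive s 1 g (g' s)) -> (forall s, O s -> {for s, continuous g'}) ->
  mixedC2_real U (fun q => g q.2) (fun=> 0) (fun q => g' q.2) (fun=> 0).
Proof.
move=> UO dg cg' q /UO Oq.
have c2 (k : R -> R) : {for q.2, continuous k} -> {for q, continuous (fun q : R * R => k q.2)}.
  by move=> ck; apply: (@continuous_comp _ _ _ snd k); [exact: cvg_snd|].
have cg : {for q.2, continuous g} := is_derive1_continuous (dg _ Oq).
split=> /=; [exact: is_derive_cst|exact: dg|exact: is_derive_cst|exact: is_derive_cst|].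
split; [exact: c2|exact: cvg_cst|exact/c2/cg'|exact: cvg_cst].
Qed.

(** K extends a trivialization (t, q) |-> Psi t q of the fibration to an open
    subset of R^6, and G extends a path in the reference level curve to an open
    subset of R; the path moves over the parameters t in Vp. *)
Variables (H : poly2 R) (Vp : set (R * R)) (dom : set V6) (K : V6 -> C2)
  (Og : set R) (G : R -> C2).
Hypotheses (oV : open Vp) (odom : open dom) (CK : forall k, Ck k dom K)
  (oOg : open Og) (CG : forall k, Ck k Og G) (seg_Og : @seg R `<=` Og).
Hypothesis dom_G : forall t s, Vp t -> seg s -> dom (t, G s).
Hypothesis levK : forall t s, Vp t -> seg s -> level H (cplx t) (K (t, G s)).
Hypothesis nc : forall t, Vp t -> ~ critical_value H (cplx t).

Let x (q : (R * R) * R) : C := cplx (K (q.1, G q.2)).1.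
Let y (q : (R * R) * R) : C := cplx (K (q.1, G q.2)).2.
Let dS a b (q : (R * R) * R) : R :=
  \sum_i coords6 0 ('D_1 G q.2) i * coord a b ('D_(basis6 i) K (q.1, G q.2)).
Let DX (q : (R * R) * R) : C := dS true true q +i* dS true false q.
Let DY (q : (R * R) * R) : C := dS false true q +i* dS false false q.
Let ok (q : (R * R) * R) : Prop := Og q.2 /\ dom (q.1, G q.2).

Lemma cont_G s : Og s -> {for s, continuous G}.
Proof. exact: (CG 0). Qed.

Lemma is_derive_coords6 (t : R * R) s i : Og s ->
  is_derive s 1 (fun s => coords6 t (G s) i) (coords6 0 ('D_1 G s) i).
Proof.
move=> Os.
have d a b : is_derive s 1 (fun t => coord a b (G t)) (coord a b ('D_1 G s)).
  by have [dG _ _ _ _] := Ck_coord a b CG Os; exact: dG.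
have [E|E|[a [b E]]] := coords6P i.
- by under eq_fun do rewrite E; rewrite E; exact: is_derive_cst.
- by under eq_fun do rewrite E; rewrite E; exact: is_derive_cst.
- by under eq_fun do rewrite E; rewrite E; exact: d.
Qed.

Lemma cont_coords6 (t : R * R) s i : Og s ->
  {for s, continuous (fun s => coords6 t ('D_1 G s) i)}.
Proof.
move=> Os.
have k a b : {for s, continuous (fun t => coord a b ('D_1 G t))}.
  by have [_ _ _ cG _] := Ck_coord a b CG Os; exact: cG.
have [E|E|[a [b E]]] := coords6P i.
- by apply: (continuous_at_ext (fun s => esym (E _ _))); exact: cvg_cst.
- by apply: (continuous_at_ext (fun s => esym (E _ _))); exact: cvg_cst.
- by apply: (continuous_at_ext (fun s => esym (E _ _))); exact: k.
Qed.

Lemma is_derive_dS a b q : ok q ->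
  is_derive q.2 1 (fun s => coord a b (K (q.1, G s))) (dS a b q).
Proof.
move=> [Oq dq].
have dK v z (dz : dom z) : is_derive z v (coord a b \o K) (coord a b ('D_v K z)).
  by have [D _ _ _ _] := Ck_coord a b CK dz; exact: D.
have cK v z (dz : dom z) : {for z, continuous (fun z => coord a b ('D_v K z))}.
  by have [_ _ _ cD _] := Ck_coord a b CK dz; exact: cD.
have E s : \sum_i coords6 q.1 (G s) i *: basis6 i = (q.1, G s) := basis6E _ _.
have dq' : dom (\sum_i coords6 q.1 (G q.2) i *: basis6 i) by rewrite E.
have D := @curve_chain R V6 dom (coord a b \o K) 6 basis6
  (fun i z => coord a b ('D_(basis6 i) K z)) (fun i s => coords6 q.1 (G s) i)
  (fun i => coords6 0 ('D_1 G q.2) i) q.2 odom (fun i => dK (basis6 i))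
  (fun i => cK (basis6 i)) (fun i => is_derive_coords6 q.1 i Oq) dq'.
rewrite /dS -(E q.2); move: D; congr (is_derive _ _ _ _).
by apply/funext => s; rewrite E.
Qed.

Lemma cont_point q : ok q -> {for q, continuous (fun q : (R * R) * R => (q.1, G q.2))}.
Proof.
move=> [Oq _]; apply: continuous_at_pair; first exact: cvg_fst.
by apply: (@continuous_comp _ _ _ snd G); [exact: cvg_snd|exact: cont_G].
Qed.

Lemma cont_xy q : ok q -> cont_at x q /\ cont_at y q.
Proof.
move=> okq; have [_ dq] := okq.
have c a b : {for q, continuous (fun q : (R * R) * R => coord a b (K (q.1, G q.2)))}.
  apply: (@continuous_comp _ _ _ (fun q : (R * R) * R => (q.1, G q.2)) (coord a b \o K)).
    exact: cont_point.
  by have [_ _ cK _ _] := Ck_coord a b CK dq.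
by split; split; [exact: (c true true)|exact: (c true false)|
  exact: (c false true)|exact: (c false false)].
Qed.

Lemma cont_DXY q : ok q -> cont_at DX q /\ cont_at DY q.
Proof.
move=> okq; have [Oq dq] := okq.
have c a b : {for q, continuous (dS a b)}.
  apply: continuous_at_sum => i _; apply: continuousM.
    by apply: (@continuous_comp _ _ _ snd (fun s => coords6 0 ('D_1 G s) i));
      [exact: cvg_snd|exact: cont_coords6].
  apply: (@continuous_comp _ _ _ (fun q : (R * R) * R => (q.1, G q.2))
    (fun z => coord a b ('D_(basis6 i) K z))); first exact: cont_point.
  by have [_ _ _ cK _] := Ck_coord a b CK dq; exact: cK.
by split; split; [exact: (c true true)|exact: (c true false)|
  exact: (c false true)|exact: (c false false)].
Qed.

Lemma is_cderive_DXY q : ok q ->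
  is_cderive (fun s => x (q.1, s)) q.2 (DX q) /\ is_cderive (fun s => y (q.1, s)) q.2 (DY q).
Proof.
move=> okq; split; split.
- exact: (is_derive_dS true true okq).
- exact: (is_derive_dS true false okq).
- exact: (is_derive_dS false true okq).
- exact: (is_derive_dS false false okq).
Qed.

Lemma ok_V t s : Vp t -> seg s -> ok (t, s).
Proof. by move=> Vt s01; split; [exact: seg_Og|exact: dom_G]. Qed.

Lemma cont_slice (t : R * R) (s : R) : {for s, continuous (fun s : R => (t, s))}.
Proof. by apply: continuous_at_pair; [exact: cvg_cst|exact: cvg_id]. Qed.

Lemma transported_C1path (t : R * R) (g : R -> C2) : Vp t ->
  (forall s, seg s -> g s = K (t, G s)) ->
  C1path g (fun s => x (t, s)) (fun s => y (t, s)) (fun s => DX (t, s)) (fun s => DY (t, s)).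
Proof.
move=> Vt gE s s01; have okq := ok_V Vt s01.
have [dx dy] := is_cderive_DXY okq; have [cx cy] := cont_DXY okq.
rewrite (gE s s01); split; [by []|by []|exact: dx|exact: dy|split].
  exact: (cont_at_comp (@cont_slice t s) cx).
exact: (cont_at_comp (@cont_slice t s) cy).
Qed.

(** The integral along the moved path s |-> K (t, G s); DX and DY are its
    velocity. *)
Definition transported_integral (w : form1 R) (t : R * R) : C :=
  cint (fun s => evalC w.1 (x (t, s)) (y (t, s)) * DX (t, s) +
                 evalC w.2 (x (t, s)) (y (t, s)) * DY (t, s)).

Definition transported_gl (f : poly2 R) (t : R * R) : C :=
  cint (fun s => gl_integrand H f (x (t, s)) (y (t, s)) (DX (t, s)) (DY (t, s))).

(** The value of the form on the velocity of the point K (t, p) when t moves in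
    the direction h.  It depends on the path through the point p only, which is
    what makes it cancel over a cycle. *)
Definition endpoint_term (w : form1 R) (t h : R * R) (p : C2) : C :=
  evalC w.1 (cplx (K (t, p)).1) (cplx (K (t, p)).2) * cplx ('D_(h, 0) K (t, p)).1 +
  evalC w.2 (cplx (K (t, p)).1) (cplx (K (t, p)).2) * cplx ('D_(h, 0) K (t, p)).2.

Lemma near_line (t h : R * R) : Vp t -> \forall r \near (0 : R), Vp (t + r *: h).
Proof.
move=> Vt; have cl : {for (0 : R), continuous (fun r : R => t + r *: h)}.
  apply: (@continuousD _ _ _ (fun=> t)); first exact: cvg_cst.
  by apply: cvgZr_tmp; exact: cvg_id.
apply: cl; rewrite scale0r addr0; exact: open_nbhs_nbhs.
Qed.

(** [variation] for (r, s) |-> K (t + r *: h, G s).  Since H (K (t, G s)) is the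
    complex number t, dH takes the values h and 0 on the r- and s-derivatives,
    and [det_tangent_coef] gives the Gelfand-Leray integrand. *)
Lemma line_variation (w : form1 R) (t h : R * R) : Vp t ->
  is_cderive (fun r => transported_integral w (t + r *: h)) 0
    (endpoint_term w t h (G 1) - endpoint_term w t h (G 0) +
     cplx h * transported_gl (d1 w) t).
Proof.
move=> Vt; pose U : set (R * R) := [set q | ok (t + q.1 *: h, q.2)].
pose c i (q : R * R) := coords6 (t + q.1 *: h) (G q.2) i.
have ce q : \sum_i c i q *: basis6 i = (t + q.1 *: h, G q.2) by exact: basis6E.
have cline (q : R * R) : {for q, continuous (fun q : R * R => t + q.1 *: h)}.
  apply: (@continuousD _ _ _ (fun=> t)); first exact: cvg_cst.
  by apply: cvgZr_tmp; exact: cvg_fst.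
have oU : open U.
  rewrite openE => q [/= Oq dq]; rewrite /interior.
  have n1 : \forall q' \near q, Og q'.2.
    have c2 : {for q, continuous (@snd R R)} by exact: cvg_snd.
    by apply: c2; exact: open_nbhs_nbhs.
  have n2 : \forall q' \near q, dom (t + q'.1 *: h, G q'.2).
    have cpt : {for q, continuous (fun q : R * R => (t + q.1 *: h, G q.2))}.
      apply: continuous_at_pair; first exact: cline.
      by apply: (@continuous_comp _ _ _ snd G); [exact: cvg_snd|exact: cont_G].
    by apply: cpt; exact: open_nbhs_nbhs.
  by apply: filterS2 n1 n2 => q' O1 d1.
have Ur s : seg s -> U (0, s).
  by move=> s01; rewrite /U /= scale0r addr0; exact: ok_V.
have Cc i : mixedC2_real U (c i) (fun q => coords6 h 0 i) (fun q => coords6 0 ('D_1 G q.2) i)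
    (fun=> 0).
  have UO q : U q -> Og q.2 by case.
  have d a b s : Og s -> is_derive s 1 (fun t => coord a b (G t)) (coord a b ('D_1 G s)).
    by move=> Os; have [dG _ _ _ _] := Ck_coord a b CG Os; exact: dG.
  have k a b s : Og s -> {for s, continuous (fun t => coord a b ('D_1 G t))}.
    by move=> Os; have [_ _ _ cG _] := Ck_coord a b CG Os; exact: cG.
  have e2 (f f' : R * R -> R) : f =1 f' -> f = f' by move=> /funext.
  have [E|E|[a [b E]]] := coords6P i.
  - rewrite (e2 (c i) _ (fun q => E _ _)) (e2 _ _ (fun q => E h 0)).
    rewrite (e2 _ (fun=> 0) (fun q => E 0 ('D_1 G q.2))); exact: mixedC2_real_affine.
  - rewrite (e2 (c i) _ (fun q => E _ _)) (e2 _ _ (fun q => E h 0)).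
    rewrite (e2 _ (fun=> 0) (fun q => E 0 ('D_1 G q.2))); exact: mixedC2_real_affine.
  - rewrite (e2 (c i) _ (fun q => E _ _)) (e2 _ (fun=> 0) (fun q => etrans (E h 0) _)); last by case: (a); case: (b).
    rewrite (e2 _ _ (fun q => E 0 ('D_1 G q.2))); exact: (mixedC2_real_snd UO (d a b) (k a b)).
have UO q : U q -> dom (\sum_i c i q *: basis6 i) by rewrite ce => -[].
have [[xr [xs [xrs Dx]]] [yr [ys [yrs Dy]]]] := mixedC2_comp odom oU CK Cc UO.
have xE : (fun q : R * R => cplx (K (\sum_i c i q *: basis6 i)).1) =
    (fun q : R * R => x (t + q.1 *: h, q.2)) by apply/funext => q; rewrite ce.
have yE : (fun q : R * R => cplx (K (\sum_i c i q *: basis6 i)).2) =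
    (fun q : R * R => y (t + q.1 *: h, q.2)) by apply/funext => q; rewrite ce.
rewrite xE in Dx; rewrite yE in Dy.
have xsE q : U q -> xs q = DX (t + q.1 *: h, q.2).
  move=> Uq; have [_ dxs _ _ _] := Dx q Uq.
  exact: (is_cderive_unique dxs (is_cderive_DXY Uq).1).
have ysE q : U q -> ys q = DY (t + q.1 *: h, q.2).
  move=> Uq; have [_ dys _ _ _] := Dy q Uq.
  exact: (is_cderive_unique dys (is_cderive_DXY Uq).2).
(* for small r the data xs, ys are the velocity of the moved path *)
have near_U : \forall r \near (0 : R), forall s, seg s -> U (r, s).
  apply: (@tube R _ 0 U) => s s01; apply: open_nbhs_nbhs; split=> //; exact: Ur.
have velocity s a b : seg s ->
    is_derive (0 : R) 1 (fun r => coord a b (K (t + r *: h, G s))) (coord a b ('D_(h, 0) K (t, G s))).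
  move=> s01; have dz := dom_G Vt s01.
  have [/(_ (h, 0)) dK _ _ _ _] := Ck_coord a b CK dz.
  have line r : (t, G s) + r *: (h, 0) = (t + r *: h, G s).
    by congr (_, _) => /=; rewrite scaler0 addr0.
  have dK0 : is_derive ((t, G s) + (0 : R) *: (h, 0)) (h, 0) (coord a b \o K)
      (coord a b ('D_(h, 0) K (t, G s))) by rewrite scale0r addr0.
  have := is_derive_line dK0; congr (is_derive _ _ _ _).
  by apply/funext => r; rewrite line.
have xrE s : seg s -> xr (0, s) = cplx ('D_(h, 0) K (t, G s)).1.
  move=> s01; have [dxr _ _ _ _] := Dx _ (Ur s s01).
  apply: (is_cderive_unique dxr); split.
    exact: (velocity s true true s01).
  exact: (velocity s true false s01).
have yrE s : seg s -> yr (0, s) = cplx ('D_(h, 0) K (t, G s)).2.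
  move=> s01; have [dyr _ _ _ _] := Dy _ (Ur s s01).
  apply: (is_cderive_unique dyr); split.
    exact: (velocity s false true s01).
  exact: (velocity s false false s01).
have pt0 : t + (0 : R) *: h = t by rewrite scale0r addr0.
have val s : seg s -> evalC w.1 (x (t + (0 : R) *: h, s)) (y (t + (0 : R) *: h, s)) * xr (0, s) +
    evalC w.2 (x (t + (0 : R) *: h, s)) (y (t + (0 : R) *: h, s)) * yr (0, s) =
    endpoint_term w t h (G s).
  by move=> s01; rewrite pt0 xrE // yrE.
have wE : cint (fun s => evalC (d1 w) (x (t + (0 : R) *: h, s)) (y (t + (0 : R) *: h, s)) *
     (xr (0, s) * ys (0, s) - xs (0, s) * yr (0, s))) = cplx h * transported_gl (d1 w) t.
  rewrite pt0.
  have okc f : ccont01 (fun s => gl_integrand H f (x (t, s)) (y (t, s)) (DX (t, s)) (DY (t, s))).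
    by apply: (cont_gl_integrand (nc Vt) (fun s s01 => levK Vt s01)); exact: transported_C1path.
  rewrite /transported_gl -cintZ //; apply: cint_eq => s s01.
  have Uq := Ur s s01.
  have tC := transported_C1path Vt (fun s _ => erefl (K (t, G s))).
  have nz := grad_C1path (nc Vt) (fun s s01 => levK Vt s01) tC s01.
  have [_ _ hX hY _] := tC s s01.
  have tan : evalC (mderiv varx H) (x (t, s)) (y (t, s)) * DX (t, s) +
      evalC (mderiv vary H) (x (t, s)) (y (t, s)) * DY (t, s) = 0.
    apply: (is_cderive_tangent s01 hX hY (a := cplx t)) => s' s'01.
    by rewrite mul0r addr0; exact: (levK Vt s'01).
  have [dxr _ _ _ _] := Dx _ Uq; have [dyr _ _ _ _] := Dy _ Uq.
  have nrm : evalC (mderiv varx H) (x (t, s)) (y (t, s)) * xr (0, s) +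
      evalC (mderiv vary H) (x (t, s)) (y (t, s)) * yr (0, s) = cplx h.
    have := is_cderive_evalC H dxr dyr; rewrite /= pt0 => dH.
    apply: (is_cderive_unique dH).
    apply: (@is_cderive_near_eq (fun r => cplx (t + r *: h))).
      apply: filterS (near_line h Vt) => r Vr.
      by have := levK Vr s01.
    have lin (a b : R) : is_derive (0 : R) 1 (fun r => a + r * b) b.
      have := @mixedC2_real_affine setT a b (0, 0) I; by case.
    by split; exact: lin.
  rewrite (xsE _ Uq) (ysE _ Uq) /= pt0.
  by rewrite (det_tangent_coef nz tan nrm) /gl_integrand mulrCA.
have HV : is_cderive (fun r => cint (fun s =>
    evalC w.1 (x (t + r *: h, s)) (y (t + r *: h, s)) * xs (r, s) +
    evalC w.2 (x (t + r *: h, s)) (y (t + r *: h, s)) * ys (r, s))) 0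
    (endpoint_term w t h (G 1) - endpoint_term w t h (G 0) +
     cplx h * transported_gl (d1 w) t).
  by rewrite -wE -(val 1 (seg1 R)) -(val 0 (seg0 R)); exact (variation w oU Ur Dx Dy).
apply: is_cderive_near_eq HV; apply: filterS near_U => r Usr.
rewrite /transported_integral; apply: cint_eq => s s01.
by rewrite (xsE _ (Usr s s01)) (ysE _ (Usr s s01)).
Qed.

Lemma cont_transported_gl (f : poly2 R) (t : R * R) : Vp t ->
  cont_at (transported_gl f) t.
Proof.
move=> Vt; pose L q := gl_integrand H f (x q) (y q) (DX q) (DY q).
have cL t' s : Vp t' -> seg s -> cont_at L (t', s).
  move=> Vt' s01; have okq := ok_V Vt' s01.
  have [cx cy] := cont_xy okq; have [cdx cdy] := cont_DXY okq.
  apply: cont_at_gl_integrand => //.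
  have tC := transported_C1path Vt' (fun s _ => erefl (K (t', G s))).
  exact: (grad_C1path (nc Vt') (fun s s01 => levK Vt' s01) tC s01).
have nV : \forall t' \near t, Vp t' by exact: open_nbhs_nbhs.
split.
  apply: (@int01_continuous R _ t (fun q => complex.Re (L q))) => [s s01|].
    by have [] := cL t s Vt s01.
  apply: filterS nV => t' Vt' s s01.
  by have [] := cont_at_comp (@cont_slice t' s) (cL t' s Vt' s01).
apply: (@int01_continuous R _ t (fun q => complex.Im (L q))) => [s s01|].
  by have [] := cL t s Vt s01.
apply: filterS nV => t' Vt' s s01.
by have [] := cont_at_comp (@cont_slice t' s) (cL t' s Vt' s01).
Qed.

End PathFamily.


(** * From real directions to the complex derivative *)

Section ComplexDerivative.
Variable R : realType.
Local Notation C := R[i].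

Definition pairC (z : C) : R * R := (complex.Re z, complex.Im z).

Lemma pairCK (z : C) : cplx (pairC z) = z.
Proof. by case: z. Qed.

Lemma norm_pairC (z : C) : (`|pairC z|%:C)%C <= `|z|.
Proof.
have : (`|pairC z| = `|complex.Re z|) \/ (`|pairC z| = `|complex.Im z|).
  by rewrite prod_normE /= /Num.max; case: ifP => _; [right|left].
case: z => u v; rewrite normc_def /= => -[] -> /=; rewrite lecR -sqrtr_sqr ler_sqrt.
- by rewrite lerDl sqr_ge0.
- by rewrite addr_ge0 ?sqr_ge0.
- by rewrite lerDr sqr_ge0.
- by rewrite addr_ge0 ?sqr_ge0.
Qed.

(** The norm of R[i] takes its values in R[i]. *)
Lemma norm_le_parts (z : C) (a : R) :
  `|complex.Re z| <= a -> `|complex.Im z| <= a -> `|z| <= ((a + a)%:C)%C.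
Proof.
case: z => [u v] /= ua va; rewrite normc_def /= lecR.
have a0 : 0 <= a by rewrite (le_trans _ ua).
rewrite -(ger0_norm (addr_ge0 a0 a0)) -sqrtr_sqr ler_sqrt ?sqr_ge0 //.
have u2 : u ^+ 2 <= a ^+ 2 by rewrite -(real_normK (num_real u)) ler_pXn2r ?nnegrE.
have v2 : v ^+ 2 <= a ^+ 2 by rewrite -(real_normK (num_real v)) ler_pXn2r ?nnegrE.
have := mulr_ge0 a0 a0; nra.
Qed.

Lemma pos_complexP (e : C) : 0 < e -> exists2 r : R, 0 < r & e = (r%:C)%C.
Proof.
by case: e => [r i]; rewrite ltcE /= => /andP[/eqP -> r0]; exists r.
Qed.

Lemma open_cplx (V : set C^o) : open V -> open [set t : R * R | V (cplx t)].
Proof.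
move=> oV; rewrite openE => t /= Vt.
have /nbhs_normP[e /= /pos_complexP[r r0 ->] H] : nbhs (cplx t : C^o) V.
  exact: open_nbhs_nbhs.
suff : \forall t' \near t, V (cplx t') by [].
apply/(@nbhs_normP R (R * R)%type); exists (r / 4); first by rewrite /= divr_gt0.
move=> t' /=; rewrite prod_normE gt_max => /andP[/ltW h1 /ltW h2]; apply: H => /=.
apply: (@le_lt_trans _ _ ((r / 4 + r / 4)%:C)%C).
  by apply: norm_le_parts; rewrite /cplx /=.
by rewrite ltcR; lra.
Qed.

(** On the segment from t0 to t0 + h the derivative of S is h g with g close to
    g t0, so the mean value theorem on real and imaginary parts bounds
    S (t0 + h) - S t0 - h g t0 by e |h|. *)
Lemma is_derive_of_directional (X : C^o -> C^o) (S g : R * R -> C) (Vp : set (R * R)) (t0 : C) :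
  open Vp -> Vp (pairC t0) ->
  (forall t, Vp t -> X (cplx t) = S t) ->
  (forall t h, Vp t -> is_cderive (fun r => S (t + r *: h)) 0 (cplx h * g t)) ->
  cont_at g (pairC t0) ->
  is_derive (t0 : C^o) (1 : C^o) X (g (pairC t0)).
Proof.
move=> oV Vt0 XS dS [cg1 cg2]; set p0 := pairC t0 in Vt0 cg1 cg2 *.
have estimate (e : R) : 0 < e -> exists2 d : R, 0 < d & forall h : R * R, `|h| < d ->
    [/\ Vp (p0 + h),
        `|complex.Re (S (p0 + h) - S p0 - cplx h * g p0)| <= e * `|h| &
        `|complex.Im (S (p0 + h) - S p0 - cplx h * g p0)| <= e * `|h| ].
  move=> e0; have e2 : 0 < e / 2 by rewrite divr_gt0.
  have [d1 d1_gt0 H1] := (continuous_at_leP _ _).1 cg1 _ e2.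
  have [d2 d2_gt0 H2] := (continuous_at_leP _ _).1 cg2 _ e2.
  have /nbhs_normP[d3 /= d3_gt0 H3] : nbhs p0 Vp by exact: open_nbhs_nbhs.
  exists (Num.min d1 (Num.min d2 d3)); first by rewrite !lt_min d1_gt0 d2_gt0.
  move=> h; rewrite !lt_min => /and3P[h1 h2 h3].
  have scal (k : R) : `|k| <= 1 -> `|k *: h| <= `|h|.
    by move=> k1; rewrite normrZ ler_piMl.
  have near (d k : R) : `|h| < d -> `|k| <= 1 -> `|p0 + k *: h - p0| < d.
    by move=> hd k1; rewrite addrAC subrr add0r (le_lt_trans (scal _ k1)).
  have inV (k : R) : `|k| <= 1 -> Vp (p0 + k *: h).
    by move=> k1; apply: H3; rewrite /= distrC; exact: near.
  have shift (f : R * R -> R) (l r : R) :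
      is_derive (0 : R) 1 (fun k => f ((p0 + r *: h) + k *: h)) l ->
      is_derive r 1 (fun k => f (p0 + k *: h)) l.
    move=> /is_derive1P D; apply/is_derive1P => eps /D[d d0 {}D]; exists d => // k kd.
    have := D k kd; rewrite /= add0r scale0r addr0.
    by have -> : p0 + r *: h + k *: h = p0 + (r + k) *: h by rewrite scalerDl addrA.
  have dline (r : R) : `|r| <= 1 -> is_cderive (fun k => S (p0 + k *: h)) r (cplx h * g (p0 + r *: h)).
    move=> /inV Vr; have [D1 D2] := dS _ h Vr; split.
      exact: (shift (fun t => complex.Re (S t))).
    exact: (shift (fun t => complex.Im (S t))).
  have hh : `|h.1| <= `|h| /\ `|h.2| <= `|h|.
    by rewrite prod_normE !le_max !lexx orbT.
  have bound (k a b : R) : `|k| <= 1 -> `|a| <= e / 2 -> `|b| <= e / 2 ->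
      `|h.1 * a| + `|h.2 * b| <= e * `|h|.
    move=> k1 ae be; rewrite !normrM.
    have := ler_pM (normr_ge0 _) (normr_ge0 _) hh.1 ae.
    have := ler_pM (normr_ge0 _) (normr_ge0 _) hh.2 be.
    lra.
  have ReB (z w : C) : complex.Re (z - w) = complex.Re z - complex.Re w by rewrite ReD ReN.
  have ImB (z w : C) : complex.Im (z - w) = complex.Im z - complex.Im w by rewrite ImD ImN.
  split.
  - by rewrite -[h]scale1r; apply: inV; rewrite normr1.
  - have [|k k1] := @MVT_sym R (fun k => complex.Re (S (p0 + k *: h)))
       (fun k => complex.Re (cplx h * g (p0 + k *: h))) 0 1.
      by move=> r; rewrite subr0 normr1 => /dline[].
    rewrite normr1 in k1; rewrite !add0r scale1r scale0r addr0 mul1r => E.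
    rewrite !ReB E -ReB -mulrBr ReM ReB ImB /=.
    apply: (le_trans (ler_normB _ _)); apply: (bound k) => //.
      by apply: H1; exact: near.
    by apply: H2; exact: near.
  - have [|k k1] := @MVT_sym R (fun k => complex.Im (S (p0 + k *: h)))
       (fun k => complex.Im (cplx h * g (p0 + k *: h))) 0 1.
      by move=> r; rewrite subr0 normr1 => /dline[].
    rewrite normr1 in k1; rewrite !add0r scale1r scale0r addr0 mul1r => E.
    rewrite !ImB E -ImB -mulrBr ImM ReB ImB /=.
    apply: (le_trans (ler_normD _ _)); apply: (bound k) => //.
      by apply: H2; exact: near.
    by apply: H1; exact: near.
have cv : (fun h : C^o => h^-1 *: (X (h *: (1 : C^o) + t0) - X t0)) @ 0^' --> (g p0 : C^o).
  apply/cvgrPdist_le => e /pos_complexP[r r0 ->].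
  have r2 : 0 < r / 2 by rewrite divr_gt0.
  have [d d0 H] := estimate _ r2.
  apply/nbhs_normP; exists ((d%:C)%C); first by rewrite /= ltcR.
  move=> h /=; rewrite sub0r normrN => hd h0.
  have hp : `|pairC h| < d.
    by rewrite -ltcR; exact: le_lt_trans (norm_pairC h) hd.
  have [Vh hRe hIm] := H _ hp.
  have Xh : X (h *: (1 : C^o) + t0) = S (p0 + pairC h).
    rewrite -XS //; congr X; rewrite [h *: _]mulr1 addrC.
    by apply: complex_eq; rewrite ?ReD ?ImD.
  have Xt : X t0 = S p0 by rewrite -XS // pairCK.
  rewrite Xh Xt distrC.
  set D := S (p0 + pairC h) - S p0 in hRe hIm *.
  have -> : h^-1 *: (D : C^o) - g p0 = (D - h * g p0) / h :> C.
    by rewrite /GRing.scale /= mulrBl mulrC [h * g p0]mulrC mulfK.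
  rewrite normrM normfV ler_pdivrMr ?normr_gt0 //.
  rewrite pairCK in hRe hIm.
  apply: (le_trans (norm_le_parts hRe hIm)).
  have -> : r / 2 * `|pairC h| + r / 2 * `|pairC h| = r * `|pairC h| by field.
  rewrite rmorphM /= ler_wpM2l ?norm_pairC //.
  by rewrite ler0c ltW.
by split; [apply/cvg_ex; exists (g p0)|apply/cvg_lim].
Qed.

End ComplexDerivative.


(** * The derivative of an Abelian integral *)

Section ChainTransport.
Variable R : realType.
Local Notation C := R[i].
Local Notation C2 := ((R * R) * (R * R))%type.
Local Notation V6 := ((R * R) * ((R * R) * (R * R)))%type.

Lemma is_cderiveMz (F : R -> C) (s : R) (d : C) (m : int) :
  is_cderive F s d -> is_cderive (fun t => F t *~ m) s (d *~ m).
Proof.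
move=> dF; have := is_cderiveM dF (is_cderive_cst m%:~R s).
by rewrite mulr0 addr0 mulrzr; under eq_fun do rewrite mulrzr.
Qed.

Lemma cont_atMz (T : topologicalType) (F : T -> C) (x : T) (m : int) :
  cont_at F x -> cont_at (fun t => F t *~ m) x.
Proof.
move=> cF; have := cont_atM cF (cont_at_cst m%:~R x).
by under eq_fun do rewrite mulrzr.
Qed.

(** Sums [line_variation] over the edges of a chain.  Each edge comes with its
    own smooth extension, hence the existential statement and the induction on
    the chain. *)
Lemma chain_transport (H : poly2 R) (t0 : C) (V : set C^o) (Psi : C -> C2 -> C2)
    (dom : set V6) (K : V6 -> C2) (w : form1 R) (c : chain1 R) :
  open V -> V t0 -> (forall t, V t -> ~ critical_value H t) ->
  open dom -> (forall k, Ck k dom K) ->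
  (forall t q, V t -> level H t0 q -> dom (pairC t, q)) ->
  (forall t q, V t -> level H t0 q -> level H t (Psi t q)) ->
  (forall t q, V t -> level H t0 q -> Psi t q = K (pairC t, q)) ->
  (forall q, level H t0 q -> Psi t0 q = q) ->
  (forall e, e \in c -> path_in H t0 e.2) ->
  exists S g : R * R -> C,
  [/\ forall t, V t -> (forall e, e \in Defs.pushforward (Psi t) c -> C1able e.2) /\
        chain_integral w (Defs.pushforward (Psi t) c) = S (pairC t),
      forall t h, V (cplx t) -> is_cderive (fun r => S (t + r *: h)) 0
        (\sum_(e <- c) (endpoint_term K w t h (e.2 1) - endpoint_term K w t h (e.2 0)) *~ e.1
         + cplx h * g t),
      forall t, V (cplx t) -> cont_at g t &
      g (pairC t0) = gl_integral H (d1 w) c].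
Proof.
move=> oV Vt0 nc odom CK domK levPsi PsiK Psi0; elim: c => [|[m gam] c IH] pc.
  exists (fun=> 0), (fun=> 0); split.
  - by move=> t Vt; split=> //; rewrite /chain_integral big_nil.
  - by move=> t h Vt; rewrite big_nil mulr0 addr0; exact: is_cderive_cst.
  - by move=> t _; exact: cont_at_cst.
  - by rewrite /gl_integral big_nil.
have [|S [g [SE dS cg g0]]] := IH; first by move=> e ec; apply: pc; rewrite inE ec orbT.
have [[Og [G [oOg sOg CG gE]] ] lev] : path_in H t0 gam by apply: (pc (m, gam)); rewrite mem_head.
pose Vp : set (R * R) := [set t | V (cplx t)].
have oVp : open Vp by exact: open_cplx.
have levG s : seg s -> level H t0 (G s) by move=> s01; rewrite -gE //; exact: lev.
have pK (t : R * R) : pairC (cplx t) = t by case: t.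
have domG t s : Vp t -> seg s -> dom (t, G s).
  by move=> Vt s01; rewrite -(pK t); apply: domK => //; exact: levG.
have levK t s : Vp t -> seg s -> level H (cplx t) (K (t, G s)).
  move=> Vt s01; have := levPsi _ _ Vt (levG s s01).
  by rewrite PsiK ?pK //; exact: levG.
have ncV t : Vp t -> ~ critical_value H (cplx t) by exact: nc.
have s0 := seg0 R; have s1 := seg1 R.
pose J := transported_integral K G w; pose T := transported_gl H K G (d1 w).
have transp t (p : R -> C2) : V t -> (forall s, seg s -> p s = K (pairC t, G s)) ->
    C1able p /\ path_integral w p = J (pairC t).
  move=> Vt pE; have Vt' : Vp (pairC t) by rewrite /Vp /= pairCK.
  have P := transported_C1path odom CK CG sOg domG Vt' pE.
  by split; [do 4 eexists; exact: P|rewrite (path_integralE w P)].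
exists (fun t => J t *~ m + S t), (fun t => T t *~ m + g t); split.
- move=> t Vt; have [C1c intc] := SE t Vt.
  have [|Cp pE] := transp t (Psi t \o gam) Vt.
    by move=> s s01; rewrite /= gE // PsiK //; exact: levG.
  split; last by rewrite /chain_integral /= big_cons /= pE -intc.
  by move=> e; rewrite inE => /orP[/eqP -> //|]; exact: C1c.
- move=> t h Vt; rewrite big_cons /=.
  have := line_variation oVp odom CK oOg CG sOg domG levK ncV w h Vt.
  rewrite -!gE // => /(@is_cderiveMz _ _ _ m) D.
  have := is_cderiveD D (dS t h Vt); congr is_cderive.
  by rewrite mulrzDl -mulrzAr mulrDr addrACA.
- move=> t Vt; apply: cont_atD; last exact: cg.
  apply: cont_atMz; exact: (cont_transported_gl oVp odom CK CG sOg domG levK ncV (d1 w) Vt).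
- have Vt0' : Vp (pairC t0) by rewrite /Vp /= pairCK.
  have gE0 s : seg s -> gam s = K (pairC t0, G s).
    by move=> s01; rewrite gE // -PsiK ?Psi0 //; exact: levG.
  have P := transported_C1path odom CK CG sOg domG Vt0' gE0.
  have TE : gl_path H (d1 w) gam = T (pairC t0) := gl_pathE (nc _ Vt0) lev P (d1 w).
  have -> : gl_integral H (d1 w) ((m, gam) :: c) =
      gl_path H (d1 w) gam *~ m + gl_integral H (d1 w) c.
    by rewrite /gl_integral big_cons.
  by rewrite TE -g0.
Qed.

(** Near t0 the cycle delta t is homologous to the image of delta t0 under the
    trivialization, so both have the same integrals; over t0 the trivialization
    is the identity, which identifies the derivative. *)
Lemma is_derive_chain_integral (H : poly2 R) (U : set C^o) (delta : C -> chain1 R)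
    (w : form1 R) (t0 : C) :
  (forall t, U t -> ~ critical_value H t) -> continuous_family H U delta -> U t0 ->
  is_derive (t0 : C^o) (1 : C^o) (fun t : C^o => chain_integral w (delta t) : C^o)
    (gl_integral H (d1 w) (delta t0)).
Proof.
move=> nc [cyc loc] Ut0.
have [V [Psi [rho [oV Vt0 VU [triv1 _ [dom [K [odom subK CK KE]]] _ Psi0] hom]]]] := loc t0 Ut0.
have ncV t : V t -> ~ critical_value H t by move=> /VU; exact: nc.
have domK t q : V t -> level H t0 q -> dom (pairC t, q).
  by move=> Vt lq; apply: subK; rewrite /= -/(pairC t) pairCK.
have PsiK t q : V t -> level H t0 q -> Psi t q = K (pairC t, q).
  move=> Vt lq; have := KE (pairC t, q).
  by rewrite /= -/(pairC t) pairCK; apply.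
have levPsi t q : V t -> level H t0 q -> level H t (Psi t q).
  by move=> Vt lq; have [] := triv1 t q Vt lq.
have [pt0 _] := cyc t0 Ut0.
have [S [g [SE dS cg <-]]] :=
  chain_transport w oV Vt0 ncV odom CK domK levPsi PsiK Psi0 pt0.
apply: (@is_derive_of_directional R _ S g [set t | V (cplx t)] t0).
- exact: open_cplx.
- by rewrite /= pairCK.
- move=> t Vt; have [C1c intE] := SE _ Vt.
  have pK : pairC (cplx t) = t by case: (t).
  rewrite pK in intE; rewrite -intE.
  apply: (homologous_integral w (ncV _ Vt) _ C1c (hom _ Vt)).
  by move=> e ed; have [P _] := cyc _ (VU _ Vt); exact: path_in_C1 (P e ed).
- move=> t h Vt; have := dS t h Vt.
  by rewrite (cycle_boundary_eq0 (endpoint_term K w t h) (cyc t0 Ut0)) add0r.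
- by apply: cg; rewrite pairCK.
Qed.

End ChainTransport.


(** * The Picard-Fuchs system *)

Section PicardFuchs.
Variable R : realType.
Local Notation C := R[i].
Local Notation C2 := ((R * R) * (R * R))%type.

Section OneCycle.
Variables (H : poly2 R) (t : C) (c : chain1 R).
Hypotheses (nc : ~ critical_value H t) (cyc : is_cycle H t c).

Lemma cycle_C1 e : e \in c -> C1able e.2.
Proof. by have [pc _] := cyc; move=> /pc; exact: path_in_C1. Qed.

Lemma cycle_level e : e \in c -> forall s, seg s -> level H t (e.2 s).
Proof. by have [pc _] := cyc; move=> /pc[]. Qed.

Lemma gl_integral_linear (a : C) f g :
  gl_integral H (a *: f + g) c = a * gl_integral H f c + gl_integral H g c.
Proof.
rewrite /gl_integral mulr_sumr -big_split /= big_seq [RHS]big_seq.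
apply: eq_bigr => e ec; have [X [Y [dX [dY P]]]] := cycle_C1 ec.
rewrite (gl_pathD nc (cycle_level ec) P) (gl_pathZ nc (cycle_level ec) P).
by rewrite mulrzDl mulrzAr.
Qed.

Lemma gl_integral_sum (I : Type) (r : seq I) (a : I -> C) (f : I -> poly2 R) :
  gl_integral H (\sum_(j <- r) a j *: f j) c = \sum_(j <- r) a j * gl_integral H (f j) c.
Proof.
elim: r => [|j r IH]; last by rewrite !big_cons gl_integral_linear IH.
rewrite !big_nil; have := gl_integral_linear (-1) 0 0.
by rewrite scaler0 addr0 mulN1r addNr.
Qed.

Lemma gl_integralMH f : gl_integral H (H * f) c = t * gl_integral H f c.
Proof.
rewrite /gl_integral mulr_sumr big_seq [RHS]big_seq.
apply: eq_bigr => e ec; have [X [Y [dX [dY P]]]] := cycle_C1 ec.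
by rewrite (gl_pathMH nc (cycle_level ec) P) mulrzAr.
Qed.

Lemma gl_integral_wedge (P Q : poly2 R) :
  gl_integral H (mderiv varx H * Q - mderiv vary H * P) c = chain_integral (P, Q) c.
Proof.
rewrite /gl_integral /chain_integral big_seq [RHS]big_seq.
apply: eq_bigr => e ec; have [X [Y [dX [dY p]]]] := cycle_C1 ec.
by rewrite (gl_path_wedge nc (cycle_level ec) p).
Qed.

(** The integral of (P, Q) is the Gelfand-Leray integral of H_x Q - H_y P,
    which is linear in (P, Q). *)
Lemma chain_integral_linear (a : C) (w w' : form1 R) :
  chain_integral (a *: w.1 + w'.1, a *: w.2 + w'.2) c =
  a * chain_integral w c + chain_integral w' c.
Proof.
case: w w' => [P Q] [P' Q'] /=.
rewrite -(gl_integral_wedge P Q) -(gl_integral_wedge P' Q') -gl_integral_linear.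
rewrite -(gl_integral_wedge (a *: P + P') (a *: Q + Q')).
by rewrite -!mul_mpolyC; congr (gl_integral H _ c); ring.
Qed.

Lemma chain_integral_sum (I : Type) (r : seq I) (a : I -> C) (w : I -> form1 R) :
  chain_integral (\sum_(j <- r) a j *: (w j).1, \sum_(j <- r) a j *: (w j).2) c =
  \sum_(j <- r) a j * chain_integral (w j) c.
Proof.
elim: r => [|j r IH].
  rewrite !big_nil; have := chain_integral_linear (-1) (0, 0) (0, 0).
  by rewrite /= scaler0 addr0 mulN1r addNr.
rewrite !big_cons -IH.
by rewrite -(chain_integral_linear (a j) (w j)
  (\sum_(j <- r) a j *: (w j).1, \sum_(j <- r) a j *: (w j).2)).
Qed.

(** The integral of dF along a path is the increment of F, and increments cancel
    over a cycle. *)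
Lemma chain_integral_exact (F : poly2 R) :
  chain_integral (mderiv varx F, mderiv vary F) c = 0.
Proof.
rewrite -[RHS](cycle_boundary_eq0 (eval2 F) cyc) /chain_integral big_seq [RHS]big_seq.
apply: eq_bigr => e ec; have [X [Y [dX [dY P]]]] := cycle_C1 ec.
rewrite (path_integralE _ P); congr (_ *~ _).
rewrite (@cint_FTC _ (fun s => evalC F (X s) (Y s))).
- rewrite /eval2 -/(evalC F _ _) -/(evalC F (cplx (e.2 0).1) _).
  by have [-> -> _ _ _] := P 0 (seg0 R); have [-> -> _ _ _] := P 1 (seg1 R).
- by move=> s s01; have [_ _ hX hY _] := P s s01; exact: is_cderive_evalC.
move=> s s01; have [_ _ hX hY [cX cY]] := P s s01.
have kX := cont_at_of_is_cderive hX; have kY := cont_at_of_is_cderive hY.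
exact: (cont_atD (cont_atM (cont_at_evalC _ kX kY) cX)
                 (cont_atM (cont_at_evalC _ kX kY) cY)).
Qed.

End OneCycle.

Lemma deg2_leP (f : poly2 R) (d : nat) :
  (deg2 f <= d.+1)%N = (mmeasure mdeg f <= d)%N.
Proof.
rewrite /deg2; case: eqP => [->|_]; last by [].
by rewrite mmeasure0.
Qed.

(** Factors that are pairwise non-proportional have nonzero 2 x 2 determinants; a
    factor cannot vanish, being distinct from 0 times another one. *)
Lemma transversal_factors (H : poly2 R) (n : nat) :
  mmeasure mdeg H = n.+2 -> (0 < n)%N -> transversal_to_infinity H ->
  exists a b : 'I_n.+1 -> C,
    (forall j k, j != k -> a j * b k - a k * b j != 0) /\
    pihomog mdeg n.+1 H =
      \prod_k (a k *: mpolyX C (mnm1 (ord0 : 'I_2)) + b k *: mpolyX C (mnm1 (ord_max : 'I_2))).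
Proof.
rewrite /transversal_to_infinity => -> n_gt0 /= [l [Hl lP]].
exists (fun k => (l k).1), (fun k => (l k).2); split; last exact: Hl.
move=> j k jk; apply/negP => /eqP/eqP; rewrite subr_eq0 => /eqP det0.
have lk0 : (l k).1 != 0 \/ (l k).2 != 0.
  have [k1|] := eqVneq (l k).1 0; last by left.
  have [k2|] := eqVneq (l k).2 0; last by right.
  have kj : k != j by rewrite eq_sym.
  by case: (lP _ _ kj 0); rewrite scale0r; case: (l k) k1 k2 => u v /= -> ->.
case: lk0 => nz.
  apply: (lP _ _ jk ((l j).1 / (l k).1)).
  case: (l j) (l k) det0 nz => [a b] [a' b'] /= det0 nz; congr (_, _) => /=.
    by rewrite /GRing.scale /= divfK.
  by rewrite /GRing.scale /= mulrAC det0 mulrAC divff // mul1r.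
apply: (lP _ _ jk ((l j).2 / (l k).2)).
case: (l j) (l k) det0 nz => [a b] [a' b'] /= det0 nz; congr (_, _) => /=.
  by rewrite /GRing.scale /= mulrAC [b * a']mulrC -det0 mulfK.
by rewrite /GRing.scale /= divfK.
Qed.

End PicardFuchs.

Theorem mainTheorem3 (R : realType) (n : nat) (H : poly2 R)
    (omega : 'I_(n * (2 * n - 1)) -> form1 R) :
  (1 <= n)%N ->
  mmeasure mdeg H = n.+2 ->
  transversal_to_infinity H ->
  (forall i, monomial_form (omega i)) ->
  (forall i, (deg1 (omega i) <= 2 * n)%N) ->
  basis_forms2 (2 * n) (fun i => d1 (omega i)) ->
  exists A B : 'M[R[i]]_(n * (2 * n - 1)),
    forall (U : set (R[i])^o) (delta : R[i] -> chain1 R),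
      open U ->
      (forall t, U t -> ~ critical_value H t) ->
      continuous_family H U delta ->
      let X (i : 'I_(n * (2 * n - 1))) (t : (R[i])^o) : (R[i])^o :=
        chain_integral (omega i) (delta t) in
      forall t : (R[i])^o, U t ->
        exists2 dX : 'cV[R[i]]_(n * (2 * n - 1)),
          forall i, is_derive t (1 : (R[i])^o) (X i) (dX i 0) &
          (t *: 1%:M - A) *m dX = B *m \col_i X i t.
Proof.
move=> n_gt0 sizeH transH _ _ [degf _ spanf].
have [a [b [indep topH]]] := transversal_factors sizeH n_gt0 transH.
have nE : (2 * n = (2 * n - 1).+1)%N by lia.
have decomp i : exists ab : ('I_(n * (2 * n - 1)) -> R[i]) * ('I_(n * (2 * n - 1)) -> R[i]),
    forall t c, ~ critical_value H t -> is_cycle H t c ->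
    t * gl_integral H (d1 (omega i)) c =
    \sum_j ab.2 j * chain_integral (omega j) c +
    \sum_j ab.1 j * gl_integral H (d1 (omega j)) c.
  have sf : (mmeasure mdeg (d1 (omega i)) <= 2 * n - 1)%N.
    by rewrite -deg2_leP -nE.
  have sHf : (mmeasure mdeg (H * d1 (omega i)) <= 3 * n)%N.
    (* sizes are degrees plus one: H has degree n + 1, d omega_i at most 2n - 2 *)
    have -> : (3 * n = n.+2 + (2 * n - 2))%N by lia.
    apply: msizeM_leq; first by rewrite sizeH.
    by rewrite (leq_trans sf) //; lia.
  have [Q [P [r [fE sQ sP sr]]]] := jacobian_division n_gt0 indep sizeH topH sHf.
  have [al rE] : exists al, r = \sum_j al j *: d1 (omega j).
    by apply: spanf; rewrite nE deg2_leP.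
  have sd : (deg2 (d1 (- P, Q)) <= 2 * n)%N.
    rewrite nE deg2_leP /d1 /=; apply: msizeD_leq.
      by apply: msize_mderiv; rewrite (leq_trans sQ) //; lia.
    rewrite mmeasureN; apply: msize_mderiv; rewrite mmeasureN (leq_trans sP) //; lia.
  have [be etaE] := spanf _ sd.
  (* eta_i = - P dx + Q dy, up to the combination of the omega_j with the same
     differential, is closed *)
  have closed : mderiv varx (Q - \sum_j be j *: (omega j).2) =
                mderiv vary (- P - \sum_j be j *: (omega j).1).
    have dS : mderiv varx (\sum_j be j *: (omega j).2) - mderiv vary (\sum_j be j *: (omega j).1) =
        mderiv varx Q - mderiv vary (- P).
      have dsum v (G : 'I_(n * (2 * n - 1)) -> poly2 R) :
          mderiv v (\sum_j G j) = \sum_j mderiv v (G j) by exact: linear_sum.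
      rewrite -[RHS]/(d1 (- P, Q)) etaE !dsum -sumrB; apply: eq_bigr => j _ /=.
      by rewrite !mderivZ -scalerBr.
    have swap (p q p' q' : poly2 R) : p' - q' = p - q -> p - p' = q - q'.
      move=> e; apply/eqP; rewrite -subr_eq0.
      have -> : p - p' - (q - q') = (p - q) - (p' - q') by ring.
      by rewrite e subrr.
    by rewrite !mderivB; apply: swap.
  have [F [Fx Fy]] := closed_form_exact closed.
  exists (al, be) => t c nc cyc /=.
  rewrite -(gl_integralMH nc cyc) fE.
  have -> : Q * mderiv ord0 H + P * mderiv ord_max H + r =
    1 *: (mderiv varx H * Q - mderiv vary H * (- P)) + \sum_j al j *: d1 (omega j).
    by rewrite scale1r rE; ring.
  rewrite (gl_integral_linear nc cyc) mul1r (gl_integral_sum nc cyc).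
  rewrite (gl_integral_wedge nc cyc); congr (_ + _).
  have := chain_integral_linear nc cyc 1 (mderiv varx F, mderiv vary F)
    (\sum_j be j *: (omega j).1, \sum_j be j *: (omega j).2).
  rewrite /= Fx Fy !scale1r !subrK (chain_integral_sum nc cyc) => ->.
  by rewrite mul1r -Fx -Fy (chain_integral_exact cyc) add0r.
have [ab abE] := choice decomp.
exists (\matrix_(i, j) (ab i).1 j), (\matrix_(i, j) (ab i).2 j).
move=> U delta oU nc fam X t Ut.
exists (\col_i gl_integral H (d1 (omega i)) (delta t)).
  by move=> i; rewrite mxE; exact: (is_derive_chain_integral (omega i) nc fam Ut).
have [cyc _] := fam.
rewrite mulmxBl -scalemxAl mul1mx; apply/matrixP => i k.
rewrite !mxE; apply/eqP; rewrite subr_eq; apply/eqP.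
rewrite (abE i t (delta t) (nc t Ut) (cyc t Ut)).
by congr (_ + _); apply: eq_bigr => j _; rewrite !mxE.
Qed.
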